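(* Let $\Omega\subset\mathbb{R}^2$ be a bounded domain with smooth boundary and let $f\in L^1(\Omega)$. Then there exists $\lambda_0>0$ such that for every $\lambda$ with $0<\lambda<\lambda_0$ the problem $$\Delta^2 u=\det\left(D^2u\right)+\lambda f \ \text{ in } \Omega,\qquad u=0,\quad \frac{\partial u}{\partial n}=0\ \text{ on }\partial\Omega,$$ has at least two solutions $u\in W^{2,2}_0(\Omega)$.
   Context: $D^2u$ is the Hessian matrix of $u$, so $\det(D^2u)=u_{x_1x_1}u_{x_2x_2}-u_{x_1x_2}^2$; $n$ is the unit outward normal to $\partial\Omega$. $W^{2,2}_0(\Omega)$ is the completion of $\mathcal{C}_0^\infty(\Omega)$ in the norm of $W^{2,2}(\Omega)$; on it $\|\Delta u\|_2$ is an equivalent norm, and $W^{2,2}_0(\Omega)\subset L^\infty(\Omega)$. A solution is a function $u\in W^{2,2}_0(\Omega)$ such that $$\int_\Omega \Delta u\,\Delta\phi\,dx=\int_\Omega \det(D^2u)\,\phi\,dx+\lambda\int_\Omega f\phi\,dx\quad\text{for all }\phi\in W^{2,2}_0(\Omega).$$ *)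

(* Defs.v *)
From HB Require Import structures.
From mathcomp Require Import all_boot all_order all_algebra.
From mathcomp Require Import all_classical all_reals all_analysis.

Set Implicit Arguments.
Unset Strict Implicit.
Unset Printing Implicit Defensive.

Import Order.TTheory GRing.Theory Num.Theory.
Import numFieldNormedType.Exports.

Local Open Scope classical_set_scope.
Local Open Scope ring_scope.

Definition area (R : realType) :
    {measure set (measurableTypeR R * measurableTypeR R)%type
       -> \bar R} :=
  (@lebesgue_measure R \x @lebesgue_measure R)%E.

Definition is_domain (R : realType) (D : set (R * R)) :=
  [/\ open D, D !=set0 & connected D].

Definition smooth1 (R : realType) (g : R -> R) :=
  forall n t, derivable (derive1n n g) t 1.

(* Near each boundary point, and up to exchanging the two axes ([swap]) and
   reversing the second one ([flip]), D is the strict epigraph of a smooth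
   function of one variable. *)
Definition smooth_boundary (R : realType) (D : set (R * R)) :=
  forall p, (closure D `\` interior D) p ->
  exists (swap flip : bool) (g : R -> R), smooth1 g /\
    \forall x \near p,
      let y := if swap then (x.2, x.1) else x in
      D x <-> g y.1 < (if flip then - y.2 else y.2).

Definition axis (R : realType) (i : 'I_2) : R * R :=
  if i == 0 then (1, 0) else (0, 1).

Definition partial (R : realType) (s : seq 'I_2) (u : R * R -> R) : R * R -> R :=
  foldr (fun i w => 'D_(axis R i) w) u s.

Definition smooth (R : realType) (u : R * R -> R) :=
  forall s, continuous (partial s u) /\
            forall i x, derivable (partial s u) x (axis R i).

Definition test_function (R : realType) (D : set (R * R)) (phi : R * R -> R) :=
  [/\ smooth phi, compact (closure [set x | phi x != 0])
    & closure [set x | phi x != 0] `<=` D].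

(* Functions on D are represented by functions on the plane whose values
   outside D play no role. *)
Definition in_L2 (R : realType) (D : set (R * R)) (u : R * R -> R) : Prop :=
  (u \_ D) \in Lfun (@area R) 2%:E.

Definition L2norm (R : realType) (D : set (R * R)) (u : R * R -> R) : \bar R :=
  'N[@area R]_(2%:E)[EFin \o (u \_ D)].

Definition is_weak_partial (R : realType) (D : set (R * R)) (s : seq 'I_2)
    (u v : R * R -> R) :=
  in_L2 D v /\
  forall phi, test_function D phi ->
    \int[@area R]_(x in D) (u x * partial s phi x) =
    (-1) ^+ size s * \int[@area R]_(x in D) (v x * phi x).

(* A weak partial derivative is unique up to equality almost everywhere;
   [weak_partial] selects one representative. *)
Definition weak_partial (R : realType) (D : set (R * R)) (s : seq 'I_2)
    (u : R * R -> R) : R * R -> R :=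
  get [set v | is_weak_partial D s u v].

Definition in_W22 (R : realType) (D : set (R * R)) (u : R * R -> R) :=
  in_L2 D u /\
  forall s, (size s <= 2)%N -> exists v, is_weak_partial D s u v.

Definition W22norm (R : realType) (D : set (R * R)) (u : R * R -> R) : \bar R :=
  ((\sum_(k < 3) \sum_(s : k.-tuple 'I_2)
      L2norm D (weak_partial D s u) ^+ 2) `^ 2^-1)%E.

(* The completion of the test functions in the norm of W^{2,2}(D), realized as
   their closure in that Banach space. *)
Definition in_W22_0 (R : realType) (D : set (R * R)) (u : R * R -> R) :=
  in_W22 D u /\
  exists phi : nat -> R * R -> R, (forall k, test_function D (phi k)) /\
    W22norm D (phi k \- u) @[k --> \oo] --> 0%E.

Definition hessian (R : realType) (D : set (R * R)) (u : R * R -> R)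
    (x : R * R) : 'M[R]_2 :=
  \matrix_(i < 2, j < 2) weak_partial D [:: i; j] u x.

Definition laplacian (R : realType) (D : set (R * R)) (u : R * R -> R)
    (x : R * R) : R :=
  \tr (hessian D u x).

Definition is_solution (R : realType) (D : set (R * R)) (f : R * R -> R)
    (lambda : R) (u : R * R -> R) :=
  in_W22_0 D u /\
  forall phi, in_W22_0 D phi ->
    \int[@area R]_(x in D) (laplacian D u x * laplacian D phi x) =
    \int[@area R]_(x in D) (\det (hessian D u x) * phi x) +
    lambda * \int[@area R]_(x in D) (f x * phi x).

(* Main.v *)
Require Import Defs.
From HB Require Import structures.
From mathcomp Require Import all_boot all_order all_algebra.
From mathcomp Require Import all_classical all_reals all_analysis.
From mathcomp Require Import measurable_realfun ring lra.
Import Order.TTheory GRing.Theory Num.Theory.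
Import numFieldNormedType.Exports.
Local Open Scope classical_set_scope.
Local Open Scope ring_scope.
Set Implicit Arguments.
Unset Strict Implicit.
Unset Printing Implicit Defensive.

(** The equation is variational. Integration by parts makes the form
    trilinear u v phi = (1/2) * (integral of [u, v] phi) totally symmetric in
    u, v and phi, where [u, v] is the Monge-Ampère bracket, the polar form of
    2 det (D^2 u) ([trilinear_swap]). With the form
    a (u, v) = (integral of lap u * lap v), solutions are thus the critical
    points of the energy a (u, u) / 2 - T (u, u, u) / 3 - lambda * l (u), whose
    cubic part T (u, u, u) is continuous because the norm of a dominates the
    sup norm.

    The first solution is a local minimum. In a ball whose radius depends only
    on the constant of the embedding, the quadratic part dominates the cubic
    one; the energy is strongly convex there and, for small lambda, larger near
    the boundary sphere than at 0 ([local_minimum]). The second solution has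
    the form u + z. The second variation q of the energy at u is equivalent to
    a, and u + z is a solution exactly when q (z, .) = T (z, z, .). This
    homogeneous problem is solved by maximizing the cubic form on the unit ball
    of q: the maximum is positive, the form being positive on a product of two
    bumps ([exists_trilinear_pos]), and a maximizer satisfies the equation up to
    rescaling ([critical_sequence]). The two steps are joined in
    [two_approximate_solutions].

    All this takes place on the space of test functions, with Cauchy sequences
    of approximate solutions in place of solutions. The compactness used is
    that a sequence bounded for a has a subsequence that is Cauchy in the sup
    norm ([tsup_compact]). It is enough because |T (u, v, phi)| is at most
    sup |phi| * |u| * |v|, where only one factor carries the weaker norm. Both
    the compactness and the embedding follow from an elementary Hölder estimate
    by the mixed second derivative ([holder_estimate]): an increment of phi on a
    segment parallel to an axis is bounded by the integral of |D_0 D_1 phi| over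
    the strip through that segment.

    It remains to pass from Cauchy sequences to functions in W^{2,2}_0. The
    derivatives of order at most 2 converge in the mean, the functions
    themselves uniformly ([cauchy_W22_limit]); the limits are weak derivatives,
    and these are unique almost everywhere by the fundamental lemma of the
    calculus of variations ([fundamental_lemma]). In the equation the product
    of two second derivatives and a uniformly convergent sequence of test
    functions passes to the limit ([limit_solution]). The two solutions differ
    because their approximating sequences stay apart ([apart_limits]). *)

(** The plane with the product sigma-algebra on which [area] is a measure. *)
Local Notation meas2 R := (measurableTypeR R * measurableTypeR R)%type.

(** * Measurability in the plane *)

Section plane_measurability.
Context (R : realType).
Implicit Types (D : set (R * R)) (u v : R * R -> R).

(** Measurability in the plane refers to the product sigma-algebra; rational
    boxes form a countable base of the topology and are measurable for that
    algebra. *)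
Lemma open_plane_measurable D : open D -> @measurable _ (meas2 R) D.
Proof.
move=> oD.
pose Q (a b c d : rat) : set (R * R) :=
  `]ratr a : R, ratr b[%classic `*` `]ratr c : R, ratr d[%classic.
pose Q' a b c d := if pselect (Q a b c d `<=` D) then Q a b c d else set0.
suff -> : D = \bigcup_a \bigcup_b \bigcup_c \bigcup_d Q' a b c d.
  apply: bigcupT_measurable_rat => a; apply: bigcupT_measurable_rat => b.
  apply: bigcupT_measurable_rat => c; apply: bigcupT_measurable_rat => d.
  rewrite /Q'; case: (pselect (Q a b c d `<=` D)) => QD /=; last exact: measurable0.
  by apply: measurableX; apply: measurable_itv.
apply/seteqP; split => [[x y] Dxy|z [a _ [b _ [c _ [d _]]]]]; last first.
  by rewrite /Q'; case: (pselect (Q a b c d `<=` D)) => // QD /QD.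
have /nbhs_ballP[e /= e0 eD] : nbhs (x, y) D by exact: open_nbhs_nbhs.
have rat_near (t : R) : exists a b : rat, [/\ t - e < ratr a, ratr a < t, t < ratr b & ratr b < t + e].
  have te : t - e < t by rewrite ltrBlDr ltrDl.
  have et : t < t + e by rewrite ltrDl.
  have [a] := rat_in_itvoo te; have [b] := rat_in_itvoo et.
  by rewrite !in_itv/= => /andP[? ?] /andP[? ?]; exists a, b.
have [a [b [xa ax xb bx]]] := rat_near x.
have [c [d [yc cy yd dy]]] := rat_near y.
exists a => //; exists b => //; exists c => //; exists d => //.
rewrite /Q'; case: (pselect (Q a b c d `<=` D)) => [QD|[]] /=.
  by split => /=; rewrite in_itv/=; apply/andP.
move=> [p q] [/=]; rewrite !in_itv/= => /andP[ap pb] /andP[cq qd].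
apply: eD; split; rewrite /ball/= ltr_norml; lra.
Qed.

Lemma continuous_plane_measurable u : continuous u -> measurable_fun [set: meas2 R] u.
Proof.
move=> /continuousP cu; apply: (measurability _ (RGenOpens.measurableE R)).
move=> _ [_ [a [b ->] <-]]; rewrite setTI.
by apply: open_plane_measurable; apply: cu; exact: interval_open.
Qed.

End plane_measurability.

(** * Square-integrable functions and convergence in the mean *)

Section discriminant.
Context (R : realFieldType).

Lemma discriminant_le (a b c : R) :
  (forall t, 0 <= a + 2 * t * b + t ^+ 2 * c) -> b ^+ 2 <= a * c.
Proof.
move=> H.
have a0 : 0 <= a by have := H 0; rewrite mulr0 mul0r expr0n/= mul0r !addr0.
have c0 : 0 <= c.
  rewrite leNgt; apply/negP => c0.
  (* if c < 0, the quadratic is negative at this t, as t * c = c - (a + 2 |b|) *)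
  pose t := 1 + (a + 2 * `|b|) / - c.
  have t1 : 1 <= t.
    by rewrite lerDl divr_ge0//; [rewrite addr_ge0// mulr_ge0|rewrite oppr_ge0 ltW].
  have := H t; have bt : t * b <= t * `|b|.
    by rewrite ler_wpM2l ?ler_norm// (le_trans ler01).
  have tc : t * c = c - (a + 2 * `|b|) by rewrite /t; field; rewrite lt_eqF.
  have at_ : a <= a * t by rewrite ler_peMr.
  have -> : t ^+ 2 * c = t * (t * c) by ring.
  rewrite tc; have : t * c < 0 by rewrite pmulr_rlt0// (lt_le_trans ltr01).
  lra.
have [c_eq|c_gt] := eqVneq c 0.
  rewrite c_eq mulr0; have [->|bn0] := eqVneq b 0; first by rewrite expr0n.
  have := H (- (a + 1) / (2 * b)); rewrite c_eq mulr0 addr0.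
  have -> : a + 2 * (- (a + 1) / (2 * b)) * b = -1 by field.
  by rewrite leNgt ltrN10.
have {}c_gt : 0 < c by rewrite lt_neqAle eq_sym c_gt.
have := H (- b / c).
have -> : a + 2 * (- b / c) * b + (- b / c) ^+ 2 * c = (a * c - b ^+ 2) / c.
  by field; rewrite gt_eqF.
by rewrite pmulr_lge0 ?invr_gt0// subr_ge0.
Qed.

End discriminant.

Section square_integrable.
Context d (T : measurableType d) (R : realType).
Variables (mu : {measure set T -> \bar R}) (D : set T) (mD : measurable D).
Implicit Types f g : T -> R.

Definition sqintegrable f :=
  measurable_fun D f /\ mu.-integrable D (EFin \o (fun x => f x ^+ 2)).

Lemma sqintegrableM f g : sqintegrable f -> sqintegrable g ->
  mu.-integrable D (EFin \o (fun x => f x * g x)).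
Proof.
move=> [mf f2] [mg g2].
apply: (@le_integrable _ _ _ mu D mD _
    (EFin \o (fun x => f x ^+ 2 + g x ^+ 2))).
- by apply/measurable_EFinP; exact: measurable_funM.
- move=> x Dx /=; rewrite lee_fin ler_norml.
  have : 0 <= f x ^+ 2 + g x ^+ 2 by rewrite addr_ge0// sqr_ge0.
  move=> /ger0_norm ->.
  have := sqr_ge0 (f x - g x); have := sqr_ge0 (f x + g x).
  have := sqr_ge0 (f x); have := sqr_ge0 (g x).
  rewrite !sqrrD sqrrN mulrN => *; apply/andP; split; lra.
- by have := integrableD mD f2 g2.
Qed.

Lemma sqintegrableD f g : sqintegrable f -> sqintegrable g ->
  sqintegrable (fun x => f x + g x).
Proof.
move=> If Ig; have [[mf f2] [mg g2]] := (If, Ig).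
split; first exact: measurable_funD.
have := integrableD mD f2 (integrableD mD
   (integrableZl mD 2 (sqintegrableM If Ig)) g2).
apply: eq_integrable => // x _ /=.
rewrite -!EFinM -!EFinD; congr EFin; ring.
Qed.

Lemma sqintegrableZ (c : R) f : sqintegrable f -> sqintegrable (fun x => c * f x).
Proof.
move=> [mf f2]; split; first exact: measurable_funM.
have := integrableZl mD (c ^+ 2) f2.
by apply: eq_integrable => // x _ /=; rewrite -EFinM exprMn.
Qed.

Lemma sqintegrableB f g : sqintegrable f -> sqintegrable g ->
  sqintegrable (fun x => f x - g x).
Proof.
move=> If Ig; have := sqintegrableD If (sqintegrableZ (-1) Ig).
by under eq_fun do rewrite mulN1r.
Qed.

Local Notation sqn f := (\int[mu]_(x in D) (f x ^+ 2)).

Lemma sqn_ge0 f : 0 <= sqn f.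
Proof. by apply: Rintegral_ge0 => x _; exact: sqr_ge0. Qed.

Lemma sqn_addZ f g t : sqintegrable f -> sqintegrable g ->
  sqn (fun x => f x + t * g x) =
  sqn f + 2 * t * \int[mu]_(x in D) (f x * g x) + t ^+ 2 * sqn g.
Proof.
move=> If Ig; have If2 := If.2; have Ig2 := Ig.2.
have IM := sqintegrableM If Ig.
have I1 : mu.-integrable D (EFin \o (fun x => 2 * t * (f x * g x))).
  by have := integrableZl mD (2 * t) IM.
have I2 : mu.-integrable D (EFin \o (fun x => t ^+ 2 * g x ^+ 2)).
  by have := integrableZl mD (t ^+ 2) Ig2.
have I3 : mu.-integrable D (EFin \o (fun x => f x ^+ 2 + 2 * t * (f x * g x))).
  by have := integrableD mD If2 I1.
rewrite -!RintegralZl// -!RintegralD//.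
by apply: eq_Rintegral => x _; ring.
Qed.

Lemma cauchy_schwarz f g : sqintegrable f -> sqintegrable g ->
  (\int[mu]_(x in D) (f x * g x)) ^+ 2 <= sqn f * sqn g.
Proof.
move=> If Ig; apply: discriminant_le => t.
by rewrite -sqn_addZ//; exact: sqn_ge0.
Qed.

Lemma sqnD f g : sqintegrable f -> sqintegrable g ->
  sqn (fun x => f x + g x) <= 2 * sqn f + 2 * sqn g.
Proof.
move=> If Ig.
have p : sqn (fun x => f x + g x) =
    sqn f + 2 * \int[mu]_(x in D) (f x * g x) + sqn g.
  have := sqn_addZ 1 If Ig; rewrite mulr1 expr1n mul1r => <-.
  by apply: eq_Rintegral => x _; rewrite mul1r.
have := sqn_addZ (-1) If Ig; rewrite mulrN1 sqrrN expr1n mul1r.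
have := sqn_ge0 (fun x => f x + -1 * g x); lra.
Qed.

Definition L2cvg (F_ : nat -> T -> R) f :=
  [/\ forall k, sqintegrable (F_ k), sqintegrable f
    & sqn (fun x => F_ k x - f x) @[k --> \oo] --> 0].

Lemma L2cvg_bounded (F_ : nat -> T -> R) f : L2cvg F_ f ->
  exists2 M, 0 <= M & forall k, sqn (F_ k) <= M.
Proof.
move=> [IF_ If fc].
have /cvgP/cvg_seq_bounded[/=] := fc.
rewrite /globally/= => M [_ /(_ (`|M| + 1))].
have hM : M < `|M| + 1 by rewrite (le_lt_trans (ler_norm _))// ltrDl.
move=> /(_ hM) H; exists (2 * (`|M| + 1) + 2 * sqn f).
  by rewrite addr_ge0// mulr_ge0// ?sqn_ge0// addr_ge0.
move=> k; have := sqnD (sqintegrableB (IF_ k) If) If.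
have : sqn (fun x => F_ k x - f x) <= `|M| + 1.
  by have := H k I; rewrite ger0_norm// sqn_ge0.
have -> : sqn (fun x => F_ k x - f x + f x) = sqn (F_ k).
  by apply: eq_Rintegral => x _; rewrite subrK.
lra.
Qed.

(** The difference of the two integrals splits as - F (G - g) - (F - f) g, and
    Cauchy-Schwarz applies to both parts because the norms of the F_k stay
    bounded. *)
Lemma L2cvg_intM (F_ G_ : nat -> T -> R) f g : L2cvg F_ f -> L2cvg G_ g ->
  \int[mu]_(x in D) (F_ k x * G_ k x) @[k --> \oo] -->
  \int[mu]_(x in D) (f x * g x).
Proof.
move=> Hf Hg; have [IF_ If fc] := Hf; have [IG_ Ig gc] := Hg.
have [M M0 HM] := L2cvg_bounded Hf.
apply/cvgrPdist_le => e e0.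
pose P k := M * sqn (fun x => G_ k x - g x).
pose Q k := sqn (fun x => F_ k x - f x) * sqn g.
have Pc : P k @[k --> \oo] --> 0 by rewrite -(mulr0 M); apply: cvgMl_tmp.
have Qc : Q k @[k --> \oo] --> 0 by rewrite -(mul0r (sqn g)); apply: cvgMr_tmp.
have e4 : 0 < (e / 2) ^+ 2 by rewrite exprn_gt0// divr_gt0.
move/cvgrPdist_le : Pc => /(_ _ e4) Pc.
move/cvgrPdist_le : Qc => /(_ _ e4) Qc.
near=> k.
have : `|0 - P k| <= (e / 2) ^+ 2 by near: k.
have : `|0 - Q k| <= (e / 2) ^+ 2 by near: k.
rewrite !sub0r !normrN.
move=> /(le_trans (ler_norm _)) Qk /(le_trans (ler_norm _)) Pk.
have e2 : 0 <= e / 2 by rewrite divr_ge0// ltW.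
have norm_le (z : R) : z ^+ 2 <= (e / 2) ^+ 2 -> `|z| <= e / 2.
  by rewrite -ler_sqrt ?exprn_ge0// !sqrtr_sqr [X in _ <= X]ger0_norm.
have -> : \int[mu]_(x in D) (f x * g x) - \int[mu]_(x in D) (F_ k x * G_ k x) =
   - (\int[mu]_(x in D) (F_ k x * (G_ k x - g x))) -
      \int[mu]_(x in D) ((F_ k x - f x) * g x).
  rewrite -opprD -opprB; congr (- _).
  have Ifg := sqintegrableM If Ig.
  have IFG_ := sqintegrableM (IF_ k) (IG_ k).
  rewrite -(RintegralB mD IFG_ Ifg).
  rewrite -RintegralD//; last 2 first.
  - exact: sqintegrableM (IF_ k) (sqintegrableB (IG_ k) Ig).
  - exact: sqintegrableM (sqintegrableB (IF_ k) If) Ig.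
  by apply: eq_Rintegral => x _; ring.
rewrite [e]splitr (le_trans (ler_normB _ _))// normrN lerD// norm_le//.
  apply: (le_trans (cauchy_schwarz (IF_ k) (sqintegrableB (IG_ k) Ig))).
  apply: le_trans Pk; rewrite /P.
  by rewrite ler_wpM2r ?sqn_ge0.
exact: (le_trans (cauchy_schwarz (sqintegrableB (IF_ k) If) Ig)).
Unshelve. all: by end_near. Qed.

End square_integrable.

Section L2_limits.
Context d (T : measurableType d) (R : realType).
Variables (mu : {measure set T -> \bar R}) (D : set T) (mD : measurable D).
Implicit Types f g : T -> R.
Local Notation sqn f := (\int[mu]_(x in D) (f x ^+ 2)).
Local Notation sqintegrable := (sqintegrable mu D).
Local Notation L2cvg := (L2cvg mu D).

Lemma Rintegral_EFin f : mu.-integrable D (EFin \o f) ->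
  (\int[mu]_(x in D) f x)%:E = (\int[mu]_(x in D) (f x)%:E)%E.
Proof. by move=> If; rewrite fineK//; exact: integrable_fin_num. Qed.

Lemma ae_eq_Rintegral f g : measurable_fun D f -> measurable_fun D g ->
  ae_eq mu D f g -> \int[mu]_(x in D) f x = \int[mu]_(x in D) g x.
Proof.
move=> mf mg fg; rewrite /Rintegral; congr fine; apply: ae_eq_integral => //.
- exact/measurable_EFinP.
- exact/measurable_EFinP.
- by apply: filterS fg => x /= fg Dx; rewrite fg.
Qed.

Lemma sqn_eq0 f : sqintegrable f -> sqn f = 0 -> ae_eq mu D f (cst 0).
Proof.
move=> If f0.
have mf2 : measurable_fun D (EFin \o (fun x => f x ^+ 2)).
  exact: (measurable_int mu If.2).
have [+ _] := ae_eq_integral_abs mu mD mf2.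
have -> : (\int[mu]_(x in D) `|(EFin \o (fun x => (f x ^+ 2)%R)) x| = 0)%E.
  under eq_integral do rewrite /= ger0_norm ?sqr_ge0//.
  by rewrite -Rintegral_EFin ?f0//; exact: If.2.
move=> /(_ erefl); apply: filterS => x /= /[apply] -[] /eqP.
by rewrite sqrf_eq0 => /eqP.
Qed.

Lemma L2cvg_unique (F : nat -> T -> R) f g :
  L2cvg F f -> L2cvg F g -> ae_eq mu D f g.
Proof.
move=> [IF If fc] [_ Ig gc].
have le k : sqn (fun x => f x - g x) <=
    2 * sqn (fun x => F k x - f x) + 2 * sqn (fun x => F k x - g x).
  have := sqnD mD (sqintegrableB mD If (IF k)) (sqintegrableB mD (IF k) Ig).
  have -> : sqn (fun x => f x - F k x) = sqn (fun x => F k x - f x).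
    by apply: eq_Rintegral => x _; rewrite -sqrrN opprB.
  by under eq_Rintegral do rewrite subrKA.
apply: filterS (sqn_eq0 (sqintegrableB mD If Ig) _).
  by move=> x /= /[apply] /eqP; rewrite subr_eq0 => /eqP.
apply/eqP; rewrite eq_le sqn_ge0 andbT.
have : 2 * sqn (fun x => F k x - f x) + 2 * sqn (fun x => F k x - g x)
    @[k --> \oo] --> 2 * 0 + 2 * (0 : R).
  by apply: cvgD; apply: cvgMl_tmp.
rewrite mulr0 addr0 => h; apply: (ler_cvg_to _ h); first exact: cvg_cst.
exact: nearW.
Qed.

Lemma sqn_le f g : measurable_fun D f -> sqintegrable g ->
  (forall x, D x -> `|f x| <= `|g x|) -> sqintegrable f /\ sqn f <= sqn g.
Proof.
move=> mf Ig fg.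
have fg2 x : D x -> f x ^+ 2 <= g x ^+ 2.
  move=> Dx; rewrite -[f x ^+ 2]real_normK ?num_real// -[g x ^+ 2]real_normK ?num_real//.
  by rewrite ler_sqr ?nnegrE// fg.
have If : sqintegrable f.
  split => //; apply: (le_integrable mD _ _ Ig.2) => [|x Dx /=].
    by apply/measurable_EFinP; exact: measurable_funX.
  by rewrite !ger0_norm ?sqr_ge0// lee_fin fg2.
by split=> //; apply: le_Rintegral => //; [exact: If.2|exact: Ig.2].
Qed.

Lemma sqnZ c f : sqintegrable f -> sqn (fun x => c * f x) = c ^+ 2 * sqn f.
Proof.
move=> If; rewrite -RintegralZl//; last exact: If.2.
by apply: eq_Rintegral => x _; rewrite exprMn.
Qed.

Lemma sqnZ_le c f g : measurable_fun D f -> sqintegrable g ->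
  (forall x, D x -> `|f x| <= c * `|g x|) ->
  sqintegrable f /\ sqn f <= c ^+ 2 * sqn g.
Proof.
move=> mf Ig fg; rewrite -sqnZ//.
apply: sqn_le => //; first exact: sqintegrableZ.
move=> x Dx; rewrite normrM (le_trans (fg x Dx))//.
by rewrite ler_wpM2r// ler_norm.
Qed.

(** This is how the product of a second derivative and a test function passes
    to the limit: the test functions converge uniformly, so boundedness of one
    factor and convergence in the mean of the other suffice. *)
Lemma L2cvgM (F H : nat -> T -> R) (f h : T -> R) (B : R) (e : nat -> R) :
  L2cvg F f -> (forall k, measurable_fun D (H k)) -> measurable_fun D h ->
  (forall k x, D x -> `|H k x| <= B) ->
  (forall k x, D x -> `|H k x - h x| <= e k) -> e @ \oo --> 0 ->
  L2cvg (fun k x => F k x * H k x) (fun x => f x * h x).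
Proof.
move=> [IF If fc] mH mh HB He e0.
have I1 k : sqintegrable (fun x => F k x * H k x).
  apply: (sqnZ_le (c := B) _ (IF k) _).1.
    by apply: measurable_funM; [exact: (IF k).1|].
  by move=> x Dx; rewrite normrM mulrC ler_wpM2r// HB.
have I2 : sqintegrable (fun x => f x * h x).
  apply: (sqnZ_le (c := B + e 0) _ If _).1.
    by apply: measurable_funM; [exact: If.1|].
  move=> x Dx; rewrite normrM mulrC ler_wpM2r//.
  have -> : h x = H 0 x - (H 0 x - h x) by ring.
  by rewrite (le_trans (ler_normB _ _))// lerD// ?HB// He.
split=> //.
have bnd k : sqn (fun x => F k x * H k x - f x * h x) <=
    2 * (B ^+ 2 * sqn (fun x => F k x - f x)) + 2 * (e k ^+ 2 * sqn f).
  have IFf := sqintegrableB mD (IF k) If.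
  have [Ia Ha] : sqintegrable (fun x => (F k x - f x) * H k x) /\
     sqn (fun x => (F k x - f x) * H k x) <= B ^+ 2 * sqn (fun x => F k x - f x).
    apply: sqnZ_le => //; first by apply: measurable_funM => //; exact: IFf.1.
    by move=> x Dx; rewrite normrM mulrC ler_wpM2r// HB.
  have [Ib Hb] : sqintegrable (fun x => f x * (H k x - h x)) /\
     sqn (fun x => f x * (H k x - h x)) <= e k ^+ 2 * sqn f.
    apply: sqnZ_le => //.
      by apply: measurable_funM; [exact: If.1|exact: measurable_funB].
    by move=> x Dx; rewrite normrM mulrC ler_wpM2r// He.
  have -> : sqn (fun x => F k x * H k x - f x * h x) =
      sqn (fun x => (F k x - f x) * H k x + f x * (H k x - h x)).
    by apply: eq_Rintegral => x _; congr (_ ^+ 2); ring.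
  by have := sqnD mD Ia Ib; lra.
apply: (@squeeze_cvgr _ _ _ _ (cst 0) (fun k =>
    2 * (B ^+ 2 * sqn (fun x => F k x - f x)) + 2 * (e k ^+ 2 * sqn f))).
- by apply: nearW => k; rewrite bnd sqn_ge0.
- exact: cvg_cst.
- have -> : 0 = 2 * (B ^+ 2 * 0) + 2 * (0 * 0 * sqn f) :> R by ring.
  apply: cvgD; apply: cvgMl_tmp; first exact: cvgMl_tmp.
  by apply: cvgMr_tmp; under eq_fun do rewrite expr2; exact: cvgM.
Qed.

(** Cauchy-Schwarz for a telescoping sum with weights 2 ^ j. The geometric sum
    of the inverse weights is absorbed in the factor 2 / 2 ^ k, which is what
    the induction reproduces. *)
Lemma telescope_le (d_ a : nat -> R) k n :
  (forall j, a j.+1 - a j = d_ j) ->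
  (a (k + n)%N - a k) ^+ 2 <=
    2 / 2 ^+ k * \sum_(k <= j < k + n) (2 ^+ j * d_ j ^+ 2).
Proof.
move=> ad; elim: n k => [|n IH] k.
  by rewrite addn0 big_geq// mulr0 subrr expr0n.
rewrite -addSnnS big_ltn ?leq_addr// ?addSn ?ltnS ?leq_addr//.
have := IH k.+1; rewrite addSn.
set S := \sum_(k.+1 <= j < _) _; set b := a (k + n).+1 => IHk.
have S0 : 0 <= S.
  by rewrite /S; apply: sumr_ge0 => j _; rewrite mulr_ge0 ?sqr_ge0 ?exprn_ge0.
have p0 : 0 < 2 ^+ k :> R by rewrite exprn_gt0.
have -> : 2 / 2 ^+ k * (2 ^+ k * d_ k ^+ 2 + S) = 2 * d_ k ^+ 2 + 2 / 2 ^+ k * S.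
  by field; rewrite gt_eqF.
have e : 2 / 2 ^+ k.+1 * S = 1 / 2 ^+ k * S.
  by rewrite exprS; field; rewrite gt_eqF.
rewrite e in IHk.
have -> : b - a k = (b - a k.+1) + d_ k by rewrite -ad; ring.
have : (b - a k.+1 + d_ k) ^+ 2 <= 2 * (b - a k.+1) ^+ 2 + 2 * d_ k ^+ 2.
  have := sqr_ge0 (b - a k.+1 - d_ k); rewrite !expr2; lra.
have : 2 / 2 ^+ k * S = 2 * (1 / 2 ^+ k * S) by ring.
lra.
Qed.

(** Completeness for rapidly converging sequences. With g_k = 2 ^ k (F_(k+1) -
    F_k) ^ 2, the sum G of the g_k has integral at most 1. Where G is finite,
    [telescope_le] bounds (F_n - F_k) ^ 2 by 2 / 2 ^ k * G, hence the sequence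
    converges pointwise, and the limit inherits the bound; integrating it
    gives convergence in the mean. Where G is infinite the limit is set to 0
    and the bound is trivial. *)
Lemma L2_rapid_cvg (F : nat -> T -> R) :
  (forall k, sqintegrable (F k)) ->
  (forall k, sqn (fun x => F k.+1 x - F k x) <= (2 ^+ k * 2 ^+ k.+1)^-1) ->
  exists f, L2cvg F f.
Proof.
move=> IF Fr.
pose dd k x := F k.+1 x - F k x.
have Id k : sqintegrable (dd k) by exact: sqintegrableB.
pose g k x : \bar R := (2 ^+ k * dd k x ^+ 2)%:E.
have mg k : measurable_fun D (g k).
  apply/measurable_EFinP; apply: measurable_funM => //.
  by apply: measurable_funX; exact: (Id k).1.
have g0 k x : (0 <= g k x)%E.
  by rewrite lee_fin mulr_ge0 ?sqr_ge0 ?exprn_ge0.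
pose G x := (\sum_(k <oo) g k x)%E.
have G0 x : (0 <= G x)%E by apply: nneseries_ge0 => k _ _; exact: g0.
have mG : measurable_fun D G by apply: ge0_emeasurable_sum.
have intG : (\int[mu]_(x in D) G x <= 1)%E.
  rewrite integral_nneseries//.
  apply: (le_trans _ (epsilon_trick0 xpredT (@ler01 R))).
  apply: lee_nneseries => [k _ _|k _].
    by apply: integral_ge0 => x _; exact: g0.
  have -> : (\int[mu]_(x in D) g k x = (2 ^+ k * sqn (dd k))%:E)%E.
    rewrite -RintegralZl//; last exact: (Id k).2.
    by rewrite Rintegral_EFin//; have := integrableZl mD (2 ^+ k) (Id k).2.
  rewrite lee_fin natrX div1r; have := Fr k.
  have p0 : 0 < 2 ^+ k :> R by rewrite exprn_gt0.
  by rewrite -ler_pdivlMl// -invfM.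
pose E := [set x | (G x < +oo)%E].
pose f x := if (G x < +oo)%E then limn (F ^~ x) else 0.
have part x k n : (G x < +oo)%E ->
    (F (k + n)%N x - F k x) ^+ 2 <= 2 / 2 ^+ k * fine (G x).
  move=> Gx; apply: (le_trans (@telescope_le (dd ^~ x) (F ^~ x) k n (fun=> erefl))).
  rewrite ler_wpM2l ?divr_ge0 ?exprn_ge0//.
  rewrite -lee_fin fineK ?ge0_fin_numE// -sumEFin.
  rewrite (le_trans _ (nneseries_lim_ge (k + n) _))//.
  rewrite (big_cat_nat (leq0n k) (leq_addr n k))/=.
  by rewrite leeDr// sume_ge0.
have Fc x : (G x < +oo)%E -> F ^~ x @ \oo --> f x.
  move=> Gx; rewrite /f Gx; apply/cauchy_cvgP/cauchy_exP => e e0.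
  have c0 : 0 <= fine (G x) by rewrite fine_ge0.
  have [K HK] : exists K, 2 / 2 ^+ K * fine (G x) < (e / 2) ^+ 2.
    have h : geometric (2 * fine (G x)) (2^-1 : R) @ \oo --> 0.
      by apply: cvg_geometric; rewrite ger0_norm ?invr_ge0// invf_lt1// ltr1n.
    move/cvgrPdist_lt : h => /(_ ((e / 2) ^+ 2)).
    have e2 : 0 < (e / 2) ^+ 2 by rewrite exprn_gt0// divr_gt0.
    move=> /(_ e2)[K _ /(_ K (leqnn K))] /=.
    rewrite sub0r normrN => /(le_lt_trans (ler_norm _)).
    by rewrite exprVn => h; exists K; rewrite mulrAC.
  have half n : (K <= n)%N -> `|F n x - F K x| < e / 2.
    move=> Kn; have e2 : 0 < e / 2 by rewrite divr_gt0.
    rewrite -ltr_sqr ?nnegrE ?(ltW e2)// real_normK ?num_real//.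
    by apply: le_lt_trans HK; rewrite -(subnKC Kn) part.
  exists (F K x); exists K => // n /= Kn; rewrite /ball/= distrC.
  by rewrite (lt_trans (half n Kn))// ltr_pdivrMr// ltr_pMr// ltr1n.
have bound k x : (((F k x - f x) ^+ 2)%:E <= (2 / 2 ^+ k)%:E * G x)%E.
  have [Gx|] := ltP (G x) +oo%E; last first.
    by rewrite leye_eq => /eqP ->; rewrite gt0_muley ?leey//.
  rewrite -[G x]fineK ?ge0_fin_numE// -EFinM lee_fin.
  have h : (F n x - F k x) ^+ 2 @[n --> \oo] --> (f x - F k x) ^+ 2.
    have h1 : F n x - F k x @[n --> \oo] --> f x - F k x.
      by apply: cvgB; [exact: Fc|exact: cvg_cst].
    by rewrite expr2; under eq_fun do rewrite expr2; exact: cvgM.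
  rewrite -sqrrN opprB; apply: (ler_cvg_to h (cvg_cst _)).
  near=> n; have kn : (k <= n)%N by near: n; exists k.
  by rewrite -(subnKC kn) part.
have mf : measurable_fun D f.
  have mE : measurable (D `&` E).
    by rewrite /E; apply: measurable_lte.
  have mind : measurable_fun D (\1_E : T -> R).
    have := @measurable_indic _ T R D _ mE.
    apply: eq_measurable_fun => x; rewrite inE => Dx.
    by rewrite !indicE in_setI mem_set.
  apply: (@measurable_fun_cvg _ _ _ D (fun n x => F n x * \1_E x)).
    by move=> m; apply: measurable_funM => //; exact: (IF m).1.
  move=> x Dx; rewrite /f indicE; case: ltP => Gx; last first.
    rewrite memNset; last by rewrite /E/= ltNge Gx.
    by under eq_fun do rewrite mulr0; exact: cvg_cst.
  rewrite mem_set//; under eq_fun do rewrite mulr1.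
  by have := Fc x Gx; rewrite /f Gx.
have intb k : (\int[mu]_(x in D) ((F k x - f x) ^+ 2)%:E <= (2 / 2 ^+ k)%:E)%E.
  apply: (@le_trans _ _ (\int[mu]_(x in D) ((2 / 2 ^+ k)%:E * G x))%E).
    apply: ge0_le_integral => //.
    - by move=> x _; rewrite lee_fin sqr_ge0.
    - apply/measurable_EFinP; apply: measurable_funX.
      by apply: measurable_funB => //; exact: (IF k).1.
    - by apply: emeasurable_funM => //; exact: measurable_cst.
  rewrite ge0_integralZl//.
  by rewrite -[leRHS]mule1 lee_wpmul2l// lee_fin divr_ge0 ?exprn_ge0.
have IFf k : sqintegrable (fun x => F k x - f x).
  split; first by apply: measurable_funB => //; exact: (IF k).1.
  apply/integrableP; split.
    apply/measurable_EFinP; apply: measurable_funX.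
    by apply: measurable_funB => //; exact: (IF k).1.
  under eq_integral do rewrite /= ger0_norm ?sqr_ge0//.
  by rewrite (le_lt_trans (intb k))// ltry.
exists f; split => //.
  have := sqintegrableB mD (IF 0) (IFf 0).
  by under eq_fun do rewrite subKr.
apply: (@squeeze_cvgr _ _ _ _ (cst 0) (geometric 2 (2^-1 : R))).
- apply: nearW => k; rewrite sqn_ge0/= -lee_fin Rintegral_EFin ?exprVn//.
  exact: (IFf k).2.
- exact: cvg_cst.
- by apply: cvg_geometric; rewrite ger0_norm ?invr_ge0// invf_lt1// ltr1n.
Unshelve. all: by end_near. Qed.

End L2_limits.

(** * Smooth functions and test functions *)

Section smooth_calculus.
Context (R : realType).
Implicit Types (u v : R * R -> R) (x p : R * R) (i j : 'I_2).

Lemma ord2_cases i : i = 0 \/ i = 1.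
Proof. by case: i => [[|[|//]]] ?; [left|right]; apply/val_inj. Qed.

Lemma derivable_slice0 u x :
  derivable u x (axis R 0) <-> derivable (fun t => u (t, x.2)) x.1 1.
Proof.
rewrite /derivable /axis eqxx; case: x => a b /=.
by have -> : (fun h : R => h^-1 *: (u (h *: (1, 0) + (a, b)) - u (a, b))) =
  (fun h : R => h^-1 *: (u (h *: 1 + a, b) - u (a, b)))
  by apply/funext => h; congr (_ *: (u _ - _)); congr pair; rewrite /= ?scaler0 ?add0r.
Qed.

Lemma derivable_slice1 u x :
  derivable u x (axis R 1) <-> derivable (fun t => u (x.1, t)) x.2 1.
Proof.
rewrite /derivable /axis; case: x => a b /=.
by have -> : (fun h : R => h^-1 *: (u (h *: (0, 1) + (a, b)) - u (a, b))) =
  (fun h : R => h^-1 *: (u (a, h *: 1 + b) - u (a, b)))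
  by apply/funext => h; congr (_ *: (u _ - _)); congr pair; rewrite /= ?scaler0 ?add0r.
Qed.

Lemma derive_slice0 u x :
  'D_(axis R 0) u x = derive1 (fun t => u (t, x.2)) x.1.
Proof.
rewrite derive1E /derive /axis eqxx; case: x => a b /=.
by have -> : (fun h : R => h^-1 *: (u (h *: (1, 0) + (a, b)) - u (a, b))) =
  (fun h : R => h^-1 *: (u (h *: 1 + a, b) - u (a, b)))
  by apply/funext => h; congr (_ *: (u _ - _)); congr pair; rewrite /= ?scaler0 ?add0r.
Qed.

Lemma derive_slice1 u x :
  'D_(axis R 1) u x = derive1 (fun t => u (x.1, t)) x.2.
Proof.
rewrite derive1E /derive /axis; case: x => a b /=.
by have -> : (fun h : R => h^-1 *: (u (h *: (0, 1) + (a, b)) - u (a, b))) =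
  (fun h : R => h^-1 *: (u (a, h *: 1 + b) - u (a, b)))
  by apply/funext => h; congr (_ *: (u _ - _)); congr pair; rewrite /= ?scaler0 ?add0r.
Qed.

(** Smoothness speaks of all iterated partial derivatives. A class stable
    under differentiation serves as an invariant, for which only first-order
    properties remain to be checked. *)
Lemma smooth_class (P : set (R * R -> R)) :
  (forall u, P u -> continuous u /\ forall i x, derivable u x (axis R i)) ->
  (forall u i, P u -> P ('D_(axis R i) u)) ->
  forall u, P u -> smooth u.
Proof.
move=> Pc PD u Pu s; apply: Pc.
by elim: s => [|i s IH] //=; exact: PD.
Qed.

Lemma smooth_continuous u : smooth u -> continuous u.
Proof. by move=> /(_ [::])[]. Qed.

Lemma smooth_derivable u i x : smooth u -> derivable u x (axis R i).
Proof. by move=> /(_ [::])[_]; exact. Qed.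

Lemma smooth_partial u s : smooth u -> smooth (partial s u).
Proof.
move=> su s'; have := su (s' ++ s).
by rewrite /partial foldr_cat.
Qed.

Lemma smooth_D u i : smooth u -> smooth ('D_(axis R i) u).
Proof. exact: (@smooth_partial u [:: i]). Qed.

(** The algebra generated by smooth functions and constants is stable under
    differentiation by the Leibniz rule, which makes it an instance of
    [smooth_class]. *)
Inductive smooth_algebra : (R * R -> R) -> Prop :=
| SmoothGen u of smooth u : smooth_algebra u
| SmoothCst c : smooth_algebra (cst c)
| SmoothAdd u v of smooth_algebra u & smooth_algebra v : smooth_algebra (u \+ v)
| SmoothMul u v of smooth_algebra u & smooth_algebra v : smooth_algebra (u \* v).

Lemma smooth_algebra_smooth u : smooth_algebra u -> smooth u.
Proof.
have H : forall u, smooth_algebra u -> [/\ continuous u,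
    forall i x, derivable u x (axis R i) &
    forall i, smooth_algebra ('D_(axis R i) u)].
  move=> {}u; elim=> {u} [u su|c|u v _ [cu du Du] _ [cv dv Dv]|u v Hu [cu du Du] Hv [cv dv Dv]].
  - split=> [|i x|i]; [exact: smooth_continuous|exact: smooth_derivable|].
    exact/SmoothGen/smooth_D.
  - split=> [x|i x|i]; [exact: cvg_cst|exact: derivable_cst|].
    by rewrite (_ : 'D__ _ = cst 0); [exact: SmoothCst|apply/funext => x; rewrite derive_cst].
  - split=> [x|i x|i]; [by apply: cvgD; [exact: cu|exact: cv]|exact: derivableD|].
    rewrite (_ : 'D__ _ = 'D_(axis R i) u \+ 'D_(axis R i) v); first exact: SmoothAdd.
    by apply/funext => x; exact: deriveD.
  - split=> [x|i x|i]; [by apply: cvgM; [exact: cu|exact: cv]|exact: derivableM|].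
    rewrite (_ : 'D__ _ = u \* 'D_(axis R i) v \+ v \* 'D_(axis R i) u).
      by apply: SmoothAdd; exact: SmoothMul.
    by apply/funext => x; rewrite [LHS]deriveM.
apply: smooth_class => [v /H[]//|v i /H[]//].
Qed.

Lemma smoothD u v : smooth u -> smooth v -> smooth (fun x => u x + v x).
Proof.
by move=> su sv; apply: (smooth_algebra_smooth (SmoothAdd (SmoothGen su) (SmoothGen sv))).
Qed.

Lemma smoothM u v : smooth u -> smooth v -> smooth (fun x => u x * v x).
Proof.
by move=> su sv; apply: (smooth_algebra_smooth (SmoothMul (SmoothGen su) (SmoothGen sv))).
Qed.

Lemma smoothZ c u : smooth u -> smooth (fun x => c * u x).
Proof.
by move=> su; apply: (smooth_algebra_smooth (SmoothMul (SmoothCst c) (SmoothGen su))).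
Qed.

Lemma DD u v i x : smooth u -> smooth v ->
  'D_(axis R i) (fun x => u x + v x) x = 'D_(axis R i) u x + 'D_(axis R i) v x.
Proof. by move=> su sv; rewrite [LHS]deriveD//; exact: smooth_derivable. Qed.

Lemma DM u v i x : smooth u -> smooth v ->
  'D_(axis R i) (fun x => u x * v x) x =
  u x * 'D_(axis R i) v x + v x * 'D_(axis R i) u x.
Proof. by move=> su sv; rewrite [LHS]deriveM//; exact: smooth_derivable. Qed.

Lemma DZ c u i x : smooth u ->
  'D_(axis R i) (fun x => c * u x) x = c * 'D_(axis R i) u x.
Proof. by move=> su; rewrite [LHS](@deriveZ _ _ _ u c)//; exact: smooth_derivable. Qed.

Lemma partialD u v s x : smooth u -> smooth v ->
  partial s (fun x => u x + v x) x = partial s u x + partial s v x.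
Proof.
move=> su sv; elim: s x => [//|i s IH] x.
transitivity ('D_(axis R i) (fun y => partial s u y + partial s v y) x).
  by congr ('D_ _ _ x); apply/funext => y; rewrite -IH.
by rewrite DD//; exact: smooth_partial.
Qed.

Lemma partialZ c u s x : smooth u ->
  partial s (fun x => c * u x) x = c * partial s u x.
Proof.
move=> su; elim: s x => [//|i s IH] x.
transitivity ('D_(axis R i) (fun y => c * partial s u y) x).
  by congr ('D_ _ _ x); apply/funext => y; rewrite -IH.
by rewrite DZ//; exact: smooth_partial.
Qed.

End smooth_calculus.

Section test_functions.
Context (R : realType) (D : set (R * R)).
Implicit Types (u v w : R * R -> R) (x : R * R) (i j : 'I_2).

Lemma test_sub u v : test_function D u -> smooth v ->
  (forall x, v x != 0 -> closure [set x | u x != 0] x) -> test_function D v.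
Proof.
move=> [su cu uD] sv vu.
have sub : closure [set x | v x != 0] `<=` closure [set x | u x != 0].
  by rewrite [X in _ `<=` X](closure_id _).1; [exact: closureS|exact: closed_closure].
split => //; last exact: subset_trans uD.
by apply: subclosed_compact cu sub; exact: closed_closure.
Qed.

Lemma test_smooth u : test_function D u -> smooth u.
Proof. by case. Qed.

Lemma test_out u x : test_function D u -> ~ D x -> u x = 0.
Proof.
move=> [_ _ uD] Dx; apply/eqP/negPn/negP => ux.
by apply: Dx; apply: uD; exact: subset_closure.
Qed.

Lemma test_D u i : test_function D u -> test_function D ('D_(axis R i) u).
Proof.
move=> tu; apply: (test_sub tu); first by apply: smooth_D; case: tu.
(* outside the support u vanishes near x, hence so does its derivative at x *)
move=> x; apply: contra_neqP => xu.
have : nbhs x (~` closure [set y | u y != 0]).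
  by apply: open_nbhs_nbhs; split => //; exact/closed_openC/closed_closure.
move=> xnbhs; have : \near x, u x = cst 0 x.
  apply: filterS xnbhs => y /= yu; apply/eqP/negPn/negP => uy.
  by apply: yu; exact: subset_closure.
by move=> /(near_eq_derive (axis R i)) ->; rewrite derive_cst.
Qed.

Lemma test_partial u s : test_function D u -> test_function D (partial s u).
Proof. by move=> tu; elim: s => //= i s; exact: test_D. Qed.

Lemma test_Mr u v : test_function D u -> smooth v -> test_function D (fun x => u x * v x).
Proof.
move=> tu sv; apply: (test_sub tu); first by apply: smoothM => //; case: tu.
by move=> x ux; apply: subset_closure => /=; apply: contra_neq ux => ->; rewrite mul0r.
Qed.

Lemma test_Z c u : test_function D u -> test_function D (fun x => c * u x).
Proof.
move=> tu; apply: (test_sub tu); first by apply: smoothZ => //; case: tu.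
by move=> x ux; apply: subset_closure => /=; apply: contra_neq ux => ->; rewrite mulr0.
Qed.

Lemma test_Add u v : test_function D u -> test_function D v ->
  test_function D (fun x => u x + v x).
Proof.
move=> [su cu uD] [sv cv vD].
have sub : closure [set x | u x + v x != 0] `<=`
    closure [set x | u x != 0] `|` closure [set x | v x != 0].
  rewrite -closureU; apply: closureS => x /=.
  by have [->|] := eqVneq (u x) 0; [rewrite add0r; right|left].
split; first exact: smoothD.
  apply: (subclosed_compact _ (compactU cu cv) sub); exact: closed_closure.
by apply: (subset_trans sub) => x [/uD|/vD].
Qed.

End test_functions.

(** * Equality of mixed partial derivatives *)

Section clairaut.
Context (R : realType).
Implicit Types (u : R * R -> R) (x : R * R).

Lemma smooth_slice0 u (b t : R) : smooth u ->
  is_derive t 1 (fun s => u (s, b)) ('D_(axis R 0) u (t, b)).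
Proof.
move=> su; have /derivable_slice0/= du := smooth_derivable (i := 0) (x := (t, b)) su.
by rewrite derive_slice0/= derive1E; exact: derivableP.
Qed.

Lemma smooth_slice1 u (a t : R) : smooth u ->
  is_derive t 1 (fun s => u (a, s)) ('D_(axis R 1) u (a, t)).
Proof.
move=> su; have /derivable_slice1/= du := smooth_derivable (i := 1) (x := (a, t)) su.
by rewrite derive_slice1/= derive1E; exact: derivableP.
Qed.

Lemma is_derive_continuous (f df : R -> R) :
  (forall t : R, is_derive t 1 f (df t)) -> continuous f.
Proof. by move=> H t; apply/differentiable_continuous/derivable1_diffP; case: (H t). Qed.

Lemma MVT_all (f df : R -> R) (a b : R) : a < b ->
  (forall t : R, is_derive t 1 f (df t)) ->
  exists2 c, a < c < b & f b - f a = df c * (b - a).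
Proof.
move=> ab H; have [|c] := @MVT R f df a b ab (fun t _ => H t).
  by apply: continuous_subspaceT; exact: is_derive_continuous H.
by rewrite in_itv/= => ? ?; exists c.
Qed.

(** Two applications of the mean value theorem to the second difference of u
    over a square of side h; taking the axes in the other order gives the
    other mixed derivative. *)
Lemma double_difference01 u (a b h : R) : smooth u -> 0 < h ->
  exists2 p, `|p.1 - a| < h /\ `|p.2 - b| < h &
    u (a + h, b + h) - u (a + h, b) - (u (a, b + h) - u (a, b)) =
    'D_(axis R 1) ('D_(axis R 0) u) p * h ^+ 2.
Proof.
move=> su h0; pose f s := u (s, b + h) - u (s, b).
have [||xi /andP[axi xih] ->] := MVT_all (f := f) (a := a) (b := a + h)
    (df := fun s => 'D_(axis R 0) u (s, b + h) - 'D_(axis R 0) u (s, b)) _ _.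
- by rewrite ltrDl.
- by move=> t; apply: is_deriveB; exact: smooth_slice0.
have [|eta /andP[be eh] ->] := MVT_all (a := b) (b := b + h) _
   (fun t => smooth_slice1 xi t (smooth_D 0 su)).
  by rewrite ltrDl.
exists (xi, eta) => /=; last by ring.
by split; rewrite ltr_norml; apply/andP; split; lra.
Qed.

Lemma double_difference10 u (a b h : R) : smooth u -> 0 < h ->
  exists2 p, `|p.1 - a| < h /\ `|p.2 - b| < h &
    u (a + h, b + h) - u (a + h, b) - (u (a, b + h) - u (a, b)) =
    'D_(axis R 0) ('D_(axis R 1) u) p * h ^+ 2.
Proof.
move=> su h0; pose f s := u (a + h, s) - u (a, s).
have -> : u (a + h, b + h) - u (a + h, b) - (u (a, b + h) - u (a, b)) =
  f (b + h) - f b by rewrite /f; ring.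
have [||eta /andP[axi xih] ->] := MVT_all (f := f) (a := b) (b := b + h)
    (df := fun s => 'D_(axis R 1) u (a + h, s) - 'D_(axis R 1) u (a, s)) _ _.
- by rewrite ltrDl.
- by move=> t; apply: is_deriveB; exact: smooth_slice1.
have [|xi /andP[be eh] ->] := MVT_all (a := a) (b := a + h) _
   (fun t => smooth_slice0 eta t (smooth_D 1 su)).
  by rewrite ltrDl.
exists (xi, eta) => /=; last by ring.
by split; rewrite ltr_norml; apply/andP; split; lra.
Qed.

Lemma continuous_eq_near (F G : R * R -> R) (a b : R) :
  continuous F -> continuous G ->
  (forall h, 0 < h -> exists p q, [/\ `|p.1 - a| < h /\ `|p.2 - b| < h,
     `|q.1 - a| < h /\ `|q.2 - b| < h & F p = G q]) ->
  F (a, b) = G (a, b).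
Proof.
move=> cF cG FG.
apply/eqP; rewrite -subr_eq0 -normr_le0; apply/ler_addgt0Pr => e e0.
rewrite add0r; have e2 : 0 < e / 2 by rewrite divr_gt0.
have near_le (H : R * R -> R) : continuous H ->
    exists2 h, 0 < h & forall p, `|p.1 - a| < h /\ `|p.2 - b| < h -> `|H (a, b) - H p| < e / 2.
  move=> /(_ (a, b))/cvgrPdist_lt/(_ _ e2)/nbhs_ballP[h /= h0 hH].
  by exists h => // p [p1 p2]; apply: hH; split; rewrite /ball/= distrC.
have [h1 h10 H1] := near_le F cF; have [h2 h20 H2] := near_le G cG.
have h0 : 0 < Num.min h1 h2 by rewrite lt_min h10.
have [p [q []]] := FG _ h0.
rewrite !lt_min => -[/andP[p1 _] /andP[p2 _]] [/andP[_ q1] /andP[_ q2]] pq.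
have Fp := H1 p (conj p1 p2); have Gq := H2 q (conj q1 q2).
have -> : F (a, b) - G (a, b) = (F (a, b) - F p) - (G (a, b) - G q).
  by rewrite pq opprB addrA subrK.
by rewrite [e]splitr (le_trans (ler_normB _ _))// lerD// ltW.
Qed.

(** Both mixed derivatives are, up to the factor h ^ 2, the same second
    difference evaluated at points within h of (a, b). *)
Lemma clairaut u : smooth u ->
  'D_(axis R 1) ('D_(axis R 0) u) = 'D_(axis R 0) ('D_(axis R 1) u).
Proof.
move=> su; apply/funext => -[a b].
apply: (@continuous_eq_near ('D_(axis R 1) ('D_(axis R 0) u))
  ('D_(axis R 0) ('D_(axis R 1) u))) => [||h h0];[by apply: smooth_continuous; do 2 apply: smooth_D..|].
have [p hp ep] := double_difference01 a b su h0.
have [q hq eq_] := double_difference10 a b su h0.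
have h2_neq0 : h ^+ 2 != 0 by rewrite expf_neq0// gt_eqF.
exists p, q; split; [exact: hp|exact: hq|].
exact: (mulIf h2_neq0 (etrans (esym ep) eq_)).
Qed.

End clairaut.

(** * Integration by parts *)

Section one_dimensional.
Context (R : realType).

Lemma continuous_slice0 (u : R * R -> R) (b : R) :
  continuous u -> continuous (fun t => u (t, b)).
Proof.
move=> cu t; apply: (@cvg_comp _ _ _ (fun t => (t, b)) u _ _ _ _ (cu (t, b))).
by apply: (@cvg_pair _ _ _ (nbhs t) (nbhs t) (nbhs b)); [exact: cvg_id|exact: cvg_cst].
Qed.

Lemma continuous_slice1 (u : R * R -> R) (a : R) :
  continuous u -> continuous (fun t => u (a, t)).
Proof.
move=> cu t; apply: (@cvg_comp _ _ _ (fun t => (a, t)) u _ _ _ _ (cu (a, t))).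
by apply: (@cvg_pair _ _ _ (nbhs t) (nbhs a) (nbhs t)); [exact: cvg_cst|exact: cvg_id].
Qed.

Notation leb := (@lebesgue_measure R).

Lemma FTC_all (f df : R -> R) (a b : R) : a < b ->
  (forall t : R, is_derive t 1 f (df t)) -> continuous df ->
  (\int[leb]_(t in `[a, b]) (df t)%:E = (f b - f a)%:E)%E.
Proof.
move=> ab fdf cdf; have cf := is_derive_continuous fdf.
rewrite EFinB; apply: continuous_FTC2 => //.
- exact: continuous_subspaceT.
- split=> [t _||]; first by case: (fdf t).
  + by apply: cvg_at_right_filter; exact: cf.
  + by apply: cvg_at_left_filter; exact: cf.
- by move=> t _; rewrite derive1E; case: (fdf t).
Qed.

Lemma integral_derive_eq0 (f df : R -> R) (L : R) : 0 < L ->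
  (forall t : R, is_derive t 1 f (df t)) -> continuous df ->
  (forall t, L <= `|t| -> f t = 0 /\ df t = 0) ->
  (\int[leb]_t (df t)%:E = 0)%E.
Proof.
move=> L0 fdf cdf out.
have LL : - L < L by rewrite gtrN.
have -> : (\int[leb]_t (df t)%:E = \int[leb]_(t in `[(- L)%R, L]) (df t)%:E)%E.
  rewrite [RHS]integral_mkcond; apply: eq_integral => t _; rewrite patchE.
  case: ifPn => //; rewrite notin_setE/= in_itv/= -ler_norml => /negP.
  by rewrite -ltNge => /ltW /out[_ ->].
have Labs : L <= `|L| by exact: ler_norm.
have LabsN : L <= `|- L| by rewrite normrN.
by rewrite (FTC_all LL fdf cdf) (out L Labs).1 (out (- L) LabsN).1 subrr.
Qed.

Lemma increment_le_integral (f df : R -> R) (a b : R) : a <= b ->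
  (forall t : R, is_derive t 1 f (df t)) -> continuous df ->
  (`|f b - f a|%:E <= \int[leb]_(t in `[a, b]) `|df t|%:E)%E.
Proof.
rewrite le_eqVlt => /predU1P[->|ab] fdf cdf.
  by rewrite subrr normr0; apply: integral_ge0 => t _; rewrite lee_fin.
rewrite -abse_EFin -(FTC_all ab fdf cdf).
apply: (le_abse_integral leb) => //; apply/measurable_EFinP.
by apply: measurable_funTS; exact: continuous_measurable_fun.
Qed.

Lemma le_integral_derive (f df : R -> R) (L a : R) :
  (forall t : R, is_derive t 1 f (df t)) -> continuous df ->
  (forall t, L <= `|t| -> f t = 0) ->
  (`|f a|%:E <= \int[leb]_t `|df t|%:E)%E.
Proof.
(* a point to the left of both a and the support *)
move=> fdf cdf out; pose b := - (`|L| + `|a|).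
have ba : b <= a.
  by rewrite /b; have := ler_norm (- a); have := normr_ge0 L; rewrite normrN; lra.
have fb : f b = 0.
  apply: out; rewrite /b normrN ger0_norm ?addr_ge0//.
  by rewrite (le_trans (ler_norm L))// lerDl.
have := increment_le_integral ba fdf cdf; rewrite fb subr0 => /le_trans; apply.
rewrite integral_mkcond; apply: ge0_le_integral => //.
- by move=> t _; rewrite patchE; case: ifP => //; rewrite lee_fin.
- apply/(measurable_restrictT _ _).1 => //; apply: measurable_funTS.
  apply/measurable_EFinP; apply: measurableT_comp => //.
  exact: continuous_measurable_fun.
- apply/measurable_EFinP; apply: measurableT_comp => //.
  exact: continuous_measurable_fun.
- by move=> t _; rewrite patchE; case: ifP => //; rewrite lee_fin.
Qed.

End one_dimensional.

Section integrals_of_test_functions.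
Context (R : realType) (D : set (R * R)).
Hypotheses (oD : open D) (bD : bounded_set D).
Notation leb := (@lebesgue_measure R).
Notation mu := (@area R).
Implicit Types (u v w phi : R * R -> R).

Let mD : @measurable _ (meas2 R) D := open_plane_measurable oD.

Lemma bounded_in_box : exists2 L, 0 < L &
  forall x, D x -> `|x.1| < L /\ `|x.2| < L.
Proof.
have [M [_ HM]] := bD; pose L := `|M| + 2.
have L0 : 0 < L by rewrite ltr_wpDl.
exists L => // x Dx.
have : `|x| <= `|M| + 1 by apply: HM => //; rewrite (le_lt_trans (ler_norm M))// ltrDl.
move=> xM; have {xM} : `|x| < L by rewrite (le_lt_trans xM)// /L ltrD2l ltr1n.
by rewrite prod_normE/= gt_max => /andP[].
Qed.

Lemma area_rect (a b c d : R) : a <= b -> c <= d ->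
  mu (`[a, b]%classic `*` `[c, d]%classic) = ((b - a) * (d - c))%:E.
Proof.
move=> ab cd; rewrite [LHS]product_measure1E//; try exact: measurable_itv.
have len (s t : R) : s <= t -> leb `[s, t]%classic = (t - s)%:E.
  rewrite lebesgue_measure_itv/= lte_fin; case: ltgtP => // -> _.
  by rewrite subrr.
by rewrite EFinM -(len _ _ ab) -(len _ _ cd).
Qed.

Lemma area_bounded : (mu D < +oo)%E.
Proof.
have [L L0 DL] := bounded_in_box.
apply: (@le_lt_trans _ _ (mu (`[- L, L]%classic `*` `[- L, L]%classic))); last first.
  by rewrite area_rect ?ltry// ge0_cp// ltW.
apply: le_measure; rewrite ?inE//.
  by apply: measurableX; exact: measurable_itv.
by move=> x /DL[x1 x2]; split; rewrite /= in_itv/= -ler_norml ltW.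
Qed.

Lemma test_bounded phi : test_function D phi -> exists M, forall x, `|phi x| <= M.
Proof.
move=> [sphi cphi _].
have := continuous_compact (continuous_subspaceT (smooth_continuous sphi)) cphi.
move=> /compact_bounded[M [_ HM]]; exists (`|M| + 1) => x.
have [->|x0] := eqVneq (phi x) 0; first by rewrite normr0 addr_ge0.
apply: HM; first by rewrite (le_lt_trans (ler_norm M))// ltrDl.
by exists x => //; exact: subset_closure.
Qed.

Lemma test_measurable phi (A : set (meas2 R)) :
  test_function D phi -> measurable_fun A (phi : meas2 R -> R).
Proof.
move=> [sphi _ _]; apply: measurable_funTS.
by apply: continuous_plane_measurable; exact: smooth_continuous.
Qed.

Lemma test_integrable phi : test_function D phi -> mu.-integrable D (EFin \o phi).
Proof.
move=> tphi; apply: measurable_bounded_integrable => //.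
- exact: area_bounded.
- exact: test_measurable.
- have [M HM] := test_bounded tphi.
  exists M; split; first exact: num_real.
  by move=> x Mx y _ /=; rewrite (le_trans (HM y))// ltW.
Qed.

Lemma test_restrict phi : test_function D phi -> phi \_ D = phi.
Proof.
move=> tphi; apply/funext => x; rewrite patchE; case: ifPn => //.
by rewrite notin_setE => Dx; rewrite (test_out tphi Dx).
Qed.

Lemma test_integrableT phi : test_function D phi -> mu.-integrable setT (EFin \o phi).
Proof.
move=> tphi; have := (@integrable_mkcond _ _ _ mu D (EFin \o phi) mD).1 (test_integrable tphi).
by rewrite restrict_EFin test_restrict.
Qed.

Lemma test_sqintegrable phi : test_function D phi -> sqintegrable mu D phi.
Proof.
move=> tphi; split; first exact: test_measurable.
have := test_integrable (test_Mr tphi (test_smooth tphi)).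
by under eq_fun do rewrite -expr2.
Qed.

(** Fubini reduces the integral to the lines parallel to the i-th axis, along
    each of which a compactly supported function has total increment 0. *)
Lemma test_integralD_eq0 phi i : test_function D phi ->
  \int[mu]_(x in D) 'D_(axis R i) phi x = 0.
Proof.
move=> tphi; have [L L0 DL] := bounded_in_box.
have tD := test_D i tphi.
have sphi := test_smooth tphi.
have cD := smooth_continuous (test_smooth tD).
have := test_integrableT tD; set w := 'D_(axis R i) phi => Iw.
rewrite Rintegral_mkcond test_restrict// /Rintegral.
have out (t : R * R) : L <= `|t.1| \/ L <= `|t.2| -> phi t = 0 /\ w t = 0.
  move=> tL; have nDt : ~ D t by move=> /DL[]; rewrite !ltNge; case: tL => ->.
  by split; [exact: test_out tphi nDt|exact: test_out tD nDt].
suff : (\int[mu]_x (w x)%:E = 0)%E by move=> ->.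
have [i0|i1] := ord2_cases i.
- rewrite -[LHS](integral21_prod_meas1 Iw).
  rewrite (eq_integral (fun=> 0%E)) ?integral0// => y _.
  apply: (@integral_derive_eq0 _ (fun t => phi (t, y)) _ L) => //.
  + by move=> t; rewrite /w i0; exact: smooth_slice0.
  + exact: continuous_slice0.
  + by move=> t tL; apply: out; left.
- rewrite -[LHS](integral12_prod_meas1 Iw).
  rewrite (eq_integral (fun=> 0%E)) ?integral0// => y _.
  apply: (@integral_derive_eq0 _ (fun t => phi (y, t)) _ L) => //.
  + by move=> t; rewrite /w i1; exact: smooth_slice1.
  + exact: continuous_slice1.
  + by move=> t tL; apply: out; right.
Qed.

Lemma integration_by_parts_test phi u i : test_function D phi -> smooth u ->
  \int[mu]_(x in D) (u x * 'D_(axis R i) phi x) =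
  - \int[mu]_(x in D) ('D_(axis R i) u x * phi x).
Proof.
move=> tphi su; have sphi := test_smooth tphi.
have t1 := test_Mr (test_D i tphi) su.
have t2 := test_Mr tphi (smooth_D i su).
have := test_integralD_eq0 i (test_Mr tphi su).
have -> : 'D_(axis R i) (fun x => phi x * u x) = (fun x =>
   phi x * 'D_(axis R i) u x + u x * 'D_(axis R i) phi x).
  by apply/funext => x; exact: DM.
have I2 : mu.-integrable D (EFin \o (fun x => phi x * 'D_(axis R i) u x)).
  exact: test_integrable.
have I1 : mu.-integrable D (EFin \o (fun x => u x * 'D_(axis R i) phi x)).
  by have := test_integrable t1; under eq_fun do rewrite mulrC.
rewrite RintegralD// => /eqP; rewrite addrC addr_eq0 => /eqP ->.
by congr (- _); apply: eq_Rintegral => x _; rewrite mulrC.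
Qed.

End integrals_of_test_functions.

(** * A Hölder estimate by the mixed second derivative *)

Section sup_norm.
Context (R : realType) (D : set (R * R)).
Hypotheses (oD : open D) (bD : bounded_set D).
Notation leb := (@lebesgue_measure R).
Notation mu := (@area R).
Implicit Types (u v w phi : R * R -> R) (A : set R).
Local Notation sqn f := (\int[mu]_(x in D) (f x ^+ 2)).

Let mD : @measurable _ (meas2 R) D := open_plane_measurable oD.

Let mabs w : test_function D w -> measurable_fun setT (fun z : meas2 R => `|w z|%:E).
Proof.
move=> tw; apply/measurable_EFinP; apply: measurableT_comp => //.
exact: test_measurable tw.
Qed.

(** Cauchy-Schwarz against the indicator function of the part of S inside
    D. *)
Lemma strip_bound w (S : set (meas2 R)) (c : R) : test_function D w -> measurable S ->
  (mu (D `&` S) <= c%:E)%E ->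
  (\int[mu]_(z in S) `|w z|%:E <= (Num.sqrt (c * sqn w))%:E)%E.
Proof.
move=> tw mS Sc; pose E : set (meas2 R) := D `&` S.
have mE : measurable E by exact: measurableI.
have [mw w2] := test_sqintegrable oD bD tw.
have w2E : mu.-integrable E (EFin \o (fun x => w x ^+ 2)).
  by apply: integrableS w2 => //; exact: subIsetl.
have IwE : sqintegrable mu E (fun x => `|w x|).
  split; first by apply: measurableT_comp => //; exact: test_measurable tw.
  by under eq_fun do rewrite real_normK ?num_real//.
have I1E : sqintegrable mu E (cst 1).
  split=> //; under eq_fun do rewrite expr1n.
  apply: measurable_bounded_integrable => //; first by rewrite (le_lt_trans Sc)// ltry.
  exists 1; split; first exact: num_real.
  by move=> x x1 y _ /=; rewrite normr1 ltW.
have IE := sqintegrableM mE IwE I1E.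
have -> : (\int[mu]_(z in S) `|w z|%:E = (\int[mu]_(z in E) (`|w z| * cst 1 z)%R)%:E)%E.
  rewrite Rintegral_EFin// [LHS]integral_mkcond [RHS]integral_mkcond.
  apply: eq_integral => z _; rewrite !patchE mulr1 in_setI.
  have [zD|] := boolP (z \in D) => //=.
  by rewrite notin_setE => zD; rewrite (test_out tw zD) normr0; case: ifP.
rewrite lee_fin -[leLHS]ger0_norm; last first.
  by apply: Rintegral_ge0 => z _; rewrite mulr1.
rewrite -sqrtr_sqr ler_wsqrtr//.
rewrite (le_trans (cauchy_schwarz mE IwE I1E))// mulrC ler_pM ?sqn_ge0//.
  under eq_Rintegral do rewrite expr1n.
  rewrite Rintegral_cst// mul1r -lee_fin fineK// ge0_fin_numE//.
  by rewrite (le_lt_trans Sc)// ltry.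
rewrite -lee_fin !Rintegral_EFin//; last first.
  by under eq_fun do rewrite real_normK ?num_real//.
under eq_integral do rewrite real_normK ?num_real//.
apply: ge0_subset_integral => //.
- by apply/measurable_EFinP; exact: measurable_funX.
- by move=> x _; rewrite lee_fin sqr_ge0.
- exact: subIsetl.
Qed.

(** The function v vanishes at the far end of the vertical line through (s,
    b), so |v (s, b)| is at most the integral of |w| along that line.
    Integrating over s in A covers the strip above A. *)
Lemma strip_integral0 v w A b : test_function D v -> test_function D w ->
  (forall a t : R, is_derive t 1 (fun s => v (a, s)) (w (a, t))) ->
  measurable A ->
  (\int[leb]_(s in A) `|v (s, b)|%:E <= \int[mu]_(z in A `*` setT) `|w z|%:E)%E.
Proof.
move=> tv tw vw mA; have [L L0 DL] := bounded_in_box bD.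
have mw := mabs tw; have mv := mabs tv.
pose S : set (meas2 R) := A `*` setT.
have mS : measurable S by exact: measurableX.
pose g : meas2 R -> \bar R := (fun z => `|w z|%:E) \_ S.
have mg : measurable_fun setT g.
  apply: (measurable_restrictT _ mS).1; apply: (measurable_funTS mw).
rewrite integral_mkcond [leRHS]integral_mkcond.
rewrite -/g; have g0 z : (0 <= g z)%E.
  by rewrite /g patchE; case: ifP => // _; rewrite lee_fin.
rewrite [leRHS](fubini_tonelli1 _ mg g0).
apply: ge0_le_integral => //.
- by move=> s _; rewrite patchE; case: ifP => // _; rewrite lee_fin.
- apply/(measurable_restrictT _ _).1 => //; apply: measurable_funTS.
  apply/measurable_EFinP; apply: measurableT_comp => //.
  apply: continuous_measurable_fun; apply: continuous_slice0.
  exact: smooth_continuous (test_smooth tv).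
- exact: measurable_fun_fubini_tonelli_F.
move=> s _; rewrite patchE /fubini_F; case: ifPn => sA; last first.
  by apply: integral_ge0 => t _; exact: g0.
have -> : (\int[leb]_t g (s, t) = \int[leb]_t `|w (s, t)|%:E)%E.
  apply: eq_integral => t _; rewrite /g patchE mem_set//.
  by split => //=; exact: set_mem.
apply: (le_integral_derive (L := L) (f := fun t => v (s, t)) (df := fun t => w (s, t))).
- by apply: continuous_slice1; exact: smooth_continuous (test_smooth tw).
- by move=> t Lt; apply: (test_out tv) => /DL[_]; rewrite /= ltNge Lt.
Qed.

Lemma strip_integral1 v w A b : test_function D v -> test_function D w ->
  (forall a t : R, is_derive t 1 (fun s => v (s, a)) (w (t, a))) ->
  measurable A ->
  (\int[leb]_(s in A) `|v (b, s)|%:E <= \int[mu]_(z in setT `*` A) `|w z|%:E)%E.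
Proof.
move=> tv tw vw mA; have [L L0 DL] := bounded_in_box bD.
have mw := mabs tw; have mv := mabs tv.
pose S : set (meas2 R) := setT `*` A.
have mS : measurable S by exact: measurableX.
pose g : meas2 R -> \bar R := (fun z => `|w z|%:E) \_ S.
have mg : measurable_fun setT g.
  by apply: (measurable_restrictT _ mS).1; apply: (measurable_funTS mw).
rewrite integral_mkcond [leRHS]integral_mkcond.
rewrite -/g; have g0 z : (0 <= g z)%E.
  by rewrite /g patchE; case: ifP => // _; rewrite lee_fin.
rewrite [leRHS](fubini_tonelli2 _ mg g0).
apply: ge0_le_integral => //.
- by move=> s _; rewrite patchE; case: ifP => // _; rewrite lee_fin.
- apply/(measurable_restrictT _ _).1 => //; apply: measurable_funTS.
  apply/measurable_EFinP; apply: measurableT_comp => //.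
  apply: continuous_measurable_fun; apply: continuous_slice1.
  exact: smooth_continuous (test_smooth tv).
- exact: measurable_fun_fubini_tonelli_G.
move=> s _; rewrite patchE /fubini_G; case: ifPn => sA; last first.
  by apply: integral_ge0 => t _; exact: g0.
have -> : (\int[leb]_t g (t, s) = \int[leb]_t `|w (t, s)|%:E)%E.
  apply: eq_integral => t _; rewrite /g patchE mem_set//.
  by split => //=; exact: set_mem.
apply: (le_integral_derive (L := L) (f := fun t => v (t, s)) (df := fun t => w (t, s))).
- by apply: continuous_slice0; exact: smooth_continuous (test_smooth tw).
- by move=> t Lt; apply: (test_out tv) => /DL[]; rewrite /= ltNge Lt.
Qed.

(** The functions v0, v1 and w stand for the first derivatives and the mixed
    derivative of phi. The increment of phi along a horizontal segment is an
    integral of v0, which [strip_integral0] bounds by the integral of |w| over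
    the vertical strip through the segment; [strip_bound] then uses that this
    strip meets D in an area of at most 2 L (a' - a). The sup bound is the
    case of the whole box. *)
Lemma holder_estimate_aux (L : R) phi v0 v1 w :
  0 < L -> (forall x, D x -> `|x.1| < L /\ `|x.2| < L) ->
  test_function D phi -> test_function D v0 -> test_function D v1 ->
  test_function D w ->
  (forall b t : R, is_derive t 1 (fun s => phi (s, b)) (v0 (t, b))) ->
  (forall a t : R, is_derive t 1 (fun s => phi (a, s)) (v1 (a, t))) ->
  (forall a t : R, is_derive t 1 (fun s => v0 (a, s)) (w (a, t))) ->
  (forall b t : R, is_derive t 1 (fun s => v1 (s, b)) (w (t, b))) ->
  [/\ forall p, `|phi p| <= Num.sqrt (4 * L ^+ 2 * sqn w),
      forall a a' b, a <= a' ->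
        `|phi (a', b) - phi (a, b)| <= Num.sqrt (2 * L * (a' - a) * sqn w) &
      forall a b b', b <= b' ->
        `|phi (a, b') - phi (a, b)| <= Num.sqrt (2 * L * (b' - b) * sqn w)].
Proof.
move=> L0 DL tphi t0 t1 tw s0 s1 s10 s01.
have c0 := smooth_continuous (test_smooth t0).
have c1 := smooth_continuous (test_smooth t1).
have NL : - L <= L by rewrite ge0_cp// ltW.
have strip (a a' : R) : a <= a' ->
    (mu (D `&` (`[a, a']%classic `*` setT)) <= (2 * L * (a' - a))%:E)%E.
  move=> aa'; apply: (@le_trans _ _ (mu (`[a, a']%classic `*` `[- L, L]%classic))).
    apply: le_measure; rewrite ?inE//.
    - by apply: measurableI => //; apply: measurableX => //; exact: measurable_itv.
    - by apply: measurableX; exact: measurable_itv.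
    - by move=> x [/DL[_ x2] [xa _]]; split => //=; rewrite in_itv/= -ler_norml ltW.
  by rewrite area_rect// lee_fin opprK mulrC; lra.
have strip' (a a' : R) : a <= a' ->
    (mu (D `&` (setT `*` `[a, a']%classic)) <= (2 * L * (a' - a))%:E)%E.
  move=> aa'; apply: (@le_trans _ _ (mu (`[- L, L]%classic `*` `[a, a']%classic))).
    apply: le_measure; rewrite ?inE//.
    - by apply: measurableI => //; apply: measurableX => //; exact: measurable_itv.
    - by apply: measurableX; exact: measurable_itv.
    - by move=> x [/DL[x1 _] [_ xa]]; split => //=; rewrite in_itv/= -ler_norml ltW.
  by rewrite area_rect// lee_fin opprK; lra.
split.
- move=> [a b]; rewrite -lee_fin.
  apply: (le_trans (le_integral_derive (L := L) a (s0 b) _ _)).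
  + exact: continuous_slice0.
  + by move=> t Lt; apply: (test_out tphi) => /DL[]; rewrite /= ltNge Lt.
  apply: (le_trans (strip_integral0 b t0 tw s10 measurableT)).
  apply: strip_bound => //; first by rewrite setXTT.
  rewrite setXTT setIT.
  apply: (@le_trans _ _ (mu (`[- L, L]%classic `*` `[- L, L]%classic))).
    apply: le_measure; rewrite ?inE//.
      by apply: measurableX; exact: measurable_itv.
    by move=> x /DL[x1 x2]; split; rewrite /= in_itv/= -ler_norml ltW.
  by rewrite area_rect// lee_fin expr2; lra.
- move=> a a' b aa'; rewrite -lee_fin.
  apply: (le_trans (increment_le_integral aa' (s0 b) _)).
    exact: continuous_slice0.
  apply: (le_trans (strip_integral0 b t0 tw s10 (measurable_itv _))).
  apply: strip_bound => //; last exact: strip.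
  by apply: measurableX => //; exact: measurable_itv.
- move=> a b b' bb'; rewrite -lee_fin.
  apply: (le_trans (increment_le_integral bb' (s1 a) _)).
    exact: continuous_slice1.
  apply: (le_trans (strip_integral1 a t1 tw s01 (measurable_itv _))).
  apply: strip_bound => //; last exact: strip'.
  by apply: measurableX => //; exact: measurable_itv.
Qed.

(** The two-dimensional replacement for the Sobolev embedding into Hölder
    functions of exponent 1/2: the norm of the mixed second derivative alone
    controls the sup norm and the modulus of continuity. *)
Lemma holder_estimate : exists2 L : R, 0 < L &
  (forall x, D x -> `|x.1| < L /\ `|x.2| < L) /\
  forall phi, test_function D phi ->
  let K := sqn (partial [:: 0; 1] phi) in
  [/\ forall p, `|phi p| <= Num.sqrt (4 * L ^+ 2 * K),
      forall a a' b, a <= a' ->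
        `|phi (a', b) - phi (a, b)| <= Num.sqrt (2 * L * (a' - a) * K) &
      forall a b b', b <= b' ->
        `|phi (a, b') - phi (a, b)| <= Num.sqrt (2 * L * (b' - b) * K)].
Proof.
have [L L0 DL] := bounded_in_box bD.
exists L; [exact: L0|split; [exact: DL|move=> phi tphi]].
have t0 := test_D 0 tphi; have t1 := test_D 1 tphi.
have s10 (a t : R) := smooth_slice1 a t (test_smooth t0).
have {}s10 := eq_ind _ (fun W : R * R -> R => forall a t : R,
  is_derive t 1 (fun s => ('D_(axis R 0) phi) (a, s)) (W (a, t))) s10 _
  (clairaut (test_smooth tphi)).
exact: (holder_estimate_aux L0 DL tphi t0 t1 (test_D 0 t1)
  (fun b t => smooth_slice0 b t (test_smooth tphi))
  (fun a t => smooth_slice1 a t (test_smooth tphi))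
  s10 (fun b t => smooth_slice0 b t (test_smooth t1))).
Qed.

End sup_norm.

(** * The Dirichlet form and the trilinear determinant form *)

(** Locked, so that second derivatives act as atoms in algebraic
    identities. *)
HB.lock Definition hess (R : realType) (i j : 'I_2) (u : R * R -> R) : R * R -> R :=
  partial [:: i; j] u.

Section forms.
Context (R : realType) (D : set (R * R)).
Hypotheses (oD : open D) (bD : bounded_set D).
Notation mu := (@area R).
Implicit Types (u v w phi : R * R -> R).
Local Notation integ f := (\int[mu]_(x in D) f x).
Local Notation d0 u := ('D_(axis R 0) u).
Local Notation d1 u := ('D_(axis R 1) u).

Let mD : @measurable _ (meas2 R) D := open_plane_measurable oD.

Lemma smoothB u v : smooth u -> smooth v -> smooth (fun x => u x - v x).
Proof.
move=> su sv; have := smoothD su (smoothZ (-1) sv).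
by under eq_fun do rewrite mulN1r.
Qed.

Lemma DB u v i x : smooth u -> smooth v ->
  'D_(axis R i) (fun x => u x - v x) x = 'D_(axis R i) u x - 'D_(axis R i) v x.
Proof. by move=> su sv; rewrite [LHS]deriveB//; exact: smooth_derivable. Qed.

Lemma integral_divergence (X Y dX dY : R * R -> R) :
  test_function D X -> test_function D Y -> d0 X = dX -> d1 Y = dY ->
  integ (fun x => dX x + dY x) = 0.
Proof.
move=> tX tY eX eY.
have tdX : test_function D dX by rewrite -eX; exact: test_D.
have tdY : test_function D dY by rewrite -eY; exact: test_D.
have := test_integralD_eq0 oD bD 0 tX; have := test_integralD_eq0 oD bD 1 tY.
rewrite eX eY => Y0 X0; rewrite RintegralD//; [|exact: test_integrable..].
by rewrite X0 Y0 addr0.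
Qed.

(** The bracket has divergence structure. The field with components phi (u0
    v11 - u1 v01) and phi (u1 v00 - u0 v01) has compact support; in its
    divergence the third derivatives w and z of v cancel, and what remains is
    phi times the bracket plus terms in the gradient of phi. The right-hand
    side is symmetric in the gradients of u and phi. *)
Lemma bracket_parts (phi u0 u1 v00 v01 v11 phi0 phi1 u00 u01 u11 w z : R * R -> R) :
  test_function D phi -> smooth u0 -> smooth u1 ->
  smooth v00 -> smooth v01 -> smooth v11 ->
  d0 phi = phi0 -> d1 phi = phi1 ->
  d0 u0 = u00 -> d1 u0 = u01 -> d0 u1 = u01 -> d1 u1 = u11 ->
  d0 v11 = w -> d1 v01 = w -> d0 v01 = z -> d1 v00 = z ->
  integ (fun x => (u00 x * v11 x + u11 x * v00 x - 2 * (u01 x * v01 x)) * phi x) =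
  - integ (fun x => v11 x * (u0 x * phi0 x) + v00 x * (u1 x * phi1 x) -
                    v01 x * (u0 x * phi1 x + u1 x * phi0 x)).
Proof.
move=> tphi su0 su1 sv00 sv01 sv11 e0 e1 e00 e01 e10 e11 ew ew' ez ez'.
have sphi := test_smooth tphi.
(* X0 and Y0 are the components of the field, without the factor phi *)
pose X0 x := u0 x * v11 x - u1 x * v01 x.
pose Y0 x := u1 x * v00 x - u0 x * v01 x.
have sX0 : smooth X0 by apply: smoothB; exact: smoothM.
have sY0 : smooth Y0 by apply: smoothB; exact: smoothM.
have tX := test_Mr tphi sX0; have tY := test_Mr tphi sY0.
have div := integral_divergence tX tY.
have tphi0 : test_function D phi0 by rewrite -e0; exact: test_D.
have tphi1 : test_function D phi1 by rewrite -e1; exact: test_D.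
have su00 : smooth u00 by rewrite -e00; exact: smooth_D.
have su01 : smooth u01 by rewrite -e01; exact: smooth_D.
have su11 : smooth u11 by rewrite -e11; exact: smooth_D.
have pt i (f g : R * R -> R) : 'D_(axis R i) f = g -> forall x, derive f x (axis R i) = g x.
  by move=> <-.
have dX x : (d0 (fun x => phi x * X0 x)) x =
    phi x * ((u0 x * w x + v11 x * u00 x) - (u1 x * z x + v01 x * u01 x)) + X0 x * phi0 x.
  rewrite (DM 0 x sphi sX0) /X0 (DB 0 x (smoothM su0 sv11) (smoothM su1 sv01)).
  rewrite (DM 0 x su0 sv11) (DM 0 x su1 sv01).
  by rewrite (pt _ _ _ e0) (pt _ _ _ ew) (pt _ _ _ e00) (pt _ _ _ ez) (pt _ _ _ e10).
have dY x : (d1 (fun x => phi x * Y0 x)) x =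
    phi x * ((u1 x * z x + v00 x * u11 x) - (u0 x * w x + v01 x * u01 x)) + Y0 x * phi1 x.
  rewrite (DM 1 x sphi sY0) /Y0 (DB 1 x (smoothM su1 sv00) (smoothM su0 sv01)).
  rewrite (DM 1 x su1 sv00) (DM 1 x su0 sv01).
  by rewrite (pt _ _ _ e1) (pt _ _ _ ez') (pt _ _ _ e11) (pt _ _ _ ew') (pt _ _ _ e01).
have := div _ _ (funext dX) (funext dY).
have I1 : mu.-integrable D (EFin \o (fun x =>
    (u00 x * v11 x + u11 x * v00 x - 2 * (u01 x * v01 x)) * phi x)).
  have s : smooth (fun x => u00 x * v11 x + u11 x * v00 x - 2 * (u01 x * v01 x)).
    by apply: smoothB; [apply: smoothD|apply: smoothZ]; exact: smoothM.
  by have := test_integrable oD bD (test_Mr tphi s); under eq_fun do rewrite mulrC.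
have I2 : mu.-integrable D (EFin \o (fun x => v11 x * (u0 x * phi0 x) +
     v00 x * (u1 x * phi1 x) - v01 x * (u0 x * phi1 x + u1 x * phi0 x))).
  have sA : smooth (fun x => v11 x * u0 x - v01 x * u1 x) by apply: smoothB; exact: smoothM.
  have sB : smooth (fun x => v00 x * u1 x - v01 x * u0 x) by apply: smoothB; exact: smoothM.
  have := test_integrable oD bD (test_Add (test_Mr tphi0 sA) (test_Mr tphi1 sB)).
  by apply: eq_integrable => // x _; congr EFin => /=; ring.
move=> E; apply/eqP; rewrite -addr_eq0 -RintegralD//; apply/eqP; rewrite -[RHS]E.
by apply: eq_Rintegral => x _; rewrite /X0 /Y0; ring.
Qed.

Lemma ibp i phi u dphi du : test_function D phi -> smooth u ->
  'D_(axis R i) phi = dphi -> 'D_(axis R i) u = du ->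
  integ (fun x => u x * dphi x) = - integ (fun x => du x * phi x).
Proof. by move=> tphi su <- <-; exact: integration_by_parts_test. Qed.

(** Each of the two derivatives of u00 u11 is moved once; the third derivative
    w appears only in between. *)
Lemma hessian_parts (u0 u1 u00 u01 u11 w : R * R -> R) :
  test_function D u0 -> test_function D u1 ->
  d0 u0 = u00 -> d1 u0 = u01 -> d0 u1 = u01 -> d1 u1 = u11 ->
  d0 u11 = w -> d1 u01 = w ->
  integ (fun x => u00 x * u11 x) = integ (fun x => u01 x * u01 x).
Proof.
move=> t0 t1 e00 e01 e10 e11 ew ew'.
have t11 : test_function D u11 by rewrite -e11; exact: test_D.
have t01 : test_function D u01 by rewrite -e01; exact: test_D.
rewrite (ibp t0 (test_smooth t01) e01 ew') -(ibp t0 (test_smooth t11) e00 ew).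
by apply: eq_Rintegral => x _; rewrite mulrC.
Qed.

Lemma hessE i j u : hess i j u = 'D_(axis R i) ('D_(axis R j) u).
Proof. by rewrite hess.unlock. Qed.

Definition lap u x := hess 0 0 u x + hess 1 1 u x.

(** The polar form of the Monge-Ampère operator: bracket u u is twice the
    determinant of the Hessian of u. *)
Definition bracket u v x :=
  hess 0 0 u x * hess 1 1 v x + hess 1 1 u x * hess 0 0 v x
  - 2 * (hess 0 1 u x * hess 0 1 v x).

Definition dirichlet u v := integ (fun x => lap u x * lap v x).

(** With the factor 2^-1, trilinear u u phi is the integral of the Hessian
    determinant of u times phi. *)
Definition trilinear u v phi := 2^-1 * integ (fun x => bracket u v x * phi x).

Lemma test_hess i j u : test_function D u -> test_function D (hess i j u).
Proof. by move=> tu; rewrite hess.unlock; exact: test_partial. Qed.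

Lemma test_lap u : test_function D u -> test_function D (lap u).
Proof. by move=> tu; apply: test_Add; exact: test_hess. Qed.

Lemma hess_sym u : smooth u -> hess 1 0 u = hess 0 1 u.
Proof. by move=> su; rewrite hess.unlock; exact: clairaut. Qed.

Lemma test_bracket u v : test_function D u -> test_function D v ->
  test_function D (bracket u v).
Proof.
move=> tu tv; have sv i j := test_smooth (test_hess i j tv).
have := test_Add (test_Add (test_Mr (test_hess 0 0 tu) (sv 1 1))
   (test_Mr (test_hess 1 1 tu) (sv 0 0)))
   (test_Z (- 2) (test_Mr (test_hess 0 1 tu) (sv 0 1))).
by rewrite /bracket; under eq_fun do rewrite mulNr.
Qed.

(** Together with the symmetry of the bracket, this makes the form totally
    symmetric, so that the equation is the critical point equation of a
    quadratic-cubic energy. Both sides are brought to the common form of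
    [bracket_parts], which is symmetric in u and phi. *)
Lemma trilinear_swap u v phi : test_function D u -> test_function D v ->
  test_function D phi -> trilinear u v phi = trilinear phi v u.
Proof.
move=> tu tv tphi; rewrite /trilinear; congr (_ * _).
have key (f g : R * R -> R) : test_function D f -> test_function D g ->
  integ (fun x => bracket f v x * g x) =
  - integ (fun x => hess 1 1 v x * ((d0 f) x * (d0 g) x) + hess 0 0 v x * ((d1 f) x * (d1 g) x) -
                    hess 0 1 v x * ((d0 f) x * (d1 g) x + (d1 f) x * (d0 g) x)).
  move=> tf tg; have sv i := test_smooth (test_D i tv).
  apply: (@bracket_parts g (d0 f) (d1 f) _ _ _ _ _ _ _ _ (d0 (hess 1 1 v)) (d0 (hess 0 1 v)) tg
    (test_smooth (test_D 0 tf)) (test_smooth (test_D 1 tf))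
    (test_smooth (test_hess 0 0 tv)) (test_smooth (test_hess 0 1 tv))
    (test_smooth (test_hess 1 1 tv)) erefl erefl).
  - by rewrite hessE.
  - by rewrite hessE; exact: clairaut (test_smooth tf).
  - by rewrite hessE.
  - by rewrite hessE.
  - by [].
  - by rewrite !hessE; exact: clairaut (sv 1).
  - by [].
  - by rewrite -(hess_sym (test_smooth tv)) !hessE; exact: clairaut (sv 0).
rewrite (key u phi tu tphi) (key phi u tphi tu).
have swap (a b c d p q r : R * R -> R) :
    - integ (fun x => p x * (a x * b x) + q x * (c x * d x) - r x * (a x * d x + c x * b x)) =
    - integ (fun x => p x * (b x * a x) + q x * (d x * c x) - r x * (b x * c x + d x * a x)).
  by congr (- _); apply: eq_Rintegral => x _; ring.
exact: (swap (d0 u) (d0 phi) (d1 u) (d1 phi) (hess 1 1 v) (hess 0 0 v) (hess 0 1 v)).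
Qed.

Lemma trilinear_sym u v phi : trilinear u v phi = trilinear v u phi.
Proof.
have swap (a b c d e f g : R * R -> R) :
    2^-1 * integ (fun x => (a x * b x + c x * d x - 2 * (e x * f x)) * g x) =
    2^-1 * integ (fun x => (d x * c x + b x * a x - 2 * (f x * e x)) * g x).
  by congr (_ * _); apply: eq_Rintegral => x _; ring.
exact: (swap (hess 0 0 u) (hess 1 1 v) (hess 1 1 u) (hess 0 0 v) (hess 0 1 u) (hess 0 1 v)).
Qed.

End forms.

Section form_properties.
Context (R : realType) (D : set (R * R)).
Hypotheses (oD : open D) (bD : bounded_set D).
Notation mu := (@area R).
Implicit Types (u v w phi : R * R -> R).
Local Notation sqn f := (\int[mu]_(x in D) (f x ^+ 2)).
Local Notation integ f := (\int[mu]_(x in D) f x).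
Local Notation test := (test_function D).

Let mD : @measurable _ (meas2 R) D := open_plane_measurable oD.

Lemma test_intM f g : test f -> test g ->
  mu.-integrable D (EFin \o (fun x => f x * g x)).
Proof. by move=> tf tg; have := test_integrable oD bD (test_Mr tf (test_smooth tg)). Qed.

Lemma integ_addl f g h : test f -> test g -> test h ->
  integ (fun x => (f x + g x) * h x) = integ (fun x => f x * h x) + integ (fun x => g x * h x).
Proof.
move=> tf tg th; rewrite -RintegralD//; [|exact: test_intM..].
by apply: eq_Rintegral => x _; rewrite mulrDl.
Qed.

Lemma integ_scll c f h : test f -> test h ->
  integ (fun x => (c * f x) * h x) = c * integ (fun x => f x * h x).
Proof.
move=> tf th; rewrite -RintegralZl//; last exact: test_intM.
by apply: eq_Rintegral => x _; rewrite mulrA.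
Qed.

Lemma hessD i j u v x : smooth u -> smooth v ->
  hess i j (fun x => u x + v x) x = hess i j u x + hess i j v x.
Proof. by move=> su sv; rewrite hess.unlock; exact: partialD. Qed.

Lemma hessZ i j c u x : smooth u -> hess i j (fun x => c * u x) x = c * hess i j u x.
Proof. by move=> su; rewrite hess.unlock; exact: partialZ. Qed.

Lemma dirichletC u v : dirichlet D u v = dirichlet D v u.
Proof. by apply: eq_Rintegral => x _; rewrite mulrC. Qed.

Lemma lapD u v x : smooth u -> smooth v ->
  lap (fun x => u x + v x) x = lap u x + lap v x.
Proof.
by move=> su sv; rewrite /lap (hessD 0 0 x su sv) (hessD 1 1 x su sv) addrACA.
Qed.

Lemma lapZ c u x : smooth u -> lap (fun x => c * u x) x = c * lap u x.
Proof. by move=> su; rewrite /lap (hessZ 0 0 c x su) (hessZ 1 1 c x su) mulrDr. Qed.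

Lemma bracketD u v w x : smooth u -> smooth v ->
  bracket (fun x => u x + v x) w x = bracket u w x + bracket v w x.
Proof.
move=> su sv; rewrite /bracket (hessD 0 0 x su sv) (hessD 1 1 x su sv) (hessD 0 1 x su sv).
move: (hess 0 0 u x) (hess 0 0 v x) (hess 1 1 u x) (hess 1 1 v x) (hess 0 1 u x) (hess 0 1 v x).
move: (hess 0 0 w x) (hess 1 1 w x) (hess 0 1 w x) => a b c d e f g h i.
by ring.
Qed.

Lemma bracketZ c u w x : smooth u ->
  bracket (fun x => c * u x) w x = c * bracket u w x.
Proof.
move=> su; rewrite /bracket (hessZ 0 0 c x su) (hessZ 1 1 c x su) (hessZ 0 1 c x su).
move: (hess 0 0 u x) (hess 1 1 u x) (hess 0 1 u x).
move: (hess 0 0 w x) (hess 1 1 w x) (hess 0 1 w x) => a d e f g h.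
by ring.
Qed.

Lemma dirichletD u v w : test u -> test v -> test w ->
  dirichlet D (fun x => u x + v x) w = dirichlet D u w + dirichlet D v w.
Proof.
move=> tu tv tw; rewrite /dirichlet -(integ_addl (test_lap tu) (test_lap tv) (test_lap tw)).
by apply: eq_Rintegral => x _; rewrite (lapD x (test_smooth tu) (test_smooth tv)).
Qed.

Lemma dirichletZ c u w : test u -> test w ->
  dirichlet D (fun x => c * u x) w = c * dirichlet D u w.
Proof.
move=> tu tw; rewrite /dirichlet -(integ_scll c (test_lap tu) (test_lap tw)).
by apply: eq_Rintegral => x _; rewrite (lapZ c x (test_smooth tu)).
Qed.

Lemma trilinearD u v w phi : test u -> test v -> test w -> test phi ->
  trilinear D (fun x => u x + v x) w phi = trilinear D u w phi + trilinear D v w phi.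
Proof.
move=> tu tv tw tphi; rewrite /trilinear -mulrDr.
rewrite -(integ_addl (test_bracket tu tw) (test_bracket tv tw) tphi).
congr (_ * _); apply: eq_Rintegral => x _.
by rewrite (bracketD w x (test_smooth tu) (test_smooth tv)).
Qed.

Lemma trilinearZ c u w phi : test u -> test w -> test phi ->
  trilinear D (fun x => c * u x) w phi = c * trilinear D u w phi.
Proof.
move=> tu tw tphi; rewrite /trilinear mulrCA.
rewrite -(integ_scll c (test_bracket tu tw) tphi).
congr (_ * _); apply: eq_Rintegral => x _.
by rewrite (bracketZ c w x (test_smooth tu)).
Qed.

(** The cross term 2 u00 u11 of the squared Laplacian integrates to 2 u01 ^ 2,
    by [hessian_parts]. *)
Lemma dirichlet_hess u : test u ->
  dirichlet D u u = sqn (hess 0 0 u) + sqn (hess 1 1 u) + 2 * sqn (hess 0 1 u).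
Proof.
move=> tu; have su := test_smooth tu.
have E : integ (fun x => hess 0 0 u x * hess 1 1 u x) = integ (fun x => hess 0 1 u x * hess 0 1 u x).
  rewrite !hessE.
  apply: (hessian_parts oD bD (test_D 0 tu) (test_D 1 tu) erefl (clairaut su) erefl erefl erefl).
  exact: clairaut (test_smooth (test_D 1 tu)).
have := test_sqintegrable oD bD (test_hess 0 0 tu).
have := test_sqintegrable oD bD (test_hess 1 1 tu).
have key (a b c : R * R -> R) : integ (fun x => a x * b x) = integ (fun x => c x * c x) ->
   sqintegrable mu D b -> sqintegrable mu D a ->
   integ (fun x => (a x + b x) * (a x + b x)) = sqn a + sqn b + 2 * sqn c.
  move=> e Ib Ia; have := sqn_addZ mD 1 Ia Ib; rewrite e mulr1 expr1n mul1r.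
  have -> : integ (fun x => c x * c x) = sqn c by apply: eq_Rintegral => x _; rewrite expr2.
  rewrite addrAC => <-; apply: eq_Rintegral => x _; rewrite mul1r; ring.
exact: (key (hess 0 0 u) (hess 1 1 u) (hess 0 1 u) E).
Qed.

Lemma sqn_hess01_le u : test u -> sqn (hess 0 1 u) <= dirichlet D u u.
Proof.
move=> tu; rewrite (dirichlet_hess tu).
have := sqn_ge0 mu D (hess 0 0 u); have := sqn_ge0 mu D (hess 1 1 u).
have := sqn_ge0 mu D (hess 0 1 u).
move: (sqn (hess 0 0 u)) (sqn (hess 1 1 u)) (sqn (hess 0 1 u)) => a b c; lra.
Qed.

Lemma dirichlet_ge0 u : 0 <= dirichlet D u u.
Proof. by apply: Rintegral_ge0 => x _; rewrite -expr2 sqr_ge0. Qed.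

(** Pointwise, the bracket is at most half the sum of the squared Hessian
    norms of u and v, whose integrals are the two Dirichlet forms. *)
Lemma trilinear_le u v phi N : test u -> test v -> test phi ->
  (forall x, `|phi x| <= N) ->
  `|trilinear D u v phi| <= N / 4 * (dirichlet D u u + dirichlet D v v).
Proof.
move=> tu tv tphi phiN; rewrite !dirichlet_hess// /trilinear.
have := test_sqintegrable oD bD (test_hess 0 0 tu).
have := test_sqintegrable oD bD (test_hess 1 1 tu).
have := test_sqintegrable oD bD (test_hess 0 1 tu).
have := test_sqintegrable oD bD (test_hess 0 0 tv).
have := test_sqintegrable oD bD (test_hess 1 1 tv).
have := test_sqintegrable oD bD (test_hess 0 1 tv).
have := test_intM (test_bracket tu tv) tphi.
rewrite /bracket.
move: (hess 0 0 u) (hess 1 1 u) (hess 0 1 u) (hess 0 0 v) (hess 1 1 v) (hess 0 1 v).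
move=> a b c d e f IT [_ If] [_ Ie] [_ Id] [_ Ic] [_ Ib] [_ Ia].
have Iac : mu.-integrable D (EFin \o (fun x => (a x ^+ 2 + b x ^+ 2) + 2 * c x ^+ 2)).
  by have := integrableD mD (integrableD mD Ia Ib) (integrableZl mD 2 Ic).
have Idf : mu.-integrable D (EFin \o (fun x => (d x ^+ 2 + e x ^+ 2) + 2 * f x ^+ 2)).
  by have := integrableD mD (integrableD mD Id Ie) (integrableZl mD 2 If).
have sumE g h k : mu.-integrable D (EFin \o (fun x => g x ^+ 2)) ->
   mu.-integrable D (EFin \o (fun x => h x ^+ 2)) ->
   mu.-integrable D (EFin \o (fun x => k x ^+ 2)) ->
   sqn g + sqn h + 2 * sqn k = integ (fun x => (g x ^+ 2 + h x ^+ 2) + 2 * k x ^+ 2).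
  move=> Ig Ih Ik; rewrite -RintegralZl// -!RintegralD//.
    by have := integrableD mD Ig Ih.
  by have := integrableZl mD 2 Ik.
rewrite (sumE a b c)// (sumE d e f)//.
rewrite normrM ger0_norm ?invr_ge0//.
rewrite -RintegralD// -RintegralZl//; last by have := integrableD mD Iac Idf.
have N0 : 0 <= N by exact: le_trans (phiN (0, 0)).
rewrite (le_trans (ler_wpM2l _ (le_normr_Rintegral mD IT)))// ?invr_ge0//.
rewrite -RintegralZl//; last exact: integrable_norm.
apply: le_Rintegral => //.
- by have := integrableZl mD 2^-1 (integrable_norm IT).
- by have := integrableZl mD (N / 4) (integrableD mD Iac Idf).
move=> x _; rewrite normrM (mulrA 2^-1).
have := phiN x; have := normr_ge0 (phi x).
move: (`|phi x|) => p p0 pN.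
rewrite [leRHS](_ : _ = (4^-1 * ((a x ^+ 2 + b x ^+ 2 + 2 * c x ^+ 2) +
  (d x ^+ 2 + e x ^+ 2 + 2 * f x ^+ 2))) * N); last by ring.
apply: ler_pM => //.
have : `|a x * e x + b x * d x - 2 * (c x * f x)| <=
   2^-1 * (a x ^+ 2 + b x ^+ 2 + 2 * c x ^+ 2 + (d x ^+ 2 + e x ^+ 2 + 2 * f x ^+ 2)).
  rewrite ler_norml.
  have := sqr_ge0 (a x + e x); have := sqr_ge0 (a x - e x).
  have := sqr_ge0 (b x + d x); have := sqr_ge0 (b x - d x).
  have := sqr_ge0 (c x + f x); have := sqr_ge0 (c x - f x).
  rewrite !expr2; move: (a x) (b x) (c x) (d x) (e x) (f x) => A B C E F G *.
  by apply/andP; split; lra.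
lra.
Qed.

End form_properties.

(** * A quadratic-cubic equation: a nontrivial solution without load *)

(** First-order condition at an almost maximizer w, as a statement on numbers.
    Here X, b, gam are the values of the quadratic form on (w, w), (w, phi),
    (phi, phi), and tau, sig, rho, kap those of the cubic form on (w, w, w),
    (w, w, phi), (w, phi, phi), (phi, phi, phi). The hypothesis compares the
    cubic form at w + t phi with its upper bound; all terms of second order in
    t are collected in the last summand of the conclusion. *)
Lemma quartic_slope (R : realType) (M c e X gam b t tau sig rho kap : R) :
  0 < M -> 0 <= X -> X <= 1 -> 0 <= gam -> gam <= 1 ->
  tau <= M * (X * (1 + X) / 2) -> M - e <= tau ->
  `|rho| <= c -> `|kap| <= c -> `|b| <= 1 -> `|t| <= 1 ->
  tau + 3 * t * sig + 3 * t ^+ 2 * rho + t ^+ 3 * kap <=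
    M * ((X + 2 * t * b + t ^+ 2 * gam) * (1 + (X + 2 * t * b + t ^+ 2 * gam)) / 2) ->
  0 <= e + t * (M * b * (1 + 2 * X) - 3 * sig) + (6 * M + 4 * c) * t ^+ 2.
Proof.
move=> M0 X0 w1 g0 phi1 tauM wM rhoc kapc b1 t1 H.
pose h := 2 * t * b + t ^+ 2 * gam.
have E : M * ((X + h) * (1 + (X + h)) / 2) = M * (X * (1 + X) / 2) +
   M * (t * b * (1 + 2 * X)) + M / 2 * (t ^+ 2 * gam * (1 + 2 * X) + h ^+ 2).
  by rewrite /h; field.
have t20 : 0 <= t ^+ 2 by exact: sqr_ge0.
have t2 : t ^+ 2 <= 1 by rewrite -(expr1n _ 2) -[t ^+ 2]real_normK ?num_real// ler_sqr ?nnegrE.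
have hle : h ^+ 2 <= 9 * t ^+ 2.
  have -> : h = t * (2 * b + t * gam) by rewrite /h; ring.
  rewrite exprMn mulrC ler_wpM2r//.
  have : `|2 * b + t * gam| <= 3.
    rewrite (le_trans (ler_normD _ _))// !normrM [`|gam|]ger0_norm// ger0_norm//.
    have : `|t| * gam <= 1 by rewrite mulr_ile1.
    lra.
  move=> h3; have -> : 9 = 3 ^+ 2 :> R by ring.
  by rewrite -[leLHS]real_normK ?num_real// ler_sqr ?nnegrE.
have A1 : M / 2 * (t ^+ 2 * gam * (1 + 2 * X) + h ^+ 2) <= M / 2 * (12 * t ^+ 2).
  rewrite ler_wpM2l ?divr_ge0 ?(ltW M0)//.
  have : t ^+ 2 * gam * (1 + 2 * X) <= t ^+ 2 * 3.
    rewrite -mulrA ler_wpM2l//.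
    have : gam * (1 + 2 * X) <= 1 * (1 + 2 * X) by rewrite ler_wpM2r//; lra.
    lra.
  lra.
have A2 : - (3 * t ^+ 2 * rho) <= 3 * t ^+ 2 * c.
  have rc : - rho <= c by rewrite (le_trans _ rhoc)// -normrN ler_norm.
  have := ler_wpM2l t20 rc; lra.
have A3 : - (t ^+ 3 * kap) <= t ^+ 2 * c.
  have -> : - (t ^+ 3 * kap) = t ^+ 2 * - (t * kap) by ring.
  rewrite ler_wpM2l// (le_trans (ler_norm _))// normrN normrM.
  by rewrite -[c]mul1r ler_pM.
have {}H : tau + 3 * t * sig + 3 * t ^+ 2 * rho + t ^+ 3 * kap <=
   M * ((X + h) * (1 + (X + h)) / 2) by move: H; rewrite /h !addrA.
rewrite E in H.
have PM : M * (X * (1 + X) / 2) <= M.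
  rewrite -[leRHS]mulr1 ler_wpM2l ?(ltW M0)//.
  have : X * (1 + X) <= 1 * (1 + X) by rewrite ler_wpM2r//; lra.
  lra.
lra.
Qed.

Section forms_on_a_type.
Context (R : realType) (V : Type) (add : V -> V -> V) (scl : R -> V -> V).
Implicit Types (u v w z phi : V) (a q : V -> V -> R).

(** The type V carries two bare operations. Vectors are compared only through
    values of forms, whose additivity and homogeneity supply all
    identities. *)
Definition sub u v := add u (scl (-1) v).

Definition linear_form (g : V -> R) :=
  (forall u v, g (add u v) = g u + g v) /\ (forall c u, g (scl c u) = c * g u).

Definition inner a :=
  [/\ forall w, linear_form (a ^~ w), forall u v, a u v = a v u & forall u, 0 <= a u u].

Definition sym_trilinear (T : V -> V -> V -> R) :=
  [/\ forall v w, linear_form (fun u => T u v w), forall u v w, T u v w = T v u w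
    & forall u v w, T u v w = T w v u].

Definition nrm a u := Num.sqrt (a u u).

Definition cauchy_seq_for a (u : nat -> V) := forall e, 0 < e ->
  exists K, forall j k, (K <= j)%N -> (K <= k)%N -> nrm a (sub (u j) (u k)) <= e.

(** The norm of the functional G k, in the dual of V normed by a, tends to
    0. *)
Definition vanishing a (G : nat -> V -> R) := forall e, 0 < e ->
  exists K, forall k, (K <= k)%N -> forall phi, `|G k phi| <= e * nrm a phi.

Section inner_product.
Variable a : V -> V -> R.
Hypothesis ia : inner a.

Lemma innerDl u v w : a (add u v) w = a u w + a v w. Proof. by case: ia => /(_ w)[]. Qed.
Lemma innerZl c u w : a (scl c u) w = c * a u w. Proof. by case: ia => /(_ w)[]. Qed.
Lemma innerC u v : a u v = a v u. Proof. by case: ia. Qed.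
Lemma inner_ge0 u : 0 <= a u u. Proof. by case: ia. Qed.
Lemma innerDr u v w : a w (add u v) = a w u + a w v.
Proof. by rewrite innerC innerDl !(innerC w). Qed.
Lemma innerZr c u w : a w (scl c u) = c * a w u.
Proof. by rewrite innerC innerZl innerC. Qed.

Definition innerE := (innerDl, innerDr, innerZl, innerZr).

Lemma nrm_ge0 u : 0 <= nrm a u. Proof. exact: sqrtr_ge0. Qed.

Lemma nrm_sqr u : nrm a u ^+ 2 = a u u.
Proof. by rewrite sqr_sqrtr// inner_ge0. Qed.

Lemma inner_cauchy_schwarz u v : `|a u v| <= nrm a u * nrm a v.
Proof.
rewrite -sqrtrM ?inner_ge0// -sqrtr_sqr ler_wsqrtr//.
apply: discriminant_le => t; have := inner_ge0 (add u (scl t v)).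
by rewrite !innerE (innerC v u); congr (0 <= _); ring.
Qed.

Lemma nrmZ c u : nrm a (scl c u) = `|c| * nrm a u.
Proof. by rewrite /nrm !innerE mulrA -expr2 sqrtrM ?sqr_ge0// sqrtr_sqr. Qed.

Lemma nrm_triangle u v : nrm a (add u v) <= nrm a u + nrm a v.
Proof.
rewrite -[leRHS]ger0_norm ?addr_ge0 ?nrm_ge0// -sqrtr_sqr ler_wsqrtr//.
rewrite !innerE (innerC v u) sqrrD !nrm_sqr.
have := inner_cauchy_schwarz u v; have := ler_norm (a u v); lra.
Qed.

Lemma nrm_sub u v : nrm a (sub u v) <= nrm a u + nrm a v.
Proof.
by rewrite (le_trans (nrm_triangle _ _))// nrmZ normrN1 mul1r.
Qed.

(** By homogeneity. On a vector of norm 0, a functional bounded on the unit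
    ball vanishes. *)
Lemma functional_bound (g : V -> R) (e : R) : linear_form g ->
  (forall phi, a phi phi <= 1 -> `|g phi| <= e) ->
  forall phi, `|g phi| <= e * nrm a phi.
Proof.
move=> [gD gZ] ge phi; have := nrm_ge0 phi; rewrite le_eqVlt => /predU1P[n0|n0].
  rewrite -n0 mulr0 normr_le0; apply/eqP/eqP/negPn/negP => gphi.
  have aphi : a phi phi = 0 by rewrite -nrm_sqr -n0 expr0n.
  have := ge (scl ((e + 1) / g phi) phi); rewrite !innerE aphi !mulr0 ler01 => /(_ isT).
  rewrite gZ divfK//; have := ler_norm (e + 1); lra.
have := ge (scl (nrm a phi)^-1 phi).
rewrite !innerE -nrm_sqr; have -> : (nrm a phi)^-1 * ((nrm a phi)^-1 * nrm a phi ^+ 2) = 1.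
  by field; rewrite gt_eqF.
rewrite lexx => /(_ isT); rewrite gZ normrM ger0_norm ?invr_ge0 ?nrm_ge0//.
by rewrite mulrC ler_pdivrMr.
Qed.

End inner_product.

Section trilinear_form.
Variable T : V -> V -> V -> R.
Hypothesis sT : sym_trilinear T.

Lemma tri12 u v w : T u v w = T v u w. Proof. by case: sT. Qed.
Lemma tri13 u v w : T u v w = T w v u. Proof. by case: sT. Qed.
Lemma tri23 u v w : T u v w = T u w v.
Proof. by rewrite tri13 tri12 tri13. Qed.
Lemma triD1 u v w z : T (add u v) w z = T u w z + T v w z.
Proof. by case: sT => /(_ w z)[]. Qed.
Lemma triZ1 c u w z : T (scl c u) w z = c * T u w z.
Proof. by case: sT => /(_ w z)[]. Qed.
Lemma triD2 u v w z : T w (add u v) z = T w u z + T w v z.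
Proof. by rewrite tri12 triD1 !(tri12 w). Qed.
Lemma triZ2 c u w z : T w (scl c u) z = c * T w u z.
Proof. by rewrite tri12 triZ1 (tri12 w). Qed.
Lemma triD3 u v w z : T w z (add u v) = T w z u + T w z v.
Proof. by rewrite tri13 triD1 !(tri13 w z). Qed.
Lemma triZ3 c u w z : T w z (scl c u) = c * T w z u.
Proof. by rewrite tri13 triZ1 (tri13 w). Qed.
Definition triE := (triD1, triD2, triD3, triZ1, triZ2, triZ3).

End trilinear_form.

Section nontrivial_critical_point.
Variables (q : V -> V -> R) (T : V -> V -> V -> R) (N : V -> R) (c : R).
Hypotheses (iq : inner q) (sT : sym_trilinear T) (c0 : 0 < c).
Hypothesis TN : forall u v phi, `|T u v phi| <= N phi * (nrm q u * nrm q v).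
Hypothesis N0 : forall phi, 0 <= N phi.
Hypothesis Nq : forall phi, N phi <= c * nrm q phi.
Hypothesis compactN : forall (w : nat -> V) (B : R), (forall k, nrm q (w k) <= B) ->
  exists2 s : nat -> nat, (forall k, (k <= s k)%N) &
    forall e, 0 < e -> exists K, forall j k, (K <= j)%N -> (K <= k)%N ->
      N (sub (w (s j)) (w (s k))) <= e.

Lemma T_le u v phi : `|T u v phi| <= c * (nrm q u * nrm q v * nrm q phi).
Proof.
rewrite (le_trans (TN u v phi))// mulrA [leRHS]mulrC -!mulrA.
have -> : nrm q u * (nrm q v * (nrm q phi * c)) = (c * nrm q phi) * (nrm q u * nrm q v).
  by ring.
by rewrite ler_wpM2r// mulr_ge0// nrm_ge0.
Qed.

Lemma T_unit u v phi : nrm q u <= 1 -> nrm q v <= 1 -> nrm q phi <= 1 ->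
  `|T u v phi| <= c.
Proof.
move=> u1 v1 p1; rewrite (le_trans (T_le u v phi))// -[leRHS]mulr1 ler_wpM2l ?(ltW c0)//.
have uv : nrm q u * nrm q v <= 1 by rewrite mulr_ile1 ?nrm_ge0.
by rewrite mulr_ile1 ?nrm_ge0// mulr_ge0 ?nrm_ge0.
Qed.

Lemma nrm_le1 u : (q u u <= 1) = (nrm q u <= 1).
Proof. by rewrite -(nrm_sqr iq) -[leRHS](expr1n _ 2) ler_sqr ?nnegrE ?nrm_ge0. Qed.

Lemma sqrt_le_mid (X : R) : 0 <= X -> Num.sqrt X <= (1 + X) / 2.
Proof.
move=> X0; have := sqr_ge0 (Num.sqrt X - 1); rewrite sqrrB sqr_sqrtr// mulr1; lra.
Qed.

(** Homogeneity bounds T v v v by M times the power 3/2 of X = q v v. The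
    polynomial X (1 + X) / 2 lies above that power and touches it at X = 1, so
    it is just as good for a first-order condition at almost maximizers and
    can be expanded along lines. *)
Lemma cubic_le M : 0 <= M -> (forall u, q u u <= 1 -> T u u u <= M) ->
  forall v, T v v v <= M * (q v v * (1 + q v v) / 2).
Proof.
move=> M0 HM v; have q0 := inner_ge0 iq v.
have n2 := nrm_sqr iq v.
apply: (@le_trans _ _ (M * (q v v * nrm q v))); last first.
  rewrite ler_wpM2l// -mulrA ler_wpM2l//; exact: sqrt_le_mid.
have := nrm_ge0 q v; rewrite le_eqVlt => /predU1P[n0|n0].
  have := T_le v v v; rewrite -n0 !mulr0 normr_le0 => /eqP ->; by [].
have := HM (scl (nrm q v)^-1 v); rewrite !(innerE iq) -n2.
have -> : (nrm q v)^-1 * ((nrm q v)^-1 * nrm q v ^+ 2) = 1.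
  by field; rewrite gt_eqF.
rewrite lexx => /(_ isT); rewrite !(triE sT).
have -> : (nrm q v)^-1 * ((nrm q v)^-1 * ((nrm q v)^-1 * T v v v)) =
    T v v v / (nrm q v ^+ 2 * nrm q v).
  by field; rewrite gt_eqF.
by rewrite ler_pdivrMr// mulr_gt0// exprn_gt0.
Qed.

(** Take t = sqrt e and t = - sqrt e. *)
Lemma slope_le (g e K : R) : 0 < e -> e <= 1 ->
  (forall t, `|t| <= 1 -> 0 <= e + t * g + K * t ^+ 2) ->
  `|g| <= (1 + K) * Num.sqrt e.
Proof.
move=> e0 e1 H; set s := Num.sqrt e.
have s0 : 0 < s by rewrite sqrtr_gt0.
have s2 : e = s ^+ 2 by rewrite sqr_sqrtr// ltW.
have s1 : s <= 1 by rewrite -(@sqrtr1 R) ler_wsqrtr.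
have := H s; have := H (- s); rewrite normrN ger0_norm ?(ltW s0)// => /(_ s1) h1 /(_ s1) h2.
rewrite ler_norml; rewrite s2 in h1 h2.
have e3 : s ^+ 2 + - s * g + K * (- s) ^+ 2 = s * ((1 + K) * s - g) by ring.
have e4 : s ^+ 2 + s * g + K * s ^+ 2 = s * ((1 + K) * s + g) by ring.
rewrite e3 pmulr_rge0// in h1; rewrite e4 pmulr_rge0// in h2.
apply/andP; split; lra.
Qed.

(** The Euler equation with multiplier for the cubic form on the unit ball, up
    to an error of order sqrt e. The majorant of [cubic_le] has slope M b (1 +
    2 X) at w, and this is close to 3 M b since M (1 - X) <= e. *)
Lemma almost_maximizer M e w : 0 < M -> (forall u, q u u <= 1 -> T u u u <= M) ->
  0 < e -> e <= 1 -> q w w <= 1 -> M - e <= T w w w ->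
  forall phi, `|q w phi - M^-1 * T w w phi| <=
    ((7 + 12 * M + 8 * c) / M * Num.sqrt e) * nrm q phi.
Proof.
move=> M0 HM e0 e1 w1 wM.
have lin : linear_form (fun phi => q w phi - M^-1 * T w w phi).
  split=> [u v|b u]; first by rewrite (innerDr iq) (triD3 sT); ring.
  by rewrite (innerZr iq) (triZ3 sT); ring.
apply: (functional_bound iq lin) => phi phi1.
have cub := cubic_le (ltW M0) HM.
set X := q w w in w1; set b := q w phi.
have X0 : 0 <= X by exact: inner_ge0.
have nw : nrm q w <= 1 by rewrite -nrm_le1.
have nphi : nrm q phi <= 1 by rewrite -nrm_le1.
have b1 : `|b| <= 1.
  by rewrite (le_trans (inner_cauchy_schwarz iq w phi))// mulr_ile1 ?nrm_ge0.
have g0 : 0 <= q phi phi by exact: inner_ge0.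
set gam := q phi phi in phi1 g0.
have sig := T_unit nw nw nphi; have rho := T_unit nw nphi nphi.
have kap := T_unit nphi nphi nphi.
have tau := cub w.
have expT t : T (add w (scl t phi)) (add w (scl t phi)) (add w (scl t phi)) =
   T w w w + 3 * t * T w w phi + 3 * t ^+ 2 * T w phi phi + t ^+ 3 * T phi phi phi.
  rewrite !(triE sT) (tri13 sT phi w w) (tri23 sT w phi w).
  by rewrite (tri12 sT phi w phi) (tri13 sT phi phi w); ring.
have expq t : q (add w (scl t phi)) (add w (scl t phi)) = X + 2 * t * b + t ^+ 2 * gam.
  by rewrite !(innerE iq) (innerC iq phi w) /X /b /gam; ring.
rewrite -/X in tau.
pose g := M * b * (1 + 2 * X) - 3 * T w w phi.
have gle : `|g| <= (1 + (6 * M + 4 * c)) * Num.sqrt e.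
  apply: slope_le => // t t1.
  have := cub (add w (scl t phi)); rewrite expT expq => H.
  exact: (quartic_slope M0 X0 w1 g0 phi1 tau wM rho kap b1 t1 H).
have XM : M * (1 - X) <= e.
  have : M * (X * (1 + X) / 2) <= M * X.
    rewrite ler_wpM2l ?(ltW M0)//.
    have : X * (1 + X) <= X * 2 by rewrite ler_wpM2l//; lra.
    lra.
  lra.
have s0 : 0 <= Num.sqrt e by exact: sqrtr_ge0.
have es : e <= Num.sqrt e.
  have := sqr_sqrtr (ltW e0); have : Num.sqrt e <= 1 by rewrite -(@sqrtr1 R) ler_wsqrtr.
  by move=> h1 h2; rewrite -{1}h2 expr2 -[leRHS]mulr1 ler_wpM2l.
have -> : b - M^-1 * T w w phi = (3 * M)^-1 * (g + 2 * b * (M * (1 - X))).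
  by rewrite /g; field; rewrite gt_eqF.
rewrite normrM ger0_norm ?invr_ge0 ?mulr_ge0 ?(ltW M0)//.
have num : `|g + 2 * b * (M * (1 - X))| <= (3 + (6 * M + 4 * c)) * Num.sqrt e.
  rewrite (le_trans (ler_normD _ _))// 2!normrM [`|2|]ger0_norm// [`|M * _|]ger0_norm; last first.
    by rewrite mulr_ge0 ?(ltW M0)// subr_ge0.
  have : 2 * `|b| * (M * (1 - X)) <= 2 * Num.sqrt e.
    rewrite -mulrA ler_wpM2l// -[leRHS]mul1r ler_pM//; last exact: le_trans es.
    by rewrite mulr_ge0 ?(ltW M0)// subr_ge0.
  lra.
rewrite mulrC ler_pdivrMr ?mulr_gt0// (le_trans num)//.
have -> : (7 + 12 * M + 8 * c) / M * Num.sqrt e * (3 * M) =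
   3 * (7 + 12 * M + 8 * c) * Num.sqrt e by field; rewrite gt_eqF.
by rewrite ler_wpM2r//; have := M0; have := c0; lra.
Qed.

(** The cubic form is maximized on the unit ball of q. Almost maximizers w_k
    satisfy the Euler equation q w_k phi = M^-1 T w_k w_k phi approximately.
    For x = w_j - w_k this gives, up to small errors, q x x = M^-1 T (w_j +
    w_k) x x, which is at most a multiple of N x; compactness of N thus makes
    a subsequence Cauchy for q itself. Rescaling by M^-1 removes the
    multiplier. *)
Lemma critical_sequence : (exists w, 0 < T w w w) ->
  exists z : nat -> V, [/\ cauchy_seq_for q z,
    vanishing q (fun k phi => q (z k) phi - T (z k) (z k) phi),
    exists B, forall k, nrm q (z k) <= B
  & exists2 d, 0 < d & forall k, d <= nrm q (z k)].
Proof.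
move=> [w0 Tw0].
pose S := [set T u u u | u in [set u | q u u <= 1]].
have n0 : 0 < nrm q w0.
  rewrite lt_neqAle nrm_ge0 andbT eq_sym; apply/negP => /eqP n0.
  by have := T_le w0 w0 w0; rewrite n0 !mulr0 normr_le0 => /eqP Tw; rewrite Tw ltxx in Tw0.
have ubS : ubound S c.
  move=> _ [u /= u1 <-]; rewrite nrm_le1 in u1.
  by rewrite (le_trans (ler_norm _))// T_unit.
pose M := sup S.
have hsS : has_sup S.
  split; last by exists c.
  exists (T (scl 0 w0) (scl 0 w0) (scl 0 w0)), (scl 0 w0) => //=.
  by rewrite !(innerE iq) !mul0r ler01.
have HM u : q u u <= 1 -> T u u u <= M.
  by move=> u1; apply: sup_upper_bound => //; exists u.
have M0 : 0 < M.
  apply: lt_le_trans (HM (scl (nrm q w0)^-1 w0) _).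
    by rewrite !(triE sT) !mulr_gt0// invr_gt0.
  rewrite !(innerE iq) -(nrm_sqr iq).
  have -> : (nrm q w0)^-1 * ((nrm q w0)^-1 * nrm q w0 ^+ 2) = 1 by field; rewrite gt_eqF.
  by [].
(* e <= 1 is required by almost_maximizer, and e <= M / 2 keeps the almost
   maximizers away from 0 *)
pose e0 := Num.min 1 (M / 2).
have e00 : 0 < e0 by rewrite lt_min ltr01 divr_gt0.
pose e k : R := e0 / k.+1%:R.
have ep k : 0 < e k by rewrite divr_gt0.
have ele k : e k <= e0 by rewrite ler_pdivrMr// ler_peMr ?(ltW e00)// ler1n.
have e1 k : e k <= 1 by rewrite (le_trans (ele k))// ge_min lexx.
have eM k : e k <= M / 2 by rewrite (le_trans (ele k))// ge_min lexx orbT.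
have [w Hw] : {w : nat -> V & forall k, q (w k) (w k) <= 1 /\ M - e k <= T (w k) (w k) (w k)}.
  apply: (@choice nat V (fun k w => q w w <= 1 /\ M - e k <= T w w w)) => k.
  have [_ [u /= u1 <-] /ltW uM] := sup_adherent (ep k) hsS.
  by exists u.
pose C := (7 + 12 * M + 8 * c) / M.
have C0 : 0 < C by rewrite divr_gt0// !addr_gt0// mulr_gt0.
have res k phi : `|q (w k) phi - M^-1 * T (w k) (w k) phi| <=
    (C * Num.sqrt (e k)) * nrm q phi.
  by have [w1 wM] := Hw k; apply: almost_maximizer.
have nw k : nrm q (w k) <= 1 by rewrite -nrm_le1; case: (Hw k).
have [s sk sN] := compactN nw.
have small (d : R) : 0 < d -> exists K, forall k, (K <= k)%N -> C * Num.sqrt (e (s k)) <= d.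
  move=> d0; have dC : 0 < (d / C) ^+ 2 / e0 by rewrite divr_gt0// exprn_gt0// divr_gt0.
  have [K HK] := ltr_add_invr (y := 0) (x := (d / C) ^+ 2 / e0) dC.
  exists K => k Kk; rewrite mulrC -ler_pdivlMr//.
  have dC0 : 0 <= d / C by rewrite divr_ge0 ?(ltW C0) ?(ltW d0).
  rewrite -(ger0_norm dC0) -sqrtr_sqr ler_wsqrtr//.
  rewrite /e mulrC -ler_pdivlMr//; move: HK; rewrite add0r => /ltW HK; apply: le_trans HK.
  by rewrite lef_pV2 ?posrE// ler_nat ltnS (leq_trans Kk).
have dif j k phi : T (w j) (w j) phi - T (w k) (w k) phi =
    T (add (w j) (w k)) phi (sub (w j) (w k)).
  rewrite /sub !(triE sT) (tri23 sT (w j) phi (w k)) (tri23 sT (w k) phi (w j)).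
  rewrite (tri12 sT (w k) (w j)) (tri23 sT (w j) phi (w j)) (tri23 sT (w k) phi (w k)).
  by ring.
have cauchyw : cauchy_seq_for q (w \o s).
  move=> d d0.
  have d1 : 0 < d ^+ 2 / 8 by rewrite divr_gt0// exprn_gt0.
  have d2 : 0 < M * (d ^+ 2 / 8) by rewrite mulr_gt0.
  have [K1 HK1] := small _ d1; have [K2 HK2] := sN _ d2.
  exists (maxn K1 K2) => j k; rewrite !geq_max => /andP[j1 j2] /andP[k1 k2].
  set x := sub _ _; have := HK1 _ j1; have := HK1 _ k1; have := HK2 _ _ j2 k2.
  rewrite -/x => Nx rk rj.
  have nx : nrm q x <= 2.
    by rewrite (le_trans (nrm_sub iq _ _))//; have := nw (s j); have := nw (s k); rewrite /=; lra.
  have := res (s j) x; have := res (s k) x.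
  have Td := dif (s j) (s k) x.
  have Tle : `|T (add (w (s j)) (w (s k))) x x| <= M * (d ^+ 2 / 8) * 4.
    rewrite (le_trans (TN _ _ _))// ler_pM ?mulr_ge0 ?nrm_ge0//.
    rewrite -[4]/(2 * 2)%:R natrM ler_pM ?nrm_ge0// (le_trans (nrm_triangle iq _ _))//.
    by have := nw (s j); have := nw (s k); lra.
  have qx : q x x = q (w (s j)) x - q (w (s k)) x by rewrite {1}/x /sub !(innerE iq); ring.
  have rkx : C * Num.sqrt (e (s k)) * nrm q x <= d ^+ 2 / 8 * 2.
    by rewrite ler_pM ?nrm_ge0// mulr_ge0 ?(ltW C0) ?sqrtr_ge0.
  have rjx : C * Num.sqrt (e (s j)) * nrm q x <= d ^+ 2 / 8 * 2.
    by rewrite ler_pM ?nrm_ge0// mulr_ge0 ?(ltW C0) ?sqrtr_ge0.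
  move=> /le_trans /(_ rkx) Rk /le_trans /(_ rjx) Rj.
  have qle : q x x <= d ^+ 2.
    rewrite qx.
    have -> : q (w (s j)) x - q (w (s k)) x =
      (q (w (s j)) x - M^-1 * T (w (s j)) (w (s j)) x) -
      (q (w (s k)) x - M^-1 * T (w (s k)) (w (s k)) x) +
      M^-1 * (T (w (s j)) (w (s j)) x - T (w (s k)) (w (s k)) x) by ring.
    rewrite Td.
    have h1 : M^-1 * T (add (w (s j)) (w (s k))) x x <= d ^+ 2 / 8 * 4.
      by rewrite ler_pdivrMl// mulrA (le_trans (ler_norm _)).
    move: Rk Rj; rewrite !ler_norml => /andP[? ?] /andP[? ?].
    lra.
  by rewrite /nrm -[leRHS]ger0_norm ?(ltW d0)// -sqrtr_sqr ler_wsqrtr.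
have Mi : 0 < M^-1 by rewrite invr_gt0.
exists (fun k => scl M^-1 (w (s k))); split.
- move=> d d0; have [K HK] := cauchyw (d * M) (mulr_gt0 d0 M0).
  exists K => j k jK kK; have := HK j k jK kK.
  have -> : nrm q (sub (scl M^-1 (w (s j))) (scl M^-1 (w (s k)))) =
     M^-1 * nrm q (sub (w (s j)) (w (s k))).
    rewrite -[M^-1 in RHS]ger0_norm ?(ltW Mi)// -nrmZ// /nrm /sub !(innerE iq).
    by congr Num.sqrt; ring.
  by rewrite ler_pdivrMl// mulrC.
- move=> d d0; have [K HK] := small (d * M) (mulr_gt0 d0 M0).
  exists K => k kK phi; rewrite (innerZl iq) !(triE sT).
  have -> : M^-1 * q (w (s k)) phi - M^-1 * (M^-1 * T (w (s k)) (w (s k)) phi) =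
    M^-1 * (q (w (s k)) phi - M^-1 * T (w (s k)) (w (s k)) phi) by ring.
  rewrite normrM [`|M^-1|]ger0_norm ?(ltW Mi)// ler_pdivrMl// (le_trans (res _ _))//.
  rewrite mulrA [M * d]mulrC ler_wpM2r ?nrm_ge0//; exact: HK.
- exists M^-1 => k; rewrite nrmZ// ger0_norm ?(ltW Mi)// -[leRHS]mulr1.
  by rewrite ler_wpM2l ?(ltW Mi).
- exists (M^-1 * (1 / 2)); first by rewrite mulr_gt0.
  move=> k; rewrite nrmZ// ger0_norm ?(ltW Mi)// ler_wpM2l ?(ltW Mi)//.
  have [_ wM] := Hw (s k).
  have := cubic_le (ltW M0) HM (w (s k)); rewrite -(nrm_sqr iq).
  set x := nrm q (w (s k)) => Tc.
  have x0 : 0 <= x by exact: nrm_ge0.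
  have x1 : x <= 1 by exact: nw.
  rewrite leNgt; apply/negP => xlt.
  have : M / 2 <= M * (x ^+ 2 * (1 + x ^+ 2) / 2).
    by apply: le_trans Tc; apply: le_trans wM; have := eM (s k); lra.
  rewrite ler_pM2l//.
  have : x ^+ 2 <= 1 / 4.
    have h : x <= 1 / 2 by exact: ltW.
    by have := ler_pM x0 x0 h h; rewrite expr2; lra.
  have : 0 <= x ^+ 2 by exact: sqr_ge0.
  move: (x ^+ 2) => y y0 y1.
  have : y * (1 + y) <= 1 / 4 * (1 + y) by rewrite ler_wpM2r//; lra.
  lra.
Qed.

End nontrivial_critical_point.

End forms_on_a_type.

(** * A quadratic-cubic equation: two solutions under a small load *)

Section two_critical_points.
Context (R : realType) (V : Type) (add : V -> V -> V) (scl : R -> V -> V).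
Implicit Types (u v w z phi : V).
Local Notation inner := (inner add scl).
Local Notation linear_form := (linear_form add scl).
Local Notation sym_trilinear := (sym_trilinear add scl).
Local Notation cauchy_seq_for := (cauchy_seq_for add scl).
Local Notation sub := (sub add scl).

Section local_minimum.
Variables (a : V -> V -> R) (T : V -> V -> V -> R) (l : V -> R) (c r lk : R).
Hypotheses (ia : inner a) (sT : sym_trilinear T) (ll : linear_form l) (c0 : 0 < c).
Hypothesis TN : forall u v phi, `|T u v phi| <= c * (nrm a u * nrm a v * nrm a phi).
Hypothesis cr : c * r = 1 / 4.
Hypothesis lN : forall phi, `|l phi| <= lk * nrm a phi.
Hypothesis lkr : lk <= r / 8.
Variable w0 : V.

Let r0 : 0 < r. Proof. by rewrite -(pmulr_rgt0 _ c0) cr. Qed.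

(** The equation a u = T u u + l is the critical point equation of this
    function. *)
Definition energy u := 2^-1 * a u u - 3^-1 * T u u u - l u.

Let lD u v : l (add u v) = l u + l v. Proof. by case: ll. Qed.
Let lZ t u : l (scl t u) = t * l u. Proof. by case: ll. Qed.

(** In the ball of radius r, where c r = 1 / 4, the cubic term is at most a
    sixth of the quadratic one. The energy is therefore bounded below by a
    positive constant for norms between r / 2 and r, while it vanishes at the
    origin. *)
Lemma energy_coercive u : nrm a u <= r -> nrm a u * (5 / 12 * nrm a u - r / 8) <= energy u.
Proof.
move=> ur; rewrite /energy -(nrm_sqr ia).
have := TN u u u; have := lN u; set n := nrm a u.
have n0 : 0 <= n by exact: nrm_ge0.
move=> lu Tu.
have h1 : T u u u <= n ^+ 2 / 4.
  rewrite (le_trans (ler_norm _))// (le_trans Tu)//.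
  have -> : c * (n * n * n) = n ^+ 2 * (c * n) by ring.
  have -> : n ^+ 2 / 4 = n ^+ 2 * (1 / 4) by ring.
  by rewrite ler_wpM2l ?sqr_ge0// -cr ler_wpM2l// ltW.
have h2 : l u <= r / 8 * n.
  by rewrite (le_trans (ler_norm _))// (le_trans lu)// ler_wpM2r.
have -> : n * (5 / 12 * n - r / 8) = 5 / 12 * n ^+ 2 - r / 8 * n by ring.
lra.
Qed.

Lemma energy_expand u phi h : energy (add u (scl h phi)) =
  energy u + h * (a u phi - T u u phi - l phi) +
  h ^+ 2 * (2^-1 * a phi phi - T u phi phi) - h ^+ 3 * (3^-1 * T phi phi phi).
Proof.
rewrite /energy lD lZ !(innerE ia) !(triE sT) (innerC ia phi u).
rewrite (tri13 sT phi u u) (tri23 sT u phi u) (tri12 sT phi u phi) (tri13 sT phi phi u).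
by field.
Qed.

(** The parallelogram law up to a cubic term. In the ball of radius r the
    cubic term is dominated, so the energy is strongly convex there and
    minimizing sequences are Cauchy. *)
Lemma energy_midpoint u v : energy u + energy v -
   2 * energy (scl 2^-1 (add u v)) =
  4^-1 * a (sub u v) (sub u v) - 2 * T (scl 2^-1 (add u v)) (scl 2^-1 (sub u v)) (scl 2^-1 (sub u v)).
Proof.
rewrite /energy /sub ?(lD, lZ) !(innerE ia) !(triE sT) (innerC ia v u).
rewrite (tri13 sT v u u) (tri23 sT u v u) (tri12 sT v u v) (tri13 sT v v u).
by field.
Qed.

(** A minimizing sequence for the energy in the ball of radius r. By
    coercivity it stays in the ball of radius r / 2, which leaves room for the
    perturbations that show the differential of the energy to be small, and
    for the midpoints that show the sequence to be Cauchy. *)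
Lemma local_minimum : exists u : nat -> V, [/\ forall k, nrm a (u k) <= r,
   cauchy_seq_for a u &
   vanishing a (fun k phi => a (u k) phi - T (u k) (u k) phi - l phi)].
Proof.
have lk0 : 0 <= lk * nrm a w0 by exact: le_trans (lN w0).
pose S := [set energy u | u in [set u | nrm a u <= r]].
have lbS : lbound S (- (r * (r / 8))).
  move=> _ [u /= ur <-]; apply: le_trans (energy_coercive ur).
  have n0 := nrm_ge0 a u.
  have : 0 <= nrm a u * nrm a u by rewrite mulr_ge0.
  have : nrm a u * (r / 8) <= r * (r / 8) by rewrite ler_wpM2r// divr_ge0// ltW.
  lra.
have z0 : nrm a (scl 0 w0) = 0 by rewrite (nrmZ ia) normr0 mul0r.
have E0 : energy (scl 0 w0) = 0.
  by rewrite /energy lZ !(innerE ia) !(triE sT) !mul0r !mulr0 !subr0.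
have hiS : has_inf S.
  split; last by exists (- (r * (r / 8))).
  by exists 0, (scl 0 w0) => //=; rewrite z0 ltW.
pose m := inf S.
have Hm u : nrm a u <= r -> m <= energy u.
  by move=> ur; apply: ge_inf => //; [exact: hiS.2|exists u].
have m0 : m <= 0 by rewrite -E0; apply: Hm; rewrite z0 ltW.
(* energy_coercive gives at least r ^ 2 / 24 for norms above r / 2, so values
   below r ^ 2 / 48 force the norm below r / 2 *)
pose e0 := Num.min 1 (r ^+ 2 / 48).
have r2 : 0 < r ^+ 2 by rewrite exprn_gt0.
have e00 : 0 < e0 by rewrite lt_min ltr01 divr_gt0.
pose e k : R := e0 / k.+1%:R.
have ep k : 0 < e k by rewrite divr_gt0.
have ele k : e k <= e0 by rewrite ler_pdivrMr// ler_peMr ?(ltW e00)// ler1n.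
have e1 k : e k <= 1 by rewrite (le_trans (ele k))// ge_min lexx.
have er k : e k <= r ^+ 2 / 48 by rewrite (le_trans (ele k))// ge_min lexx orbT.
have [u Hu] : {u : nat -> V & forall k, nrm a (u k) <= r /\ energy (u k) <= m + e k}.
  apply: (@choice nat V (fun k u => nrm a u <= r /\ energy u <= m + e k)) => k.
  have [_ [u /= u1 <-] /ltW uM] := inf_adherent (ep k) hiS.
  by exists u.
have ur2 k : nrm a (u k) <= r / 2.
  rewrite leNgt; apply/negP => uk; have [u1 uM] := Hu k.
  have := r0; have := energy_coercive u1; set n := nrm a (u k) in uk u1 *.
  have : r / 2 * (r / 12) <= n * (5 / 12 * n - r / 8).
    by rewrite ler_pM ?divr_ge0 ?(ltW r0)//; [exact: ltW|lra].
  have := er k; rewrite expr2 => ek.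
  have : 0 < r * r by rewrite mulr_gt0.
  lra.
have small (C d : R) : 0 < C -> 0 < d -> exists K, forall k, (K <= k)%N -> C * e k <= d.
  move=> C0 d0; have dC : 0 < d / C / e0 by rewrite !divr_gt0.
  have [K HK] := ltr_add_invr (y := 0) (x := d / C / e0) dC.
  exists K => k Kk; rewrite mulrC -ler_pdivlMr// /e mulrC -ler_pdivlMr//.
  move: HK; rewrite add0r => /ltW HK; apply: le_trans HK.
  by rewrite lef_pV2 ?posrE// ler_nat ltnS.
exists u; split=> [k||]; first by case: (Hu k).
- move=> d d0; have d2 : 0 < d ^+ 2 by rewrite exprn_gt0.
  have [K HK] := small 16 _ (ltr0n _ 16) d2.
  exists K => j k jK kK.
  set x := sub _ _; pose mid := scl 2^-1 (add (u j) (u k)).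
  have nmid : nrm a mid <= r.
    rewrite (nrmZ ia) ger0_norm ?invr_ge0// ler_pdivrMl//.
    by rewrite (le_trans (nrm_triangle ia _ _))//; have := ur2 j; have := ur2 k; have := r0; lra.
  have := energy_midpoint (u j) (u k); rewrite -/mid -/x.
  have := Hm _ nmid; have := (Hu j).2; have := (Hu k).2.
  have : `|T mid (scl 2^-1 x) (scl 2^-1 x)| <= nrm a x ^+ 2 / 16.
    rewrite (le_trans (TN _ _ _))// !(nrmZ ia 2^-1 x) !ger0_norm ?invr_ge0//.
    have -> : c * (nrm a mid * (2^-1 * nrm a x) * (2^-1 * nrm a x)) =
      (c * nrm a mid) * (nrm a x ^+ 2 / 4) by field.
    have -> : nrm a x ^+ 2 / 16 = 1 / 4 * (nrm a x ^+ 2 / 4) by field.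
    by rewrite ler_wpM2r ?divr_ge0 ?sqr_ge0// -cr ler_wpM2l// ltW.
  rewrite -(nrm_sqr ia) ler_norml => /andP[_ Tx] h1 h2 h3 h4.
  have := HK j jK; have := HK k kK => g1 g2.
  have : nrm a x ^+ 2 <= d ^+ 2 by lra.
  by rewrite ler_sqr ?nnegrE ?nrm_ge0// ltW.
- move=> d d0.
  pose C := (2 / r) * (1 + r ^+ 2 / 4).
  have C0 : 0 < C by rewrite mulr_gt0 ?divr_gt0// addr_gt0// divr_gt0.
  have dC2 : 0 < (d / C) ^+ 2 by rewrite exprn_gt0// divr_gt0.
  have [K HK] := small 1 _ ltr01 dC2.
  exists K => k kK.
  have lin : linear_form (fun phi => a (u k) phi - T (u k) (u k) phi - l phi).
    split=> [v w|b v]; first by rewrite (innerDr ia) (triD3 sT) lD; ring.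
    by rewrite (innerZr ia) (triZ3 sT) lZ; ring.
  apply: (functional_bound ia lin) => phi phi1.
  have nphi : nrm a phi <= 1 by rewrite -(nrm_le1 ia).
  have sle : `|r / 2 * (a (u k) phi - T (u k) (u k) phi - l phi)| <=
      (1 + r ^+ 2 / 4) * Num.sqrt (e k).
    apply: slope_le => // t t1.
    have inball : nrm a (add (u k) (scl (t * (r / 2)) phi)) <= r.
      rewrite (le_trans (nrm_triangle ia _ _))// (nrmZ ia) normrM [`|r / 2|]ger0_norm ?divr_ge0 ?(ltW r0)//.
      have : `|t| * (r / 2) * nrm a phi <= r / 2.
        rewrite mulrAC -[leRHS]mul1r ler_wpM2r ?divr_ge0 ?(ltW r0)//.
        by rewrite mulr_ile1// nrm_ge0.
      by have := ur2 k; lra.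
    have := Hm _ inball; rewrite energy_expand; have := (Hu k).2.
    have ur1 := ur2 k.
    have rho : `|T (u k) phi phi| <= 1 / 4.
      rewrite (le_trans (TN _ _ _))// -cr ler_wpM2l ?(ltW c0)//.
      have -> : nrm a (u k) * nrm a phi * nrm a phi = nrm a (u k) * (nrm a phi * nrm a phi) by ring.
      rewrite -[leRHS]mulr1 ler_pM ?mulr_ge0 ?nrm_ge0//; last by rewrite mulr_ile1 ?nrm_ge0.
      by case: (Hu k).
    have kap : `|T phi phi phi| <= c.
      rewrite (le_trans (TN _ _ _))// -[leRHS]mulr1 ler_wpM2l ?(ltW c0)//.
      by rewrite !mulr_ile1 ?mulr_ge0 ?nrm_ge0.
    move: (a (u k) phi - T (u k) (u k) phi - l phi) => G.
    move: (T (u k) phi phi) (T phi phi phi) (a phi phi) rho kap phi1 => rho kap gam rhoc kapc gam1.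
    move=> H1 H2.
    have t20 : 0 <= (t * (r / 2)) ^+ 2 by exact: sqr_ge0.
    have q1 : (t * (r / 2)) ^+ 2 * (2^-1 * gam - rho) <= (t * (r / 2)) ^+ 2 * (3 / 4).
      by rewrite ler_wpM2l//; move: rhoc; rewrite ler_norml => /andP[? ?]; lra.
    have q2 : - ((t * (r / 2)) ^+ 3 * (3^-1 * kap)) <= (t * (r / 2)) ^+ 2 * (1 / 4).
      have -> : - ((t * (r / 2)) ^+ 3 * (3^-1 * kap)) =
         (t * (r / 2)) ^+ 2 * ((3^-1 * (1 / 2)) * - (t * (r * kap))) by ring.
      rewrite ler_wpM2l//.
      have : `|t * (r * kap)| <= 1 / 4.
        rewrite !normrM -[1 / 4]mul1r ler_pM// ?mulr_ge0//.
        by rewrite [`|r|]ger0_norm ?(ltW r0)// mulrC -cr ler_wpM2r// ltW.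
      by rewrite ler_norml => /andP[? ?]; lra.
    have q3 : (t * (r / 2)) ^+ 2 = r ^+ 2 / 4 * t ^+ 2 by field.
    rewrite q3 in q1 q2 H2.
    have -> : t * (r / 2 * G) = t * (r / 2) * G by ring.
    lra.
  have : `|a (u k) phi - T (u k) (u k) phi - l phi| <= C * Num.sqrt (e k).
    move: sle; rewrite normrM [`|r / 2|]ger0_norm ?divr_ge0 ?(ltW r0)//.
    rewrite -ler_pdivlMl ?divr_gt0// => /le_trans; apply.
    by rewrite le_eqVlt; apply/orP; left; apply/eqP; rewrite /C; field; rewrite gt_eqF.
  move=> /le_trans; apply; rewrite mulrC -ler_pdivlMr//.
  have dC0 : 0 <= d / C by rewrite divr_ge0 ?ltW.
  rewrite -(ger0_norm dC0) -sqrtr_sqr ler_wsqrtr//.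
  by have := HK k kK; rewrite mul1r.
Qed.

End local_minimum.

Section linearized_form.
Variables (a : V -> V -> R) (T : V -> V -> V -> R) (c r : R) (u : nat -> V).
Hypotheses (ia : inner a) (sT : sym_trilinear T) (c0 : 0 < c) (cr : c * r = 1 / 4).
Hypothesis TN : forall u v phi, `|T u v phi| <= c * (nrm a u * nrm a v * nrm a phi).
Hypotheses (ur : forall k, nrm a (u k) <= r) (cu : cauchy_seq_for a u).

Let b k w phi := a w phi - 2 * T (u k) w phi.

(** Second variation of the energy at the limit of the sequence u. It is
    defined as a limit of values because V need not contain that limit. *)
Definition linearized w phi := limn (fun k => b k w phi).

Let b_cauchy e : 0 < e -> exists K, forall j k, (K <= j)%N -> (K <= k)%N ->
  forall w phi, `|b j w phi - b k w phi| <= e * (nrm a w * nrm a phi).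
Proof.
move=> e0; have ec : 0 < e / (2 * c) by rewrite divr_gt0 ?mulr_gt0.
have [K HK] := cu ec; exists K => j k jK kK w phi.
have -> : b j w phi - b k w phi = - 2 * T (sub (u j) (u k)) w phi.
  by rewrite /b /sub !(triE sT); ring.
rewrite normrM normrN [`|2|]ger0_norm//.
have P0 : 0 <= nrm a w * nrm a phi by rewrite mulr_ge0// nrm_ge0.
have := ler_wpM2r P0 (HK j k jK kK).
have := TN (sub (u j) (u k)) w phi.
rewrite -[nrm a (sub _ _) * _ * _]mulrA; move: (nrm a (sub _ _) * _) => s h1 h2.
have : c * s <= c * (e / (2 * c) * (nrm a w * nrm a phi)) by rewrite ler_wpM2l// ltW.
have -> : c * (e / (2 * c) * (nrm a w * nrm a phi)) = e / 2 * (nrm a w * nrm a phi).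
  by field; rewrite gt_eqF.
lra.
Qed.

Lemma linearized_cvg w phi : b k w phi @[k --> \oo] --> linearized w phi.
Proof.
apply/cauchy_cvgP/cauchy_exP => e e0.
have P0 : 0 < nrm a w * nrm a phi + 1 by rewrite ltr_wpDl// mulr_ge0// nrm_ge0.
have e2 : 0 < e / (2 * (nrm a w * nrm a phi + 1)) by rewrite divr_gt0// mulr_gt0.
have [K HK] := b_cauchy e2.
exists (b K w phi); exists K => // k /= Kk; rewrite /ball/=.
rewrite (le_lt_trans (HK _ _ (leqnn K) Kk w phi))//.
rewrite mulrAC ltr_pdivrMr ?mulr_gt0//.
have : e * (nrm a w * nrm a phi) < e * (nrm a w * nrm a phi + 1) by rewrite ltr_pM2l// ltrDl.
have : 0 < e * (nrm a w * nrm a phi + 1) by rewrite mulr_gt0.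
lra.
Qed.

Lemma linearized_near e : 0 < e -> exists K, forall k, (K <= k)%N -> forall w phi,
  `|linearized w phi - b k w phi| <= e * (nrm a w * nrm a phi).
Proof.
move=> e0; have [K HK] := b_cauchy e0; exists K => k Kk w phi.
have h : `|b j w phi - b k w phi| @[j --> \oo] --> `|linearized w phi - b k w phi|.
  by apply: cvg_norm; apply: cvgB; [exact: linearized_cvg|exact: cvg_cst].
apply: (ler_cvg_to h (cvg_cst _)).
by exists K => // j /= Kj; exact: HK.
Qed.

Lemma linearized_bounds w :
  2^-1 * a w w <= linearized w w <= 2 * a w w.
Proof.
have bnd k : `|2 * T (u k) w w| <= 2^-1 * a w w.
  rewrite normrM [`|2|]ger0_norm// -(nrm_sqr ia).
  have : `|T (u k) w w| <= 1 / 4 * nrm a w ^+ 2.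
    rewrite (le_trans (TN _ _ _))//.
    have -> : c * (nrm a (u k) * nrm a w * nrm a w) = c * nrm a (u k) * nrm a w ^+ 2 by ring.
    by rewrite ler_wpM2r ?sqr_ge0// -cr ler_wpM2l// ltW.
  lra.
have a0 := inner_ge0 ia w.
apply/andP; split.
  apply: (cvgr_to_ge (@linearized_cvg w w)).
  by apply: nearW => k; have := bnd k; rewrite ler_norml => /andP[? ?]; rewrite /b; lra.
apply: (cvgr_to_le (@linearized_cvg w w)).
by apply: nearW => k; have := bnd k; rewrite ler_norml => /andP[? ?]; rewrite /b; lra.
Qed.

Lemma linearized_inner : inner linearized.
Proof.
split.
- move=> w; split=> [v1 v2|s v].
    apply: cvg_lim => //.
    have -> : b^~ (add v1 v2) ^~ w = (fun k => b k v1 w + b k v2 w).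
      by apply/funext => k; rewrite /b (innerDl ia) (triD2 sT); ring.
    by apply: cvgD; exact: linearized_cvg.
  apply: cvg_lim => //.
  have -> : b^~ (scl s v) ^~ w = (fun k => s * b k v w).
    by apply/funext => k; rewrite /b (innerZl ia) (triZ2 sT); ring.
  by apply: cvgMl_tmp; exact: linearized_cvg.
- move=> v w; rewrite /linearized.
  rewrite (_ : (fun k => b k v w) = (fun k => b k w v)); first by [].
  by apply/funext => k; rewrite /b (innerC ia) (tri23 sT).
- move=> v; have /andP[h _] := linearized_bounds v.
  by rewrite (le_trans _ h)// mulr_ge0// (inner_ge0 ia).
Qed.

End linearized_form.

(** V is an incomplete space, so a solution of a u = T u u + l is represented
    by a Cauchy sequence whose residuals vanish in the dual norm. *)
Definition approximate_solution a (T : V -> V -> V -> R) (l : V -> R) (u : nat -> V) :=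
  [/\ cauchy_seq_for a u, exists B, forall k, nrm a (u k) <= B &
   vanishing a (fun k phi => a (u k) phi - T (u k) (u k) phi - l phi)].

(** Let u be the local minimum and q the second variation of the energy there.
    Expanding the equation at u + z, the terms free of z cancel and the terms
    linear in z give q, so u + z is a solution exactly when q z = T z z. For a
    load small enough q is equivalent to a, and [critical_sequence], applied
    to q, gives such a z away from 0. *)
Lemma two_approximate_solutions (a : V -> V -> R) (T : V -> V -> V -> R)
    (N l : V -> R) (c kappa : R) :
  inner a -> sym_trilinear T -> linear_form l -> 0 < c -> 0 <= kappa ->
  (forall phi, 0 <= N phi) ->
  (forall u v phi, `|T u v phi| <= N phi * (nrm a u * nrm a v)) ->
  (forall phi, N phi <= c * nrm a phi) ->
  (forall phi, `|l phi| <= kappa * nrm a phi) ->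
  (forall (w : nat -> V) (B : R), (forall k, nrm a (w k) <= B) ->
    exists2 s : nat -> nat, (forall k, (k <= s k)%N) &
      forall e, 0 < e -> exists K, forall j k, (K <= j)%N -> (K <= k)%N ->
        N (sub (w (s j)) (w (s k))) <= e) ->
  (exists w, 0 < T w w w) ->
  exists2 lambda0, 0 < lambda0 & forall lambda, 0 < lambda < lambda0 ->
    exists u v : nat -> V,
      [/\ approximate_solution a T (fun phi => lambda * l phi) u,
          approximate_solution a T (fun phi => lambda * l phi) v &
          exists2 d, 0 < d & forall k, d <= nrm a (sub (v k) (u k))].
Proof.
move=> ia sT [lD lZ] c0 k0 N0 TN Na lk compactN exT.
pose r := (4 * c)^-1.
have r0 : 0 < r by rewrite invr_gt0 mulr_gt0.
have cr : c * r = 1 / 4 by rewrite /r; field; rewrite gt_eqF.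
have TNc u v phi : `|T u v phi| <= c * (nrm a u * nrm a v * nrm a phi).
  rewrite (le_trans (TN u v phi))//.
  have -> : c * (nrm a u * nrm a v * nrm a phi) = (c * nrm a phi) * (nrm a u * nrm a v) by ring.
  by rewrite ler_wpM2r// mulr_ge0// nrm_ge0.
clearbody r.
(* the smallness of the load required by local_minimum: lambda kappa <= r / 8 *)
exists (r / 8 / (kappa + 1)); first by rewrite !divr_gt0// ltr_wpDl.
move=> lambda /andP[lam0 lam1].
have llam : linear_form (fun phi => lambda * l phi).
  by split=> [u v|s u]; [rewrite lD mulrDr|rewrite lZ mulrCA].
have lkl phi : `|lambda * l phi| <= (lambda * kappa) * nrm a phi.
  by rewrite normrM ger0_norm ?(ltW lam0)// -mulrA ler_wpM2l ?(ltW lam0).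
have lkr : lambda * kappa <= r / 8.
  move: lam1; rewrite ltr_pdivlMr ?ltr_wpDl// mulrDr mulr1; have := lam0; lra.
have [w0 _] := exT.
have [u [ur cu ru]] := local_minimum ia sT llam c0 TNc cr lkl lkr w0.
pose q := linearized a T u.
have iq : inner q := linearized_inner ia sT c0 cr TNc ur cu.
have qb w := linearized_bounds ia sT c0 cr TNc ur cu w; rewrite -/q in qb.
have naq w : nrm a w <= 2 * nrm q w.
  rewrite -[leRHS]ger0_norm ?mulr_ge0 ?nrm_ge0// -sqrtr_sqr ler_wsqrtr//.
  rewrite exprMn (nrm_sqr iq); have /andP[] := qb w.
  by have := inner_ge0 ia w; rewrite (_ : 2 ^+ 2 = 4 :> R); [lra|ring].
have nqa w : nrm q w <= 2 * nrm a w.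
  rewrite -[leRHS]ger0_norm ?mulr_ge0 ?nrm_ge0// -sqrtr_sqr ler_wsqrtr//.
  rewrite exprMn (nrm_sqr ia); have /andP[] := qb w.
  by have := inner_ge0 ia w; rewrite (_ : 2 ^+ 2 = 4 :> R); [lra|ring].
(* the norms of a and q differ by factors of at most 2 *)
pose N' phi := 4 * N phi.
have N'0 phi : 0 <= N' phi by rewrite mulr_ge0.
have TN' v w phi : `|T v w phi| <= N' phi * (nrm q v * nrm q w).
  rewrite (le_trans (TN v w phi))//.
  have -> : N' phi * (nrm q v * nrm q w) = N phi * ((2 * nrm q v) * (2 * nrm q w)).
    by rewrite /N'; ring.
  by rewrite ler_wpM2l// ler_pM ?nrm_ge0.
have N'q phi : N' phi <= 8 * c * nrm q phi.
  rewrite /N'; have := Na phi; have : c * nrm a phi <= c * (2 * nrm q phi).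
    by rewrite ler_wpM2l// ltW.
  lra.
have compactN' (w : nat -> V) (B : R) : (forall k, nrm q (w k) <= B) ->
  exists2 s : nat -> nat, (forall k, (k <= s k)%N) &
    forall e, 0 < e -> exists K, forall j k, (K <= j)%N -> (K <= k)%N ->
      N' (sub (w (s j)) (w (s k))) <= e.
  move=> wB; have [|s sk sN] := compactN w (2 * B).
    by move=> k; rewrite (le_trans (naq _))// ler_wpM2l.
  exists s => // e e0; have e4 : 0 < e / 4 by rewrite divr_gt0.
  have [K HK] := sN _ e4; exists K => j k jK kK.
  by have := HK j k jK kK; rewrite /N'; lra.
have c80 : 0 < 8 * c by rewrite mulr_gt0.
have [z [cz rz [B zB] [d d0 zd]]] := critical_sequence iq sT c80 TN' N'0 N'q compactN' exT.
have B0 : 0 <= B by exact: le_trans (nrm_ge0 _ _) (zB 0).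
exists u, (fun k => add (u k) (z k)); split.
- by split=> //; exists r.
- split.
  + move=> e e0; have e2 : 0 < e / 2 by rewrite divr_gt0.
    have e4 : 0 < e / 4 by rewrite divr_gt0.
    have [K1 H1] := cu _ e2; have [K2 H2] := cz _ e4.
    exists (maxn K1 K2) => j k; rewrite !geq_max => /andP[j1 j2] /andP[k1 k2].
    have -> : nrm a (sub (add (u j) (z j)) (add (u k) (z k))) =
        nrm a (add (sub (u j) (u k)) (sub (z j) (z k))).
      by rewrite /nrm /sub !(innerE ia); congr Num.sqrt; ring.
    rewrite (le_trans (nrm_triangle ia _ _))//.
    have := H1 _ _ j1 k1; have := H2 _ _ j2 k2; have := naq (sub (z j) (z k)); lra.
  + exists (r + 2 * B) => k; rewrite (le_trans (nrm_triangle ia _ _))//.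
    by rewrite lerD//; have := naq (z k); have := zB k; lra.
  + move=> e e0; have e3 : 0 < e / 3 by rewrite divr_gt0.
    have e6 : 0 < e / 6 by rewrite divr_gt0.
    have e2B : 0 < e / (6 * (B + 1)) by rewrite divr_gt0// mulr_gt0// ltr_wpDl.
    have [K1 H1] := ru _ e3; have [K2 H2] := rz _ e6.
    have [K3 H3] := linearized_near sT c0 TNc cu e2B.
    exists (maxn K1 (maxn K2 K3)) => k; rewrite !geq_max => /and3P[k1 k2 k3] phi.
    have := H1 k k1 phi; have := H2 k k2 phi; have := H3 k k3 (z k) phi; rewrite -/q.
    move=> h3 h2 h1.
    have -> : a (add (u k) (z k)) phi - T (add (u k) (z k)) (add (u k) (z k)) phi - lambda * l phi =
      (a (u k) phi - T (u k) (u k) phi - lambda * l phi) + (q (z k) phi - T (z k) (z k) phi) -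
      (q (z k) phi - (a (z k) phi - 2 * T (u k) (z k) phi)).
      by rewrite (innerDl ia) !(triE sT) (tri12 sT (z k) (u k)); ring.
    rewrite (le_trans (ler_normB _ _))// (le_trans (lerD (ler_normD _ _) (lexx _)))//.
    have p0 : 0 <= nrm a phi by exact: nrm_ge0.
    have h2' : `|q (z k) phi - T (z k) (z k) phi| <= e / 3 * nrm a phi.
      rewrite (le_trans h2)//.
      have : e / 6 * nrm q phi <= e / 6 * (2 * nrm a phi) by rewrite ler_wpM2l// ltW.
      lra.
    have h3' : `|q (z k) phi - (a (z k) phi - 2 * T (u k) (z k) phi)| <= e / 3 * nrm a phi.
      rewrite (le_trans h3)// mulrA ler_wpM2r//.
      rewrite mulrAC ler_pdivrMr ?mulr_gt0 ?ltr_wpDl//.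
      have -> : e / 3 * (6 * (B + 1)) = e * (2 * (B + 1)) by field.
      by rewrite ler_wpM2l ?(ltW e0)//; have := naq (z k); have := zB k; lra.
    lra.
- exists (d / 2); first by rewrite divr_gt0.
  move=> k; have -> : nrm a (sub (add (u k) (z k)) (u k)) = nrm a (z k).
    by rewrite /nrm /sub !(innerE ia); congr Num.sqrt; ring.
  by have := zd k; have := nqa (z k); lra.
Qed.

End two_critical_points.

(** * The space of test functions and its compact embedding *)

Lemma ultra_bounded_cvg (R : realType) (I : Type) (U : set_system I) (x : I -> R) (M : R) :
  UltraFilter U -> (forall k, `|x k| <= M) -> exists l : R, x @ U --> l.
Proof.
move=> UU xM.
have UA : (x @ U) `[- M, M]%classic.
  apply: (@filterE _ U _ (x @^-1` `[- M, M]%classic)) => k /=.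
  by rewrite in_itv/= -ler_norml; exact: xM.
have [l [_ cl]] := @segment_compact R (- M) M _ _ UA.
exists l => A nA; have [//|UnA] := in_ultra_setVsetC (x @^-1` A) UU.
have [y [/= xy Ay]] := cl (~` A) A UnA nA.
by [].
Qed.

Section test_space.
Context (R : realType) (D : set (R * R)).
Hypotheses (oD : open D) (bD : bounded_set D).
Local Notation sqn f := (\int[@area R]_(x in D) (f x ^+ 2)).

Definition test_space := {phi : R * R -> R | test_function D phi}.

Implicit Types u v w phi : test_space.

Definition tfun u : R * R -> R := proj1_sig u.

Definition tadd u v : test_space :=
  exist _ (fun x => tfun u x + tfun v x) (test_Add (proj2_sig u) (proj2_sig v)).

Definition tscl c u : test_space :=
  exist _ (fun x => c * tfun u x) (test_Z c (proj2_sig u)).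

Definition tdirichlet u v := dirichlet D (tfun u) (tfun v).

Definition ttrilinear u v w := trilinear D (tfun u) (tfun v) (tfun w).

Definition tsup u := sup [set `|tfun u x| | x in [set: R * R]].

Let tP u : test_function D (tfun u) := proj2_sig u.

Lemma tdirichlet_inner : inner tadd tscl tdirichlet.
Proof.
split=> [w|u v|u]; last exact: dirichlet_ge0.
- by split=> [u v|c u]; [exact: dirichletD|exact: dirichletZ].
- exact: dirichletC.
Qed.

Lemma ttrilinear_sym : sym_trilinear tadd tscl ttrilinear.
Proof.
split=> [v w|u v w|u v w].
- by split=> [u z|c u]; [exact: trilinearD|exact: trilinearZ].
- exact: trilinear_sym.
- exact: trilinear_swap.
Qed.

Lemma tsup_ge u x : `|tfun u x| <= tsup u.
Proof.
have [M HM] := test_bounded (tP u).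
apply: sup_upper_bound; last by exists x.
by split; [exists `|tfun u x|, x|exists M => _ [y _ <-]].
Qed.

Lemma tsup_le u M : (forall x, `|tfun u x| <= M) -> tsup u <= M.
Proof.
move=> uM; apply: ge_sup; first by exists `|tfun u 0|, 0.
by move=> _ [y _ <-].
Qed.

Lemma tsup_ge0 u : 0 <= tsup u.
Proof. exact: le_trans (tsup_ge u 0). Qed.

Lemma hess01_nrm u : sqn (partial [:: 0; 1] (tfun u)) <= nrm tdirichlet u ^+ 2.
Proof.
rewrite (nrm_sqr tdirichlet_inner).
by have := sqn_hess01_le oD bD (tP u); rewrite hess.unlock.
Qed.

Lemma tsup_nrm : exists2 c, 0 < c & forall u, tsup u <= c * nrm tdirichlet u.
Proof.
have [L L0 [DL HL]] := holder_estimate oD bD.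
exists (2 * L); first by rewrite mulr_gt0.
move=> u; apply: tsup_le => x; have [+ _ _] := HL _ (tP u) => /(_ x) /le_trans; apply.
have n0 : 0 <= 2 * L * nrm tdirichlet u by rewrite !mulr_ge0 ?nrm_ge0 ?(ltW L0).
rewrite -[leRHS]ger0_norm// -sqrtr_sqr ler_wsqrtr//.
rewrite exprMn (_ : (2 * L) ^+ 2 = 4 * L ^+ 2); last by ring.
by rewrite ler_wpM2l ?hess01_nrm// mulr_ge0// sqr_ge0.
Qed.

(** The bound of [trilinear_le] has the sum of the two squared norms. Applied
    to u and t v for all t, it turns into the product of the norms by the
    discriminant inequality. *)
Lemma ttrilinear_le u v phi :
  `|ttrilinear u v phi| <= tsup phi * (nrm tdirichlet u * nrm tdirichlet v).
Proof.
have iT := tdirichlet_inner; have sT := ttrilinear_sym.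
have h t : 0 <= tsup phi / 4 * tdirichlet u u + 2 * t * (- ttrilinear u v phi / 2) +
    t ^+ 2 * (tsup phi / 4 * tdirichlet v v).
  have := @trilinear_le _ D oD bD (tfun u) (tfun (tscl t v)) (tfun phi) (tsup phi)
    (tP u) (tP (tscl t v)) (tP phi) (tsup_ge phi).
  rewrite -/(ttrilinear u (tscl t v) phi) -/(tdirichlet u u) -/(tdirichlet (tscl t v) (tscl t v)).
  rewrite (triZ2 sT) !(innerE iT) => /(le_trans (ler_norm _)).
  set N := tsup phi; set A := tdirichlet u u; set B := tdirichlet v v.
  have -> : N / 4 * (A + t * (t * B)) = N / 4 * A + t ^+ 2 * (N / 4 * B) by ring.
  lra.
have := discriminant_le h.
have N0 := tsup_ge0 phi; rewrite -(nrm_sqr iT u) -(nrm_sqr iT v) => h2.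
have n1 := nrm_ge0 tdirichlet u; have n2 := nrm_ge0 tdirichlet v.
have P0 : 0 <= tsup phi * (nrm tdirichlet u * nrm tdirichlet v) by rewrite !mulr_ge0.
rewrite -ler_sqr ?nnegrE// real_normK ?num_real//.
move: (ttrilinear u v phi) (tsup phi) (nrm tdirichlet u) (nrm tdirichlet v) h2 N0 n1 n2 P0.
move=> t N x y h2 N0 x0 y0 P0.
have : 0 <= (N * (x * y)) ^+ 2 by exact: sqr_ge0.
have e1 : N / 4 * x ^+ 2 * (N / 4 * y ^+ 2) = (N * (x * y)) ^+ 2 / 16 by field.
have e2 : (- t / 2) ^+ 2 = t ^+ 2 / 4 by field.
rewrite e1 e2 in h2; lra.
Qed.

(** By the Hölder estimate, a function varies by at most sqrt (2 L d) times
    its norm along each side of a grid cell of side d. *)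
Lemma grid_le (L : R) : 0 < L ->
  (forall x, D x -> `|x.1| < L /\ `|x.2| < L) ->
  (forall phi : R * R -> R, test_function D phi -> let K := sqn (partial [:: 0; 1] phi) in
    [/\ forall p, `|phi p| <= Num.sqrt (4 * L ^+ 2 * K),
      forall a a' b, a <= a' ->
        `|phi (a', b) - phi (a, b)| <= Num.sqrt (2 * L * (a' - a) * K) &
      forall a b b', b <= b' ->
        `|phi (a, b') - phi (a, b)| <= Num.sqrt (2 * L * (b' - b) * K)]) ->
  forall (m : nat) u e,
  let d := 2 * L / m.+1%:R in
  (forall i j : 'I_m.+1, `|tfun u (- L + i%:R * d, - L + j%:R * d)| <= e) ->
  tsup u <= e + 2 * (Num.sqrt (2 * L * d) * nrm tdirichlet u).
Proof.
move=> L0 DL HL m u e d ue.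
have d0 : 0 < d by rewrite divr_gt0// mulr_gt0.
have [_ H0 H1] := HL _ (tP u).
set n := nrm tdirichlet u; have n0 : 0 <= n by exact: nrm_ge0.
have e0 : 0 <= e by exact: le_trans (ue ord0 ord0).
have osc (s : R) : 0 <= s -> s <= d ->
    Num.sqrt (2 * L * s * sqn (partial [:: 0; 1] (tfun u))) <= Num.sqrt (2 * L * d) * n.
  move=> s0 sd.
  have Ld : 0 <= 2 * L * d by rewrite !mulr_ge0 ?(ltW L0) ?(ltW d0).
  have -> : Num.sqrt (2 * L * d) * n = Num.sqrt (2 * L * d * n ^+ 2).
    by rewrite [RHS]sqrtrM// sqrtr_sqr ger0_norm.
  have L2 : 0 <= 2 * L by rewrite mulr_ge0 ?(ltW L0).
  by rewrite ler_wsqrtr// ler_pM ?sqn_ge0 ?hess01_nrm ?(mulr_ge0 L2)// ler_wpM2l.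
apply: tsup_le => -[p1 p2].
have [Dp|nDp] := pselect (D (p1, p2)); last first.
  rewrite (test_out (tP u) nDp) normr0 addr_ge0// mulr_ge0// mulr_ge0// sqrtr_ge0.
have [/= p1L p2L] := DL _ Dp.
have cell (t : R) : `|t| < L -> exists2 i : 'I_m.+1, - L + i%:R * d <= t & t - (- L + i%:R * d) <= d.
  rewrite ltr_norml => /andP[t1 t2].
  have tL0 : 0 <= (t + L) / d by rewrite divr_ge0 ?(ltW d0)//; lra.
  have /andP[k1 k2] := truncn_itv tL0.
  set k := Num.truncn _ in k1 k2.
  have km : (k < m.+1)%N.
    rewrite -(ltr_nat R) (le_lt_trans k1)// ltr_pdivrMr// /d mulrC divfK// ; lra.
  exists (Ordinal km) => /=.
    by move: k1; rewrite ler_pdivlMr//; lra.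
  by move: k2; rewrite ltr_pdivrMr// -natr1 mulrDl mul1r; lra.
have [i i1 i2] := cell _ p1L; have [j j1 j2] := cell _ p2L.
set g1 := - L + i%:R * d in i1 i2; set g2 := - L + j%:R * d in j1 j2.
have h1 := H0 g1 p1 p2 i1; have h2 := H1 g1 g2 p2 j1.
have i0 : 0 <= p1 - g1 by rewrite subr_ge0.
have j0 : 0 <= p2 - g2 by rewrite subr_ge0.
have h1' := le_trans h1 (osc _ i0 i2); have h2' := le_trans h2 (osc _ j0 j2).
have h3 := ue i j; rewrite -/g1 -/g2 in h3.
have -> : tfun u (p1, p2) = (tfun u (p1, p2) - tfun u (g1, p2)) +
   (tfun u (g1, p2) - tfun u (g1, g2)) + tfun u (g1, g2) by ring.
rewrite (le_trans (ler_normD _ _))// (le_trans (lerD (ler_normD _ _) (lexx _)))//.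
lra.
Qed.

(** The embedding into the sup norm is compact. Pointwise limits along an
    ultrafilter exist by boundedness; at the finitely many points of a grid of
    mesh 2 L / (m + 1) the convergence is uniform, and [grid_le] extends it to
    all points. The n-th index is chosen at least n and good for the first n +
    1 grids. *)
Lemma tsup_compact (w : nat -> test_space) (B : R) :
  (forall k, nrm tdirichlet (w k) <= B) ->
  exists2 s : nat -> nat, (forall k, (k <= s k)%N) &
    forall e, 0 < e -> exists K, forall j k, (K <= j)%N -> (K <= k)%N ->
      tsup (sub tadd tscl (w (s j)) (w (s k))) <= e.
Proof.
move=> wB; have [L L0 [DL HL]] := holder_estimate oD bD.
have B0 : 0 <= B by exact: le_trans (nrm_ge0 _ _) (wB 0).
have [c c0 Hc] := tsup_nrm.
have [U [UU Uoo]] := ultraFilterLemma (@eventually_filter).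
have [l Hl] : {l : R * R -> R & forall p, (fun k => tfun (w k) p) @ U --> l p}.
  apply: (@choice _ _ (fun p l => (fun k => tfun (w k) p) @ U --> l)) => p.
  apply: (ultra_bounded_cvg UU (M := c * B)) => k.
  rewrite (le_trans (tsup_ge _ _))// (le_trans (Hc _))// ler_wpM2l//; exact: ltW.
pose d m : R := 2 * L / m.+1%:R.
pose g m (ij : 'I_m.+1 * 'I_m.+1) := (- L + ij.1%:R * d m, - L + ij.2%:R * d m).
pose A m := [set k | forall ij : 'I_m.+1 * 'I_m.+1,
   `|l (g m ij) - tfun (w k) (g m ij)| <= m.+1%:R^-1].
have UA m : U (A m).
  apply: (@filter_forall _ _ (fun ij k =>
     `|l (g m ij) - tfun (w k) (g m ij)| <= m.+1%:R^-1)) => ij.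
  by have /cvgrPdist_le := Hl (g m ij); apply; rewrite invr_gt0.
have [s Hs] : {s : nat -> nat & forall n, (n <= s n)%N /\ forall m : 'I_n.+1, A m (s n)}.
  apply: (@choice _ _ (fun n k => (n <= k)%N /\ forall m : 'I_n.+1, A m k)) => n.
  have U1 : U [set k | (n <= k)%N] by apply: Uoo; exists n.
  have U2 : U [set k | forall m : 'I_n.+1, A m k].
    by apply: (@filter_forall _ _ (fun (m : 'I_n.+1) k => A m k)) => m; exact: UA.
  have [k [k1 k2]] := filter_ex (filterI U1 U2).
  by exists k.
exists s => [k|e e0]; first by case: (Hs k).
have e4 : 0 < e / 4 by rewrite divr_gt0.
have q0 : 0 < (e / (8 * (B + 1))) ^+ 2 / (2 * L * (2 * L)).
  have h : 0 < e / (8 * (B + 1)) by rewrite divr_gt0// mulr_gt0// ltr_wpDl.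
  by rewrite divr_gt0 ?(exprn_gt0 _ h) ?mulr_gt0.
have [m1 Hm1] := ltr_add_invr (y := 0) (x := e / 4) e4.
have [m2 Hm2] := ltr_add_invr (y := 0) (x := _) q0.
rewrite !add0r in Hm1 Hm2.
pose m := maxn m1 m2.
exists m => j k mj mk.
have inv_le (a : nat) : (a <= m)%N -> m.+1%:R^-1 <= a.+1%:R^-1 :> R.
  by move=> am; rewrite lef_pV2 ?posrE// ler_nat ltnS.
have m1e : m.+1%:R^-1 <= e / 4 by rewrite (le_trans (inv_le m1 (leq_maxl _ _)))// ltW.
have m2e := le_trans (inv_le m2 (leq_maxr _ _)) (ltW Hm2).
have := @grid_le L L0 DL HL m (sub tadd tscl (w (s j)) (w (s k))) (e / 2).
rewrite -/(d m) => /(_ _)/le_trans; apply.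
  move=> i i'.
  pose p := g m (i, i').
  have Aj : `|l p - tfun (w (s j)) p| <= m.+1%:R^-1.
    exact: (Hs j).2 (Ordinal (mj : (m < j.+1)%N)) (i, i').
  have Ak : `|l p - tfun (w (s k)) p| <= m.+1%:R^-1.
    exact: (Hs k).2 (Ordinal (mk : (m < k.+1)%N)) (i, i').
  rewrite [tfun _ _](_ : _ = tfun (w (s j)) p + -1 * tfun (w (s k)) p)//.
  have -> : tfun (w (s j)) p + -1 * tfun (w (s k)) p =
    (l p - tfun (w (s k)) p) - (l p - tfun (w (s j)) p) by ring.
  apply: (le_trans (ler_normB _ _)); apply: (le_trans (lerD Ak Aj)).
  by rewrite [leRHS](_ : _ = e / 4 + e / 4) ?lerD//; field.
have n2 : nrm tdirichlet (sub tadd tscl (w (s j)) (w (s k))) <= 2 * B.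
  rewrite (le_trans (nrm_sub tdirichlet_inner _ _))//.
  by have := wB (s j); have := wB (s k); lra.
have sq : Num.sqrt (2 * L * d m) <= e / (8 * (B + 1)).
  have eB : 0 <= e / (8 * (B + 1)) by rewrite divr_ge0 ?(ltW e0)// mulr_ge0// addr_ge0.
  rewrite -(ger0_norm eB) -sqrtr_sqr ler_wsqrtr// /d mulrA.
  by rewrite mulrC -ler_pdivlMr ?mulr_gt0.
have : Num.sqrt (2 * L * d m) * nrm tdirichlet (sub tadd tscl (w (s j)) (w (s k))) <=
   e / (8 * (B + 1)) * (2 * B).
  by rewrite ler_pM ?sqrtr_ge0 ?nrm_ge0.
have : e / (8 * (B + 1)) * (2 * B) <= e / 4.
  rewrite mulrAC ler_pdivrMr ?mulr_gt0 ?ltr_wpDl//.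
  have -> : e / 4 * (8 * (B + 1)) = e * (2 * (B + 1)) by field.
  by rewrite ler_wpM2l ?(ltW e0)//; lra.
lra.
Qed.

End test_space.

(** * Bump functions *)

Section flat_functions.
Context (R : realType).
Implicit Types (P : {poly R}) (t s : R).

(** The functions P(1/t) exp(-1/t), extended by 0, are a class stable under
    differentiation that contains the standard smooth cutoff. *)
Definition flat P t := if 0 < t then P.[t^-1] * expR (- t^-1) else 0.

Lemma poly_expR_bounded P : exists C, forall s, 0 <= s -> `|P.[s] * expR (- s)| <= C.
Proof.
exists (\sum_(i < size P) `|P`_i| * i`!%:R) => s s0.
rewrite normrM [`|expR _|]ger0_norm ?expR_ge0// horner_coef.
rewrite (le_trans (ler_wpM2r (expR_ge0 _) (ler_norm_sum _ _ _)))// mulr_suml.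
apply: ler_sum => i _; rewrite normrM -mulrA ler_wpM2l//.
rewrite ger0_norm ?exprn_ge0// expRN ler_pdivrMr ?expR_gt0//.
case: (nat_of_ord i) => [|n].
  by rewrite expr0 fact0 mul1r -expR0 ler_expR.
rewrite mulrC -ler_pdivrMr ?ltr0n ?fact_gt0//.
by rewrite (le_trans _ (expR_ge1Dxn n s0))// lerDr.
Qed.

(** Quadratic decay at 0 gives differentiability there, with derivative 0. *)
Lemma flat_quadratic P : exists2 C, 0 <= C & forall t, `|flat P t| <= C * t ^+ 2.
Proof.
have [C HC] := poly_expR_bounded ('X^2 * P).
have C0 : 0 <= C by exact: le_trans (HC 0 (lexx 0)).
exists C => // t; rewrite /flat; case: ifPn => t0; last by rewrite normr0 mulr_ge0// sqr_ge0.
have := HC t^-1; rewrite invr_ge0 (ltW t0) => /(_ isT).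
rewrite hornerM hornerXn -mulrA normrM ger0_norm ?exprn_ge0 ?invr_ge0 ?(ltW t0)//.
by rewrite exprVn ler_pdivrMl ?exprn_gt0// [C * _]mulrC.
Qed.

Definition dflat P := 'X^2 * (P - P^`()).

Lemma is_derive_flat P t : is_derive t 1 (flat P) (flat (dflat P) t).
Proof.
have [t0|t0|->] := ltgtP t 0.
- have e : \forall x \near t, cst 0 x = flat P x.
    near=> x; rewrite /flat/= ltNge ltW//=.
    by near: x; exact: lt_nbhsl.
  rewrite {2}/flat ltNge (ltW t0)/=.
  exact: (near_eq_is_derive e).
- have e : \forall x \near t, P.[x^-1] * expR (- x^-1) = flat P x.
    near=> x; rewrite /flat/= ifT//.
    by near: x; exact: lt_nbhsr.
  apply: (near_eq_is_derive e).
  have tn0 : t != 0 by rewrite gt_eqF.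
  have dV : is_derive t 1 (fun x : R => x^-1) (- t ^- 2).
    have := is_deriveV tn0 (is_derive_id t 1).
    by rewrite [_ *: 1]mulr1.
  have dP : is_derive t 1 (fun x => P.[x^-1]) (P^`().[t^-1] * - t ^- 2).
    exact: (@is_derive1_comp _ (horner P) (fun x => x^-1) _ _ _ (is_derive_poly P _) dV).
  have dE : is_derive t 1 (fun x => expR (- x^-1)) (expR (- t^-1) * t ^- 2).
    have dN : is_derive t 1 (fun x : R => - x^-1) (t ^- 2).
      by rewrite -[t ^- 2]opprK; exact: is_deriveN.
    exact: (@is_derive1_comp _ expR (fun x => - x^-1) _ _ _ (is_derive_expR _) dN).
  have h : is_derive t 1 (fun x => P.[x^-1] * expR (- x^-1)) _ := is_deriveM dP dE.
  apply: (is_derive_eq h).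
  rewrite /flat t0 /dflat hornerM hornerXn hornerD hornerN exprVn.
  have sc (x y : R) : x *: y = x * y by [].
  by rewrite !sc; move: P.[_] P^`().[_] (expR _) (t ^- 2) => a b c d; ring.
- have [C C0 HC] := flat_quadratic P.
  rewrite {2}/flat ltxx.
  have cv : (fun h : R => h^-1 *: (flat P (h *: 1 + 0) - flat P 0)) @ 0^' --> (0 : R).
    apply/cvgrPdist_le => e e0; near=> h.
    rewrite sub0r normrN addr0 [h *: 1]mulr1 {2}/flat ltxx subr0 normrM normfV.
    have h0 : h != 0 by near: h; exact: nbhs_dnbhs_neq.
    rewrite ler_pdivrMl ?normr_gt0// (le_trans (HC h))//.
    rewrite -real_normK ?num_real// expr2 mulrA mulrC ler_wpM2l//.
    have he : `|h| <= e / (C + 1).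
      near: h; apply: dnbhs0_le; rewrite divr_gt0// ltr_wpDl//.
    rewrite (le_trans (ler_wpM2l C0 he))// mulrA ler_pdivrMr ?ltr_wpDl// mulrC ler_wpM2l ?(ltW e0)//.
    by rewrite lerDl.
  split; first by apply/cvg_ex; exists 0.
  exact: cvg_lim cv.
Unshelve. all: by end_near. Qed.

Definition cutoff : R -> R := flat 1.

Lemma cutoff_gt0 t : 0 < t -> 0 < cutoff t.
Proof. by move=> t0; rewrite /cutoff /flat t0 hornerC mul1r expR_gt0. Qed.

Lemma cutoff_le0 t : t <= 0 -> cutoff t = 0.
Proof. by move=> t0; rewrite /cutoff /flat ltNge t0. Qed.

Lemma cutoff_ge0 t : 0 <= cutoff t.
Proof. by have [/cutoff_le0->//|/cutoff_gt0/ltW] := leP t 0. Qed.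

Lemma cutoff_le1 t : cutoff t <= 1.
Proof.
rewrite /cutoff /flat; case: ifP => // t0.
by rewrite hornerC mul1r -expR0 ler_expR oppr_le0 invr_ge0 ltW.
Qed.

Lemma cutoff_cvg t : cutoff (n.+1%:R * t) @[n --> \oo] --> (if 0 < t then 1 else 0 : R).
Proof.
case: ifPn => [t0|]; last first.
  rewrite -leNgt => t0; rewrite (_ : (fun n => _) = cst 0); first exact: cvg_cst.
  by apply/funext => n; rewrite cutoff_le0// mulr_ge0_le0.
rewrite (_ : (fun n => _) = fun n => expR (- (t^-1 * n.+1%:R^-1))).
  rewrite -[X in _ --> X]expR0; apply: continuous_cvg; first exact: continuous_expR.
  rewrite -oppr0; apply: cvgN; rewrite -(mulr0 t^-1); apply: cvgMl_tmp.
  exact: cvg_harmonic.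
apply/funext => n; rewrite /cutoff /flat mulr_gt0// hornerC mul1r invfM mulrC.
by [].
Qed.

Definition coord (i : 'I_2) (z : R * R) := if i == 0 then z.1 else z.2.

(** The factor k absorbs the constants of the chain rule, including 0 for the
    derivative in the other direction. This keeps the class stable under
    differentiation. *)
Definition flat_plane (k : R) P (i : 'I_2) (al be : R) (z : R * R) :=
  k * flat P (al * coord i z + be).

Lemma is_derive_flat_affine k P al be t :
  is_derive t 1 (fun s => k * flat P (al * s + be)) (k * al * flat (dflat P) (al * t + be)).
Proof.
have dA : is_derive t 1 (fun s => al * s + be) al.
  have h1 : is_derive t 1 (fun s : R => al *: s) (al *: (1 : R)) by exact: is_deriveZ.
  have h2 : is_derive t 1 (cst be) 0 by exact: is_derive_cst.
  by have := is_deriveD h1 h2; rewrite addr0 [_ *: 1]mulr1.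
have dF := @is_derive1_comp _ (flat P) (fun s => al * s + be) _ _ _ (is_derive_flat P _) dA.
have h : is_derive t 1 (fun s => k * flat P (al * s + be)) _ := is_deriveZ k dF.
apply: (is_derive_eq h).
have sc (x y : R) : x *: y = x * y by [].
by rewrite sc; move: (flat _ _) => z; ring.
Qed.

Lemma flat_plane_slice k P i al be x j :
  derivable (flat_plane k P i al be) x (axis R j) /\
  'D_(axis R j) (flat_plane k P i al be) x =
    flat_plane (if j == i then k * al else 0) (dflat P) i al be x.
Proof.
have [j0|j1] := ord2_cases j; rewrite ?j0 ?j1.
- have [i0|i1] := ord2_cases i; rewrite ?i0 ?i1.
  + have [h1 h2] := is_derive_flat_affine k P al be x.1.
    split; first by apply/derivable_slice0.
    by rewrite derive_slice0 derive1E.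
  + have e : (fun t => flat_plane k P 1 al be (t, x.2)) = cst (flat_plane k P 1 al be x) by [].
    split; first by apply/derivable_slice0; rewrite e; exact: derivable_cst.
    by rewrite derive_slice0 e derive1E derive_cst /flat_plane mul0r.
- have [i0|i1] := ord2_cases i; rewrite ?i0 ?i1.
  + have e : (fun t => flat_plane k P 0 al be (x.1, t)) = cst (flat_plane k P 0 al be x) by [].
    split; first by apply/derivable_slice1; rewrite e; exact: derivable_cst.
    by rewrite derive_slice1 e derive1E derive_cst /flat_plane mul0r.
  + have [h1 h2] := is_derive_flat_affine k P al be x.2.
    split; first by apply/derivable_slice1.
    by rewrite derive_slice1 derive1E.
Qed.

Lemma smooth_flat_plane k P i al be : smooth (flat_plane k P i al be).
Proof.
apply: (@smooth_class R [set u | exists k P, u = flat_plane k P i al be]); last by exists k, P.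
- move=> _ [{}k [{}P ->]]; split; last by move=> j x; case: (flat_plane_slice k P i al be x j).
  have cF : continuous (fun s => k * flat P (al * s + be)).
    exact: is_derive_continuous (is_derive_flat_affine k P al be).
  move=> z; apply: (@continuous_comp _ _ _ (coord i) (fun s => k * flat P (al * s + be))).
    by rewrite /coord; have [->|->] := ord2_cases i; [exact: cvg_fst|exact: cvg_snd].
  exact: cF.
- move=> _ j [{}k [{}P ->]]; exists (if j == i then k * al else 0), (dflat P).
  by apply/funext => x; case: (flat_plane_slice k P i al be x j).
Qed.

End flat_functions.

Section bumps.
Context (R : realType) (D : set (R * R)).
Hypotheses (oD : open D) (bD : bounded_set D).
Notation mu := (@area R).
Local Notation integ f := (\int[mu]_(x in D) f x).
Local Notation d0 u := ('D_(axis R 0) u).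
Local Notation d1 u := ('D_(axis R 1) u).

Let mD : @measurable _ (meas2 R) D := open_plane_measurable oD.

(** As n grows these functions tend to the indicator function of the strip
    where the i-th coordinate lies between a and c. *)
Definition plateau (i : 'I_2) (n a c : R) (z : R * R) :=
  cutoff (n * (coord i z - a)) * cutoff (n * (c - coord i z)).

Definition open_box (a c b d : R) : set (R * R) := `]a, c[%classic `*` `]b, d[%classic.
Definition closed_box (a c b d : R) : set (R * R) := `[a, c]%classic `*` `[b, d]%classic.

Lemma smooth_plateau i n a c : smooth (plateau i n a c).
Proof.
have -> : plateau i n a c =
    (fun z => flat_plane 1 1 i n (- (n * a)) z * flat_plane 1 1 i (- n) (n * c) z).
  apply/funext => z; rewrite /plateau /flat_plane !mul1r /cutoff.
  by congr (flat _ _ * flat _ _); ring.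
by apply: smoothM; exact: smooth_flat_plane.
Qed.

Lemma plateau_neq0 i n a c z : 0 < n -> plateau i n a c z != 0 -> a < coord i z < c.
Proof.
move=> n0; apply: contra_neqT; rewrite negb_and -!leNgt => /orP[h|h]; rewrite /plateau.
  by rewrite cutoff_le0 ?mul0r// pmulr_rle0// subr_le0.
by rewrite [X in _ * X]cutoff_le0 ?mulr0// pmulr_rle0// subr_le0.
Qed.

Lemma plateau_bounds i n a c z : 0 <= plateau i n a c z <= 1.
Proof. by rewrite mulr_ge0 ?cutoff_ge0//= mulr_ile1 ?cutoff_ge0 ?cutoff_le1. Qed.

Definition bump n a c b d z := plateau 0 n a c z * plateau 1 n b d z.

Lemma bump_test n a c b d : 0 < n -> closed_box a c b d `<=` D -> test_function D (bump n a c b d).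
Proof.
move=> n0 KD.
have sub : closure [set z | bump n a c b d z != 0] `<=` closed_box a c b d.
  have cK : closed (closed_box a c b d).
    apply: compact_closed; first exact: norm_hausdorff.
    by apply: compact_setX; exact: segment_compact.
  rewrite [X in _ `<=` X](closure_id _).1//; apply: closureS => z /=.
  rewrite mulf_eq0 negb_or => /andP[/(plateau_neq0 n0) h1 /(plateau_neq0 n0) h2].
  by move: h1 h2; rewrite /coord/= => /andP[? ?] /andP[? ?]; split; rewrite /= in_itv/=; apply/andP; split; exact: ltW.
split; last exact: subset_trans KD.
- by apply: smoothM; exact: smooth_plateau.
- apply: (subclosed_compact _ _ sub); first exact: closed_closure.
  by apply: compact_setX; exact: segment_compact.
Qed.

Lemma bump_bounds n a c b d z : 0 <= bump n a c b d z <= 1.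
Proof.
have /andP[p0 p1] := plateau_bounds 0 n a c z; have /andP[q0 q1] := plateau_bounds 1 n b d z.
by rewrite mulr_ge0//= mulr_ile1.
Qed.

Lemma bump_cvg a c b d z :
  bump n.+1%:R a c b d z @[n --> \oo] --> (\1_(open_box a c b d) z : R).
Proof.
have pc i (a' c' : R) : plateau i n.+1%:R a' c' z @[n --> \oo] -->
    ((if 0 < coord i z - a' then 1 else 0) * (if 0 < c' - coord i z then 1 else 0) : R).
  by apply: cvgM; exact: cutoff_cvg.
have h := cvgM (pc 0 a c) (pc 1 b d).
rewrite !subr_gt0 /coord/= in h.
suff -> : (\1_(open_box a c b d) z : R) = (if a < z.1 then 1 else 0) * (if z.1 < c then 1 else 0) *
   ((if b < z.2 then 1 else 0) * (if z.2 < d then 1 else 0)) by exact: h.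
rewrite indicE; have -> : (z \in open_box a c b d) = [&& a < z.1, z.1 < c, b < z.2 & z.2 < d].
  apply/idP/idP; rewrite inE /open_box /= !in_itv/=.
    by case=> /andP[-> ->] /andP[-> ->].
  by move=> /and4P[-> -> -> ->].
by case: (a < _); case: (_ < c); case: (b < _); case: (_ < d); rewrite /= ?mulr1 ?mulr0 ?mul0r.
Qed.

Lemma open_has_box p (W : set (R * R)) : open W -> W p ->
  exists2 r, 0 < r & closed_box (p.1 - r) (p.1 + r) (p.2 - r) (p.2 + r) `<=` W.
Proof.
move=> oW Wp; have /nbhs_ballP[e /= e0 eW] : nbhs p W by exact: open_nbhs_nbhs.
exists (e / 2); first by rewrite divr_gt0.
move=> z [/=]; rewrite !in_itv/= => /andP[h1 h2] /andP[h3 h4].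
apply: eW; split; rewrite /ball/= ltr_norml; apply/andP; split; lra.
Qed.

Lemma integral_test_pos g p : test_function D g -> (forall x, 0 <= g x) -> 0 < g p ->
  0 < integ g.
Proof.
move=> tg g0 gp.
have cg := smooth_continuous (test_smooth tg).
have oW : open [set x | g p / 2 < g x].
  exact: (@open_comp _ _ g [set y | g p / 2 < y] (fun x _ => cg x) (@open_gt _ _)).
have gp2 : 0 < g p / 2 by rewrite divr_gt0.
have [|r r0 KW] := open_has_box oW (p := p).
  by rewrite /= ltr_pdivrMr// ltr_pMr// ltr1n.
set K := closed_box _ _ _ _ in KW.
have KD : K `<=` D.
  move=> x /KW/= gx; apply: contrapT => nDx.
  by have := lt_trans gp2 gx; rewrite (test_out tg nDx) ltxx.
have mK : @measurable _ (meas2 R) K by apply: measurableX; exact: measurable_itv.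
have Ig := test_integrable oD bD tg.
have IgK : mu.-integrable K (EFin \o g) by apply: integrableS Ig.
have aK : mu K = ((r + r) * (r + r))%:E.
  rewrite area_rect; [congr (_ * _)%:E; ring| |]; lra.
have Ic : mu.-integrable K (EFin \o cst (g p / 2)).
  apply: measurable_bounded_integrable => //; first by rewrite aK ltry.
  exists (g p / 2); split; first exact: num_real.
  by move=> x gx y _ /=; rewrite ger0_norm ?(ltW gp2)// ltW.
have h1 : \int[mu]_(x in K) (cst (g p / 2) x) <= \int[mu]_(x in K) g x.
  by apply: le_Rintegral => // x /KW/= /ltW.
have h2 : \int[mu]_(x in K) (cst (g p / 2) x) = g p / 2 * ((r + r) * (r + r)).
  by rewrite Rintegral_cst// aK.
have h3 : \int[mu]_(x in K) g x <= integ g.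
  rewrite -lee_fin !Rintegral_EFin//.
  apply: ge0_subset_integral => //; first exact: measurable_int Ig.
  by move=> x _; rewrite lee_fin.
apply: lt_le_trans h3; apply: lt_le_trans h1; rewrite h2.
by rewrite !mulr_gt0// addr_gt0.
Qed.

(** For w = A(x1) B(x2) the Hessian determinant is A A'' B B'' - (A' B') ^ 2.
    One integration by parts in each variable turns the integral of w A A'' B
    B'' into 4 times that of w (A' B') ^ 2, so 4 - 1 = 3 copies remain. *)
Lemma trilinear_product (A B A0 A00 B1 B11 : R * R -> R) :
  test_function D (fun x => A x * B x) -> smooth A -> smooth B ->
  d0 A = A0 -> d1 A = cst 0 -> d0 A0 = A00 -> d1 A0 = cst 0 ->
  d1 B = B1 -> d0 B = cst 0 -> d1 B1 = B11 -> d0 B1 = cst 0 -> d0 B11 = cst 0 ->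
  trilinear D (fun x => A x * B x) (fun x => A x * B x) (fun x => A x * B x) =
  3 * integ (fun x => (A x * B x) * ((A0 x * A0 x) * (B1 x * B1 x))).
Proof.
move=> tw sA sB eA0 eA1 eA00 eA01 eB1 eB0 eB11 eB10 eB110.
have sA0 : smooth A0 by rewrite -eA0; exact: smooth_D.
have sA00 : smooth A00 by rewrite -eA00; exact: smooth_D.
have sB1 : smooth B1 by rewrite -eB1; exact: smooth_D.
have sB11 : smooth B11 by rewrite -eB11; exact: smooth_D.
have pt i (f g : R * R -> R) : 'D_(axis R i) f = g -> forall x, derive f x (axis R i) = g x.
  by move=> <-.
have DMf i (f g f' g' : R * R -> R) : smooth f -> smooth g ->
    'D_(axis R i) f = f' -> 'D_(axis R i) g = g' ->
    'D_(axis R i) (fun x => f x * g x) = (fun x => f x * g' x + g x * f' x).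
  by move=> sf sg ef eg; apply/funext => x; rewrite (DM i x sf sg) (pt _ _ _ ef) (pt _ _ _ eg).
pose w x := A x * B x.
have w0 : d0 w = (fun x => A0 x * B x).
  by rewrite (DMf 0 A B A0 (cst 0) sA sB eA0 eB0); apply/funext => x /=; ring.
have w1 : d1 w = (fun x => A x * B1 x).
  by rewrite (DMf 1 A B (cst 0) B1 sA sB eA1 eB1); apply/funext => x /=; ring.
have h00 : hess 0 0 w = (fun x => A00 x * B x).
  rewrite hessE w0 (DMf 0 A0 B A00 (cst 0) sA0 sB eA00 eB0).
  by apply/funext => x /=; ring.
have h11 : hess 1 1 w = (fun x => A x * B11 x).
  rewrite hessE w1 (DMf 1 A B1 (cst 0) B11 sA sB1 eA1 eB11).
  by apply/funext => x /=; ring.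
have h01 : hess 0 1 w = (fun x => A0 x * B1 x).
  rewrite hessE w1 (DMf 0 A B1 A0 (cst 0) sA sB1 eA0 eB10).
  by apply/funext => x /=; ring.
rewrite /trilinear -/w.
have -> : integ (fun x => bracket w w x * w x) =
   integ (fun x => 2 * (w x * ((A x * A00 x) * (B x * B11 x)) - w x * ((A0 x * A0 x) * (B1 x * B1 x)))).
  by apply: eq_Rintegral => x _; rewrite /bracket h00 h11 h01 /w; ring.
have tM (f : R * R -> R) : smooth f -> mu.-integrable D (EFin \o (fun x => w x * f x)).
  by move=> sf; have := test_integrable oD bD (test_Mr tw sf).
have s1 : smooth (fun x => (A x * A00 x) * (B x * B11 x)) by apply: smoothM; exact: smoothM.
have s2 : smooth (fun x => (A0 x * A0 x) * (B1 x * B1 x)) by apply: smoothM; exact: smoothM.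
have s3 : smooth (fun x => (A0 x * A0 x) * (B x * B11 x)) by apply: smoothM; exact: smoothM.
have I1 := tM _ s1; have I2 := tM _ s2; have I3 := tM _ s3.
have ID : mu.-integrable D (EFin \o (fun x => w x * ((A x * A00 x) * (B x * B11 x)) -
    w x * ((A0 x * A0 x) * (B1 x * B1 x)))) by have := integrableB mD I1 I2.
rewrite (RintegralZl 2 mD ID) (RintegralB mD I1 I2).
have tX : test_function D (fun x => w x * ((A x * A0 x) * (B x * B11 x))).
  by apply: test_Mr tw _; apply: smoothM; exact: smoothM.
have tY : test_function D (fun x => w x * ((A0 x * A0 x) * (B x * B1 x))).
  by apply: test_Mr tw _; apply: smoothM; exact: smoothM.
have zero (i : 'I_2) (X dX : R * R -> R) : test_function D X -> 'D_(axis R i) X = dX -> integ dX = 0.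
  by move=> tX' <-; exact: test_integralD_eq0.
have X0 := zero 0 _ _ tX (DMf 0 w _ _ _ (test_smooth tw) (smoothM (smoothM sA sA0) (smoothM sB sB11)) w0
  (DMf 0 _ _ _ _ (smoothM sA sA0) (smoothM sB sB11) (DMf 0 _ _ _ _ sA sA0 eA0 eA00)
   (DMf 0 _ _ _ _ sB sB11 eB0 eB110))).
have Y0 := zero 1 _ _ tY (DMf 1 w _ _ _ (test_smooth tw) (smoothM (smoothM sA0 sA0) (smoothM sB sB1)) w1
  (DMf 1 _ _ _ _ (smoothM sA0 sA0) (smoothM sB sB1) (DMf 1 _ _ _ _ sA0 sA0 eA01 eA01)
   (DMf 1 _ _ _ _ sB sB1 eB1 eB11))).
have E1 : integ (fun x => w x * ((A x * A00 x) * (B x * B11 x))) =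
    - (2 * integ (fun x => w x * ((A0 x * A0 x) * (B x * B11 x)))).
  apply/eqP; rewrite -addr_eq0 -(RintegralZl 2 mD I3) -RintegralD//; last first.
    by have := integrableZl mD 2 I3.
  rewrite -[X in _ == X]X0; apply/eqP; apply: eq_Rintegral => x _ /=.
  by rewrite /w; ring.
have E2 : integ (fun x => w x * ((A0 x * A0 x) * (B x * B11 x))) =
    - (2 * integ (fun x => w x * ((A0 x * A0 x) * (B1 x * B1 x)))).
  apply/eqP; rewrite -addr_eq0 -(RintegralZl 2 mD I2) -RintegralD//; last first.
    by have := integrableZl mD 2 I2.
  rewrite -[X in _ == X]Y0; apply/eqP; apply: eq_Rintegral => x _ /=.
  by rewrite /w; ring.
rewrite E1 E2; move: (Rintegral _ _ _) => t; by field.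
Qed.

Lemma plateau_derive i n a c j : j != i -> 'D_(axis R j) (plateau i n a c) = cst 0.
Proof.
move=> ji; apply/funext => x.
have [j0|j1] := ord2_cases j; have [i0|i1] := ord2_cases i; rewrite ?j0 ?j1 ?i0 ?i1// in ji *.
- have e : (fun t => plateau 1 n a c (t, x.2)) = cst (plateau 1 n a c x) by [].
  by rewrite derive_slice0 e derive1E derive_cst.
- have e : (fun t => plateau 0 n a c (x.1, t)) = cst (plateau 0 n a c x) by [].
  by rewrite derive_slice1 e derive1E derive_cst.
Qed.

End bumps.

(** * A test function with positive cubic energy *)

Section positivity.
Context (R : realType) (D : set (R * R)).
Hypotheses (oD : open D) (bD : bounded_set D).
Local Notation d0 u := ('D_(axis R 0) u).
Local Notation d1 u := ('D_(axis R 1) u).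

Lemma trilinear_product_gt0 (A B A0 A00 B1 B11 : R * R -> R) p :
  test_function D (fun x => A x * B x) -> smooth A -> smooth B ->
  d0 A = A0 -> d1 A = cst 0 -> d0 A0 = A00 -> d1 A0 = cst 0 ->
  d1 B = B1 -> d0 B = cst 0 -> d1 B1 = B11 -> d0 B1 = cst 0 -> d0 B11 = cst 0 ->
  (forall x, 0 <= A x) -> (forall x, 0 <= B x) ->
  0 < A p -> 0 < B p -> A0 p != 0 -> B1 p != 0 ->
  0 < trilinear D (fun x => A x * B x) (fun x => A x * B x) (fun x => A x * B x).
Proof.
move=> tw sA sB eA0 eA1 eA00 eA01 eB1 eB0 eB11 eB10 eB110 A_ge0 B_ge0 Ap Bp A'p B'p.
rewrite (trilinear_product oD bD tw sA sB eA0 eA1 eA00 eA01 eB1 eB0 eB11 eB10 eB110).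
have sA' : smooth A0 by rewrite -eA0; exact: smooth_D.
have sB' : smooth B1 by rewrite -eB1; exact: smooth_D.
have sq (z : R) : 0 <= z * z by rewrite -expr2 sqr_ge0.
have sqp (z : R) : z != 0 -> 0 < z * z by move=> z0; rewrite -expr2 exprn_even_gt0.
rewrite mulr_gt0//; apply: (integral_test_pos oD bD (p := p)).
- exact: test_Mr tw (smoothM (smoothM sA' sA') (smoothM sB' sB')).
- by move=> x; exact: (mulr_ge0 (mulr_ge0 (A_ge0 x) (B_ge0 x)) (mulr_ge0 (sq _) (sq _))).
- exact: (mulr_gt0 (mulr_gt0 Ap Bp) (mulr_gt0 (sqp _ A'p) (sqp _ B'p))).
Qed.

Lemma derive_zero i : 'D_(axis R i) (cst 0 : R * R -> R) = cst 0.
Proof. by apply/funext => x; rewrite derive_cst. Qed.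

Lemma plateau_gt0 i n (a c : R) z : 0 < n -> a < coord i z < c -> 0 < plateau i n a c z.
Proof.
by move=> n0 /andP[az zc]; rewrite mulr_gt0// cutoff_gt0// mulr_gt0// subr_gt0.
Qed.

(** The plateau vanishes at a and is positive at the midpoint, so its
    derivative is nonzero somewhere in between. *)
Lemma plateau_derive_neq0 i (a c : R) : a < c ->
  exists2 xi, a < xi < c & forall z, coord i z = xi -> 'D_(axis R i) (plateau i 1 a c) z != 0.
Proof.
move=> ac; pose m := (a + c) / 2.
have am : a < m by rewrite /m; lra.
have mc : m < c by rewrite /m; lra.
have sA := smooth_plateau i 1 a c.
pose f s := cutoff (1 * (s - a)) * cutoff (1 * (c - s)).
have key (df : R -> R) : (forall t : R, is_derive t 1 f (df t)) ->
    exists2 xi, a < xi < c & df xi != 0.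
  move=> fdf; have [xi /andP[x1 x2] e] := MVT_all am fdf.
  exists xi; first by rewrite x1 (lt_trans x2).
  apply/eqP => dxi; move: e; rewrite dxi mul0r /f subrr mulr0 (cutoff_le0 (lexx 0)) mul0r subr0.
  by move/eqP; rewrite mulf_eq0 !gt_eqF// cutoff_gt0 ?mul1r// subr_gt0.
have [i0|i1] := ord2_cases i; rewrite ?i0 ?i1 in sA *.
- have [xi h1 h2] := key _ (fun t => smooth_slice0 0 t sA).
  have E y : 'D_(axis R 0) (plateau 0 1 a c) (xi, y) = derive1 f xi.
    exact: (derive_slice0 (plateau 0 1 a c) (xi, y)).
  by exists xi; [exact: h1|move=> -[z1 z2]; move=> e; have -> : z1 = xi := e; rewrite (E z2) -(E 0)].
- have [xi h1 h2] := key _ (fun t => smooth_slice1 0 t sA).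
  have E y : 'D_(axis R 1) (plateau 1 1 a c) (y, xi) = derive1 f xi.
    exact: (derive_slice1 (plateau 1 1 a c) (y, xi)).
  by exists xi; [exact: h1|move=> -[z1 z2]; move=> e; have -> : z2 = xi := e; rewrite (E z1) -(E 0)].
Qed.

Lemma exists_trilinear_pos : D !=set0 ->
  exists2 w, test_function D w & 0 < trilinear D w w w.
Proof.
move=> [p Dp]; have [r r0 KD] := open_has_box oD Dp.
set a := p.1 - r in KD; set c := p.1 + r in KD.
set b := p.2 - r in KD; set d := p.2 + r in KD.
have ac : a < c by rewrite /a /c; lra.
have bd : b < d by rewrite /b /d; lra.
have tw := bump_test ltr01 KD.
exists (bump 1 a c b d); first exact: tw.
have sA := smooth_plateau 0 1 a c; have sB := smooth_plateau 1 1 b d.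
have eA1 : d1 (plateau 0 1 a c) = cst 0 by exact: plateau_derive.
have eB0 : d0 (plateau 1 1 b d) = cst 0 by exact: plateau_derive.
have eA01 : d1 (d0 (plateau 0 1 a c)) = cst 0.
  exact: etrans (clairaut sA) (etrans (congr1 (fun h => d0 h) eA1) (derive_zero 0)).
have eB10 : d0 (d1 (plateau 1 1 b d)) = cst 0.
  exact: etrans (esym (clairaut sB)) (etrans (congr1 (fun h => d1 h) eB0) (derive_zero 1)).
have eB110 : d0 (d1 (d1 (plateau 1 1 b d))) = cst 0.
  exact: etrans (esym (clairaut (smooth_D 1 sB))) (etrans (congr1 (fun h => d1 h) eB10) (derive_zero 1)).
have [xi /andP[x1 x2] hx] := plateau_derive_neq0 0 ac.
have [eta /andP[y1 y2] hy] := plateau_derive_neq0 1 bd.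
apply: (trilinear_product_gt0 tw sA sB erefl eA1 erefl eA01 erefl eB0 erefl eB10 eB110
  _ _ _ _ (hx (xi, eta) erefl) (hy (xi, eta) erefl)).
- by move=> z; case/andP: (plateau_bounds 0 1 a c z).
- by move=> z; case/andP: (plateau_bounds 1 1 b d z).
- by apply: plateau_gt0 => //; apply/andP; split.
- by apply: plateau_gt0 => //; apply/andP; split.
Qed.

End positivity.

(** * The fundamental lemma of the calculus of variations *)

Section integrals_over_boxes.
Context (R : realType) (D : set (R * R)).
Hypotheses (oD : open D) (bD : bounded_set D).
Notation mu := (@area R).

Let mD : @measurable _ (meas2 R) D := open_plane_measurable oD.

Lemma open_box_measurable (a c b d : R) : @measurable _ (meas2 R) (open_box a c b d).
Proof. by apply: measurableX; exact: measurable_itv. Qed.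

Lemma open_box_subset (a c b d : R) : open_box a c b d `<=` closed_box a c b d.
Proof.
by move=> z [/=]; rewrite !in_itv/= => /andP[h1 h2] /andP[h3 h4];
  split; rewrite /= in_itv/=; apply/andP; split; exact: ltW.
Qed.

(** The bumps are test functions that tend boundedly to the indicator function
    of the open box. *)
Lemma integral_open_box_eq0 (v : R * R -> R) (a c b d : R) :
  mu.-integrable D (EFin \o v) ->
  (forall phi, test_function D phi -> \int[mu]_(x in D) (v x * phi x) = 0) ->
  closed_box a c b d `<=` D ->
  (\int[mu]_(x in open_box a c b d) (v x)%:E = 0)%E.
Proof.
move=> Iv v0 KD; set Q := open_box a c b d.
have QD : Q `<=` D by apply: subset_trans KD; exact: open_box_subset.
have mQ := open_box_measurable a c b d.
have mv : measurable_fun D (v : meas2 R -> R) by apply/measurable_EFinP; exact: measurable_int Iv.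
have mb n : measurable_fun D (bump n.+1%:R a c b d : meas2 R -> R).
  by apply: (test_measurable (D := D)); apply: bump_test.
have mq : measurable_fun D (\1_Q : meas2 R -> R) by exact: measurable_indic.
pose F n (x : meas2 R) := (v x * bump n.+1%:R a c b d x)%:E.
pose G (x : meas2 R) := (v x * \1_Q x)%:E.
have mF n : measurable_fun D (F n) by apply/measurable_EFinP; exact: measurable_funM.
have mG : measurable_fun D G by apply/measurable_EFinP; exact: measurable_funM.
have FG : {ae mu, forall x, D x -> F ^~ x @ \oo --> G x}.
  apply: aeW => x _; apply: cvg_EFin; first exact: nearW.
  by apply: cvgMl_tmp; exact: bump_cvg.
have Fv : {ae mu, forall x n, D x -> (`|F n x| <= (abse \o (EFin \o v)) x)%E}.
  apply: aeW => x n _ /=; rewrite lee_fin normrM -[leRHS]mulr1 ler_wpM2l//.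
  by have /andP[h1 h2] := bump_bounds n.+1%:R a c b d x; rewrite ger0_norm.
have [_ _ h] := dominated_convergence mD mF mG FG (integrable_abse Iv) Fv.
have -> : (\int[mu]_(x in Q) (v x)%:E = \int[mu]_(x in D) (v x * \1_Q x)%:E)%E.
  rewrite [LHS]integral_mkcond [RHS]integral_mkcond; apply: eq_integral => x _.
  rewrite !patchE indicE; have [xQ|xQ] := boolP (x \in Q).
    by rewrite mem_set ?mulr1//; apply: QD; exact: set_mem.
  by rewrite mulr0 if_same.
apply: (cvg_unique _ h) => //.
rewrite (_ : [sequence _]_n = cst 0%E); first exact: cvg_cst.
apply/funext => n /=; have tb : test_function D (bump n.+1%:R a c b d) by exact: bump_test.
rewrite -Rintegral_EFin ?v0//.
have [M HM] := test_bounded tb.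
apply: (le_integrable mD (mF n) (g := fun x => (M%:E * (EFin \o v) x)%E)).
  move=> x Dx; rewrite [leRHS](_ : _ = (`|M| * `|v x|)%:E); last by rewrite -EFinM /= normrM.
  rewrite [leLHS](_ : _ = (`|bump n.+1%:R a c b d x| * `|v x|)%:E); last by rewrite /F /= normrM mulrC.
  by rewrite lee_fin ler_wpM2r// (le_trans (HM x))// ler_norm.
exact: integrableZl.
Qed.

Definition open_boxes : set (set (meas2 R)) :=
  [set A | exists a c b d, A = open_box a c b d].

(** Open boxes are stable under intersection, so generation of the measurable
    sets by boxes is what Dynkin's theorem needs. *)
Lemma plane_measurableE : @measurable _ (meas2 R) = <<s open_boxes >>.
Proof.
apply/seteqP; split; last first.
  apply: smallest_sub; first exact: sigma_algebra_measurable.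
  by move=> _ [a [c [b [d ->]]]]; exact: open_box_measurable.
have [S0 SC SU] : sigma_algebra setT <<s open_boxes >>.
  exact: smallest_sigma_algebra.
have gen (f : meas2 R -> R) : (f = fst \/ f = snd) ->
    (@measurable _ (measurableTypeR R) : set (set R)) `<=` [set A | <<s open_boxes >> (f @^-1` A)].
  move=> fE; rewrite [X in X `<=` _](RGenOpens.measurableE R).
  apply: smallest_sub.
    split; first by rewrite /= preimage_set0.
    - by move=> A /= /SC; rewrite !setTD preimage_setC.
    - by move=> F /= HF; rewrite preimage_bigcup; exact: SU.
  move=> _ [x [y ->]] /=.
  pose N n : set R := `]- n%:R, n%:R[%classic.
  have TN : \bigcup_n N n = setT.
    apply/seteqP; split => // t _; exists (Num.truncn `|t|).+1 => //.
    rewrite /N/= in_itv/= -ltr_norml.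
    exact: truncnS_gt.
  case: fE => ->.
    have -> : fst @^-1` `]x, y[%classic = \bigcup_n open_box x y (- n%:R) n%:R :> set (meas2 R).
      apply/seteqP; split => [z /= zx|z [n _ []]//].
      have : (\bigcup_n N n) z.2 by rewrite TN.
      by case=> n _ nz; exists n.
    by apply: SU => n; apply: sub_gen_smallest; exists x, y, (- n%:R), n%:R.
  have -> : snd @^-1` `]x, y[%classic = \bigcup_n open_box (- n%:R) n%:R x y :> set (meas2 R).
    apply/seteqP; split => [z /= zx|z [n _ []]//].
    have : (\bigcup_n N n) z.1 by rewrite TN.
    by case=> n _ nz; exists n.
  by apply: SU => n; apply: sub_gen_smallest; exists (- n%:R), n%:R, x, y.
apply: smallest_sub; first exact: smallest_sigma_algebra.
move=> _ [[A mA <-]|[A mA <-]]; rewrite setTI.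
- exact: (gen fst (or_introl erefl)).
- exact: (gen snd (or_intror erefl)).
Qed.

Lemma open_boxI (a c b d a' c' b' d' : R) :
  open_box a c b d `&` open_box a' c' b' d' =
  open_box (Num.max a a') (Num.min c c') (Num.max b b') (Num.min d d').
Proof.
apply/seteqP; split=> z; rewrite /open_box /= !in_itv/= !gt_max !lt_min.
  by case=> -[/andP[-> ->] /andP[-> ->]] [/andP[-> ->] /andP[-> ->]].
by case=> /andP[/andP[-> ->] /andP[-> ->]] /andP[/andP[-> ->] /andP[-> ->]].
Qed.

(** The sets E for which the integral vanishes form a Dynkin system, and it
    contains the open boxes. *)
Lemma integral_box_measurable_eq0 (v : R * R -> R) (a c b d : R) :
  mu.-integrable D (EFin \o v) ->
  (forall phi, test_function D phi -> \int[mu]_(x in D) (v x * phi x) = 0) ->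
  closed_box a c b d `<=` D ->
  forall E : set (meas2 R), measurable E ->
  (\int[mu]_(x in open_box a c b d `&` E) (v x)%:E = 0)%E.
Proof.
move=> Iv v0 KD; set Q := open_box a c b d.
have QD : Q `<=` D by apply: subset_trans KD; exact: open_box_subset.
have mQ := open_box_measurable a c b d.
have IQE (E : set (meas2 R)) : measurable E -> mu.-integrable (Q `&` E) (EFin \o v).
  move=> mE; apply: integrableS Iv => //; first exact: measurableI.
  by move=> x [/QD].
have box0 a' c' b' d' : a <= a' -> c' <= c -> b <= b' -> d' <= d ->
    (\int[mu]_(x in open_box a' c' b' d') (v x)%:E = 0)%E.
  move=> aa' cc' bb' dd'; apply: integral_open_box_eq0 => //.
  apply: subset_trans KD => z [/=]; rewrite !in_itv/= => /andP[h1 h2] /andP[h3 h4].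
  by split; rewrite /= in_itv/=; apply/andP; split;
    [exact: le_trans h1|exact: le_trans cc'|exact: le_trans h3|exact: le_trans dd'].
rewrite plane_measurableE.
apply: (dynkin_induction (G := open_boxes) plane_measurableE).
- move=> _ _ [x [y [z [t ->]]]] [x' [y' [z' [t' ->]]]]; rewrite open_boxI.
  by do 4 eexists; reflexivity.
- by rewrite setIT; apply: box0.
- move=> _ [x [y [z [t ->]]]]; rewrite open_boxI.
  by apply: box0; rewrite ?le_max ?ge_min lexx.
- move=> S mS hS.
  have := @integral_setU _ _ _ mu (Q `&` S) (Q `&` ~` S) (EFin \o v)
    (measurableI _ _ mQ mS) (measurableI _ _ mQ (measurableC mS)).
  rewrite -setIUr setUv setIT => h.
  have mvQ : measurable_fun Q (EFin \o v : meas2 R -> \bar R).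
    by have := measurable_int _ (IQE _ measurableT); rewrite setIT.
  have dQ : [disjoint Q `&` S & Q `&` ~` S].
    by apply/disj_setPS => x [[_ xS] [_ xnS]]; exact: xnS.
  have e : (\int[mu]_(x in Q `&` S) (v x)%:E = 0)%E by exact: hS.
  have := h mvQ dQ => /=; rewrite e add0e => <-.
  by apply: box0.
- move=> F mF tF hF; rewrite setI_bigcupr integral_bigcup.
  + by apply: eseries0 => n _ _; exact: hF.
  + exact: trivIset_setIl.
  + by move=> n; exact: measurableI.
  + rewrite -setI_bigcupr; apply: IQE; exact: bigcupT_measurable.
Qed.

End integrals_over_boxes.

Section fundamental_lemma.
Context (R : realType) (D : set (R * R)).
Hypothesis oD : open D.
Notation mu := (@area R).

Let mD : @measurable _ (meas2 R) D := open_plane_measurable oD.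

(** Countably many open boxes with rational corners whose closures lie in D
    cover D; on each of them all integrals over measurable sets vanish. *)
Lemma fundamental_lemma (v : R * R -> R) :
  mu.-integrable D (EFin \o v) ->
  (forall phi, test_function D phi -> \int[mu]_(x in D) (v x * phi x) = 0) ->
  ae_eq mu D v (cst 0).
Proof.
move=> Iv v0.
pose P (q : rat * rat * rat * rat) (x : meas2 R) :=
  let: (a, c, b, d) := q in
  closed_box (ratr a) (ratr c) (ratr b) (ratr d) `<=` D ->
  open_box (ratr a) (ratr c) (ratr b) (ratr d) x -> v x = 0.
have hP q : {ae mu, forall x, P q x}.
  case: q => [[[a c] b] d]; rewrite /P.
  set Q := open_box _ _ _ _; have mQ : @measurable _ (meas2 R) Q by exact: open_box_measurable.
  have [KD|nKD] := pselect (closed_box (ratr a) (ratr c) (ratr b) (ratr d) `<=` D); last exact: aeW.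
  have QD : Q `<=` D by apply: subset_trans KD; exact: open_box_subset.
  have : ae_eq mu Q (EFin \o v) (cst 0%E).
    apply: integral_ae_eq => //; first exact: integrableS Iv.
    move=> E EQ mE; rewrite -(setIidr EQ) (integral_box_measurable_eq0 oD Iv v0 KD mE).
    by rewrite integral0.
  apply: filterS => x h _ /h /= /eqP; rewrite eqe => /eqP ->.
  by [].
have : {ae mu, forall x, forall n, if unpickle n is Some q then P q x else True}.
  apply: ae_foralln => n; case: unpickle => [q|]; first exact: hP.
  exact: aeW.
apply: filterS => x h Dx; have [r r0 rD] := open_has_box oD Dx.
have [a /andP[a1 a2]] : exists q : rat, (x.1 - r < ratr q) && (ratr q < x.1 :> R).
  have : x.1 - r < x.1 by rewrite ltrBlDr ltrDl.
  by move=> /rat_in_itvoo[q]; rewrite in_itv; exists q.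
have [b /andP[b1 b2]] : exists q : rat, (x.2 - r < ratr q) && (ratr q < x.2 :> R).
  have : x.2 - r < x.2 by rewrite ltrBlDr ltrDl.
  by move=> /rat_in_itvoo[q]; rewrite in_itv; exists q.
have [c /andP[c1 c2]] : exists q : rat, (x.1 < ratr q) && (ratr q < x.1 + r :> R).
  have : x.1 < x.1 + r by rewrite ltrDl.
  by move=> /rat_in_itvoo[q]; rewrite in_itv; exists q.
have [d /andP[d1 d2]] : exists q : rat, (x.2 < ratr q) && (ratr q < x.2 + r :> R).
  have : x.2 < x.2 + r by rewrite ltrDl.
  by move=> /rat_in_itvoo[q]; rewrite in_itv; exists q.
have := h (pickle (a, c, b, d)); rewrite pickleK; apply.
  apply: subset_trans rD => z [/=]; rewrite !in_itv/= => /andP[h1 h2] /andP[h3 h4].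
  by split; rewrite /= in_itv/=; apply/andP; split; lra.
by split; rewrite /= in_itv/=; apply/andP; split.
Qed.

End fundamental_lemma.

(** * Weak partial derivatives *)

Section L2_ae.
Context d (T : measurableType d) (R : realType).
Variables (mu : {measure set T -> \bar R}) (D : set T) (mD : measurable D).
Local Notation sqn f := (\int[mu]_(x in D) (f x ^+ 2)).
Local Notation sqint := (sqintegrable mu D).
Implicit Types f g : T -> R.

Lemma sqn_ae_eq f g : measurable_fun D f -> measurable_fun D g -> ae_eq mu D f g ->
  sqn f = sqn g.
Proof.
move=> mf mg fg; apply: (@ae_eq_Rintegral _ _ _ mu D mD (fun x => f x ^+ 2) (fun x => g x ^+ 2)).
- exact: measurable_funX.
- exact: measurable_funX.
- by apply: filterS fg => x /= h Dx; rewrite h.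
Qed.

Lemma sqintegrable_ae f g : sqint f -> measurable_fun D g -> ae_eq mu D f g -> sqint g.
Proof.
move=> [mf If] mg fg; split => //.
have mg2 : measurable_fun D (EFin \o (fun x => g x ^+ 2)).
  by apply/measurable_EFinP; exact: measurable_funX.
apply/integrableP; split => //.
have /integrableP[mf2 +] := If; congr (_ < _)%E; apply: ae_eq_integral => //.
- exact: measurableT_comp.
- exact: measurableT_comp.
by apply: filterS fg => x /= h Dx; rewrite h.
Qed.

Lemma L2cvg_ae (F : nat -> T -> R) f g : L2cvg mu D F f -> measurable_fun D g ->
  ae_eq mu D f g -> L2cvg mu D F g.
Proof.
move=> [IF If fc] mg fg; have Ig := sqintegrable_ae If mg fg; split=> //.
apply: cvg_trans fc; apply: near_eq_cvg; near=> k.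
apply: sqn_ae_eq; [exact: (sqintegrableB mD _ _).1|exact: (sqintegrableB mD _ _).1|].
by apply: filterS fg => x /= h Dx; rewrite h.
Unshelve. all: by end_near. Qed.

Lemma L2cvg_cst f : sqint f -> L2cvg mu D (fun=> f) f.
Proof.
move=> If; split => //; rewrite [X in X @ _](_ : _ = cst 0); first exact: cvg_cst.
apply/funext => k /=; transitivity (\int[mu]_(x in D) (0 : R)).
  by apply: eq_Rintegral => x _; rewrite subrr expr0n.
by rewrite /Rintegral integral0.
Qed.

Lemma L2cvgD (F G : nat -> T -> R) f g : L2cvg mu D F f -> L2cvg mu D G g ->
  L2cvg mu D (fun k x => F k x + G k x) (fun x => f x + g x).
Proof.
move=> [IF If fc] [IG Ig gc]; split.
- by move=> k; exact: sqintegrableD.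
- exact: sqintegrableD.
have h : (2 * sqn (fun x => F k x - f x) + 2 * sqn (fun x => G k x - g x)) @[k --> \oo] --> 0.
  rewrite -[X in _ --> X](_ : 2 * 0 + 2 * 0 = 0 :> R); last by rewrite !mulr0 addr0.
  by apply: cvgD; apply: cvgMl_tmp.
apply: (@squeeze_cvgr _ _ _ _ (cst 0)) h; last exact: cvg_cst.
near=> k; rewrite sqn_ge0//=.
have := sqnD mD (sqintegrableB mD (IF k) If) (sqintegrableB mD (IG k) Ig).
apply: le_trans; rewrite le_eqVlt; apply/orP; left; apply/eqP.
by apply: eq_Rintegral => x _; congr (_ ^+ 2); ring.
Unshelve. all: by end_near. Qed.

End L2_ae.

Section weak_partials.
Context (R : realType) (D : set (R * R)).
Hypotheses (oD : open D) (bD : bounded_set D).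
Notation mu := (@area R).
Local Notation sqn f := (\int[mu]_(x in D) (f x ^+ 2)).
Local Notation sqint u := (@sqintegrable _ (meas2 R) R mu D u).

Let mD : @measurable _ (meas2 R) D := open_plane_measurable oD.

Lemma patch_sqr (u : R * R -> R) :
  (fun x => (u \_ D) x ^+ 2) = (fun x => u x ^+ 2) \_ D.
Proof.
by apply/funext => x; rewrite !patchE; case: ifP => // _; rewrite expr0n.
Qed.

Lemma L2norm_sqr (u : R * R -> R) :
  (L2norm D u ^+ 2 = \int[mu]_(x in D) (u x ^+ 2)%:E)%E.
Proof.
have sq (x : \bar R) : (0 <= x -> x ^+ 2 = x `^ 2)%E.
  case: x => [x x0| _|//]; first by rewrite poweR_EFin powR_mulrn.
  by rewrite poweRyr// expe2 mulyy.
rewrite /L2norm sq ?Lnorm_ge0// poweR_Lnorm//.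
rewrite [RHS]integral_mkcond; apply: eq_integral => x _.
rewrite !patchE /= patchE; case: ifP => _ /=.
  by rewrite powR_mulrn// real_normK// num_real.
by rewrite normr0 powR_mulrn// expr0n.
Qed.

Lemma in_L2P (u : R * R -> R) : in_L2 D u <-> sqint u.
Proof.
rewrite /in_L2; split.
  move=> h; split.
    have : measurable_fun setT (u \_ D : meas2 R -> R).
      by move: h; rewrite inE => /andP[]; rewrite inE.
    by move/(measurable_restrictT _ mD).
  have := Lfun2_integrable_sqr h; rewrite patch_sqr => k.
  apply/(integrable_mkcond _ mD); move: k; congr (integrable _ _ _).
  by apply/funext => x /=; rewrite restrict_EFin.
move=> [mu_ Iu]; rewrite inE; apply/andP; split; rewrite inE/=.
  exact/(measurable_restrictT _ mD).
rewrite /finite_norm -/(L2norm D u).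
have : (L2norm D u ^+ 2 < +oo)%E.
  rewrite L2norm_sqr; have := integrable_fin_num mD Iu.
  by rewrite fin_numElt => /andP[].
have := Lnorm_ge0 mu 2%:E (EFin \o (u \_ D)); rewrite -/(L2norm D u).
case: (L2norm D u) => [r _ _| _|//]; first exact: ltry.
by rewrite expe2 mulyy.
Qed.

Lemma L2norm_sqn (u : R * R -> R) : sqint u -> (L2norm D u ^+ 2 = (sqn u)%:E)%E.
Proof. by move=> [_ Iu]; rewrite L2norm_sqr Rintegral_EFin. Qed.

Lemma sqint_integrable (u : R * R -> R) : sqint u -> mu.-integrable D (EFin \o u).
Proof.
move=> Iu; have I1 : sqint (fun=> 1).
  split; first exact: measurable_cst.
  apply/integrableP; split; first by apply/measurable_EFinP; exact: measurable_cst.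
  under eq_integral do rewrite /= expr1n normr1.
  by rewrite integral_cst// mul1e; exact: area_bounded.
have := sqintegrableM mD Iu I1; congr (integrable _ _ _).
by apply/funext => x /=; rewrite mulr1.
Qed.

Lemma integral_mulB (v w phi : R * R -> R) : sqint v -> sqint w -> sqint phi ->
  \int[mu]_(x in D) ((v x - w x) * phi x) =
  \int[mu]_(x in D) (v x * phi x) - \int[mu]_(x in D) (w x * phi x).
Proof.
move=> Iv Iw Ip.
rewrite -(@RintegralB _ _ _ mu D _ _ mD (sqintegrableM mD Iv Ip) (sqintegrableM mD Iw Ip)).
by apply: eq_Rintegral => x _; rewrite mulrBl.
Qed.

Lemma weak_partial_unique s u v w :
  is_weak_partial D s u v -> is_weak_partial D s u w -> ae_eq mu D v w.
Proof.
move=> [/in_L2P Iv Hv] [/in_L2P Iw Hw].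
have := fundamental_lemma oD (sqint_integrable (sqintegrableB mD Iv Iw)).
move=> /(_ _)/(filterS _); apply.
  by move=> x h /h /= /subr0_eq.
move=> phi tphi; have Ip := test_sqintegrable oD bD tphi.
rewrite integral_mulB//.
have := Hw _ tphi; rewrite Hv// => /(can_inj (signrMK _)) ->.
by rewrite subrr.
Qed.

Lemma weak_partialP s u v : is_weak_partial D s u v ->
  is_weak_partial D s u (weak_partial D s u) /\ ae_eq mu D (weak_partial D s u) v.
Proof.
move=> Hv; have H : is_weak_partial D s u (weak_partial D s u).
  exact: (@getPex _ [set w | is_weak_partial D s u w] (ex_intro _ v Hv)).
by split=> //; exact: weak_partial_unique H Hv.
Qed.

Lemma partial_cons j s (u : R * R -> R) :
  partial (j :: s) u = 'D_(axis R j) (partial s u).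
Proof. exact: erefl. Qed.

Lemma D_comm i j (w : R * R -> R) : smooth w ->
  'D_(axis R j) ('D_(axis R i) w) = 'D_(axis R i) ('D_(axis R j) w).
Proof.
move=> sw; have [->|->] := ord2_cases i; have [->|->] := ord2_cases j.
- exact: erefl.
- exact: clairaut.
- by apply: esym; exact: clairaut.
- exact: erefl.
Qed.

Lemma partial_D s i (u : R * R -> R) : smooth u ->
  partial s ('D_(axis R i) u) = 'D_(axis R i) (partial s u).
Proof.
move=> su; elim: s => [//|j s IH].
apply: (etrans (partial_cons _ _ _)).
apply: (etrans (congr1 (fun w : R * R -> R => 'D_(axis R j) w) IH)).
exact: D_comm (smooth_partial s su).
Qed.

(** Iterated integration by parts. It moves the outermost derivative of phi
    first, hence the commutation of derivatives in [partial_D]. *)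
Lemma integral_partial_test s (u phi : R * R -> R) : smooth u -> test_function D phi ->
  \int[mu]_(x in D) (u x * partial s phi x) =
  (-1) ^+ size s * \int[mu]_(x in D) (partial s u x * phi x).
Proof.
move=> su tphi; elim: s u su => [|i s IH] u su; first by rewrite expr0 mul1r.
have e : partial (i :: s) u = partial s ('D_(axis R i) u) := esym (partial_D s i su).
rewrite e (partial_cons i s phi).
rewrite (integration_by_parts_test oD bD i (test_partial s tphi) su).
rewrite (IH _ (smooth_D i su)).
by rewrite exprS mulN1r mulNr.
Qed.

Lemma test_weak_partial s phi : test_function D phi ->
  is_weak_partial D s phi (partial s phi).
Proof.
move=> tphi; split.
  by apply/in_L2P; apply: test_sqintegrable => //; exact: test_partial.
by move=> psi tpsi; apply: integral_partial_test => //; exact: test_smooth tphi.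
Qed.

Lemma weak_partialB s u v u' v' : sqint u -> sqint u' ->
  is_weak_partial D s u v -> is_weak_partial D s u' v' ->
  is_weak_partial D s (u \- u') (fun x => v x - v' x).
Proof.
move=> Iu Iu' [/in_L2P Iv Hv] [/in_L2P Iv' Hv']; split.
  by apply/in_L2P; exact: sqintegrableB.
move=> phi tphi; have Ip := test_sqintegrable oD bD tphi.
have Ips := test_sqintegrable oD bD (test_partial s tphi).
rewrite integral_mulB// mulrBr -Hv// -Hv'//.
exact: integral_mulB.
Qed.

Lemma weak_partial_closed s (phi : nat -> R * R -> R) u v :
  (forall k, test_function D (phi k)) ->
  @L2cvg _ (meas2 R) R mu D phi u ->
  @L2cvg _ (meas2 R) R mu D (fun k => partial s (phi k)) v ->
  is_weak_partial D s u v.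
Proof.
move=> tphi cu cv; have [_ Iv _] := cv; split; first exact/in_L2P.
move=> psi tpsi.
have cpsi := L2cvg_cst (test_sqintegrable oD bD tpsi).
have cpsis := L2cvg_cst (test_sqintegrable oD bD (test_partial s tpsi)).
have h1 := L2cvg_intM mD cu cpsis.
have h2 := @cvgMl_tmp _ _ _ _ _ ((-1) ^+ size s) _ (L2cvg_intM mD cv cpsi).
have e : (fun k => \int[mu]_(x in D) (phi k x * partial s psi x)) =
    (fun k => (-1) ^+ size s * \int[mu]_(x in D) (partial s (phi k) x * psi x)).
  by apply/funext => k; apply: integral_partial_test => //; exact: test_smooth (tphi k).
rewrite e in h1.
exact: (@cvg_unique R (@norm_hausdorff _ _) _ _ _ _ h1 (h2 _)).
Qed.

End weak_partials.

(** * Approximation by test functions in the second-order norm *)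

Lemma cvg_sum0 (R : realType) (J : Type) (r : seq J) (F : J -> nat -> R) :
  (forall j, F j k @[k --> \oo] --> 0) -> \sum_(j <- r) F j k @[k --> \oo] --> 0.
Proof.
move=> F0; elim: r => [|j r IH].
  by under eq_fun do rewrite big_nil; exact: cvg_cst.
under eq_fun do rewrite big_cons.
have h := cvgD (F0 j) IH; rewrite addr0 in h; exact: h.
Qed.

Lemma cvg_sqrt0 (R : realType) (F : nat -> R) : (forall k, 0 <= F k) ->
  Num.sqrt (F k) @[k --> \oo] --> 0 <-> F k @[k --> \oo] --> 0.
Proof.
move=> F0; split=> h.
  have h2 := cvgM h h; rewrite mulr0 in h2.
  have e : F = (fun k => Num.sqrt (F k)) \* (fun k => Num.sqrt (F k)).
    by apply/funext => k; rewrite /= -expr2 sqr_sqrtr.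
  by rewrite e; exact: h2.
have h2 := continuous_cvg _ (@sqrt_continuous R 0) h.
rewrite sqrtr0 in h2; exact: h2.
Qed.

Section W22.
Context (R : realType) (D : set (R * R)).
Hypotheses (oD : open D) (bD : bounded_set D).
Notation mu := (@area R).
Local Notation sqn f := (\int[mu]_(x in D) (f x ^+ 2)).
Local Notation sqint u := (@sqintegrable _ (meas2 R) R mu D u).
Local Notation L2cvg := (@L2cvg _ (meas2 R) R mu D).

Let mD : @measurable _ (meas2 R) D := open_plane_measurable oD.

Lemma W22normE u (v : seq 'I_2 -> R * R -> R) :
  (forall s, (size s <= 2)%N -> is_weak_partial D s u (v s)) ->
  W22norm D u =
    (Num.sqrt (\sum_(k < 3) \sum_(s : k.-tuple 'I_2) sqn (v s)))%:E.
Proof.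
move=> Hv; rewrite /W22norm.
under eq_bigr => k _.
  under eq_bigr => s _.
    have ss : (size s <= 2)%N by rewrite size_tuple -ltnS.
    have [[/(in_L2P oD) Iw _] wv] := weak_partialP oD bD (Hv s ss).
    have /(in_L2P oD) Iv := (Hv s ss).1.
    rewrite (L2norm_sqn oD Iw) (@sqn_ae_eq _ _ _ _ _ mD _ (v s) Iw.1 Iv.1 wv); over.
  rewrite sumEFin; over.
rewrite sumEFin poweR12_sqrt// lee_fin.
by apply: sumr_ge0 => k _; apply: sumr_ge0 => s _; exact: sqn_ge0.
Qed.

Lemma weak_partial_nil u : in_L2 D u -> is_weak_partial D [::] u u.
Proof. by move=> Iu; split=> // phi tphi; rewrite expr0 mul1r. Qed.

(** The s-th weak derivative of phi_k - u is represented by partial s phi_k -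
    w s, so the norm is the root of the finite sum of the squared
    distances. *)
Lemma W22norm_cvg0 u (w : seq 'I_2 -> R * R -> R) (phi : nat -> R * R -> R) :
  sqint u -> (forall s, (size s <= 2)%N -> is_weak_partial D s u (w s)) ->
  (forall k, test_function D (phi k)) ->
  W22norm D (phi k \- u) @[k --> \oo] --> 0%E <->
  forall s, (size s <= 2)%N -> L2cvg (fun k => partial s (phi k)) (w s).
Proof.
move=> Iu Hw tphi.
pose S k := \sum_(j < 3) \sum_(s : j.-tuple 'I_2) sqn (fun x => partial s (phi k) x - w s x).
have S0 k : 0 <= S k.
  by apply: sumr_ge0 => j _; apply: sumr_ge0 => s _; exact: sqn_ge0.
have -> : (fun k => W22norm D (phi k \- u)) = (fun k => (Num.sqrt (S k))%:E).
  apply/funext => k; apply: (W22normE (v := fun s x => partial s (phi k) x - w s x)) => s ss.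
  apply: weak_partialB => //; first exact: test_sqintegrable.
    exact: test_weak_partial.
  exact: Hw.
have Iws s : (size s <= 2)%N -> sqint (w s).
  by move=> ss; apply/(in_L2P oD); exact: (Hw s ss).1.
split=> [|h].
  move/fine_cvg => /= /(cvg_sqrt0 S0).1 h s ss; split.
  - by move=> k; apply: test_sqintegrable => //; exact: test_partial.
  - exact: Iws.
  apply: (@squeeze_cvgr _ _ _ _ (cst 0)) h; last exact: cvg_cst.
  near=> k; rewrite sqn_ge0/= /S.
  have sp : (size s < 3)%N by rewrite ltnS.
  rewrite (bigD1 (Ordinal sp))//= (bigD1 (in_tuple s))//= -addrA lerDl addr_ge0//.
    by apply: sumr_ge0 => t _; exact: sqn_ge0.
  by apply: sumr_ge0 => j _; apply: sumr_ge0 => t _; exact: sqn_ge0.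
apply: cvg_EFin; first exact: nearW.
apply/(cvg_sqrt0 S0).2; apply: cvg_sum0 => j; apply: cvg_sum0 => s.
have ss : (size s <= 2)%N by rewrite size_tuple -ltnS.
by have [] := h s ss.
Unshelve. all: by end_near. Qed.

Definition W22_cvg (phi : nat -> R * R -> R) u :=
  [/\ forall k, test_function D (phi k), L2cvg phi u &
    forall s, (size s <= 2)%N -> L2cvg (fun k => partial s (phi k)) (weak_partial D s u)].

Lemma W22_0_approx u : in_W22_0 D u -> exists phi, W22_cvg phi u.
Proof.
move=> [[/[dup] L2u /(in_L2P oD) Iu Eu] [phi [tphi cphi]]]; exists phi.
have Hw s : (size s <= 2)%N -> is_weak_partial D s u (weak_partial D s u).
  by move=> ss; have [v Hv] := Eu s ss; have [] := weak_partialP oD bD Hv.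
have H := (W22norm_cvg0 Iu Hw tphi).1 cphi; split=> //.
apply: (L2cvg_ae mD (H [::] erefl) Iu.1).
exact: (weak_partialP oD bD (weak_partial_nil L2u)).2.
Qed.

Lemma W22_0_limit u (phi : nat -> R * R -> R) :
  (forall k, test_function D (phi k)) -> L2cvg phi u ->
  (forall s, (size s <= 2)%N -> exists v, L2cvg (fun k => partial s (phi k)) v) ->
  in_W22_0 D u /\ W22_cvg phi u.
Proof.
move=> tphi cu ex; have [_ Iu _] := cu.
have Hw s : (size s <= 2)%N -> is_weak_partial D s u (weak_partial D s u).
  move=> /ex[v cv].
  by have [] := weak_partialP oD bD (weak_partial_closed oD bD tphi cu cv).
have H s : (size s <= 2)%N -> L2cvg (fun k => partial s (phi k)) (weak_partial D s u).
  move=> ss; have [v cv] := ex s ss; have [/(in_L2P oD) Iw _] := Hw s ss.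
  apply: (L2cvg_ae mD cv Iw.1).
  apply: filterS (weak_partialP oD bD (weak_partial_closed oD bD tphi cu cv)).2.
  by move=> x h /h.
split=> //; split; first split.
- exact/(in_L2P oD).
- by move=> s /Hw; exists (weak_partial D s u).
- by exists phi; split=> //; exact: (W22norm_cvg0 Iu Hw tphi).2.
Qed.

(** The weak derivatives of u also serve as limits for v, and [W22_0_limit]
    identifies them with those of v. *)
Lemma W22_cvg_ae u v phi : W22_cvg phi u -> measurable_fun D (v : meas2 R -> R) ->
  ae_eq mu D u v -> W22_cvg phi v.
Proof.
move=> [tphi cu cp] mv uv; have cv := L2cvg_ae mD cu mv uv.
apply: (W22_0_limit tphi cv _).2 => s ss; exists (weak_partial D s u); exact: cp.
Qed.

End W22.

(** * Completeness: limits of Cauchy sequences of test functions *)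

Section second_order_norm.
Context (R : realType) (D : set (R * R)).
Hypotheses (oD : open D) (bD : bounded_set D).
Notation mu := (@area R).
Local Notation sqn f := (\int[mu]_(x in D) (f x ^+ 2)).
Local Notation integ f := (\int[mu]_(x in D) f x).
Local Notation sqint u := (@sqintegrable _ (meas2 R) R mu D u).
Local Notation N := (nrm (@tdirichlet R D)).

Let mD : @measurable _ (meas2 R) D := open_plane_measurable oD.
Let tP (u : test_space D) : test_function D (tfun u) := proj2_sig u.
Let ia := tdirichlet_inner oD bD.

Lemma sqn_le_sup (g : R * R -> R) (M : R) : measurable_fun D (g : meas2 R -> R) ->
  (forall x, D x -> `|g x| <= M) -> sqint g /\ sqn g <= M ^+ 2 * fine (mu D).
Proof.
move=> mg gM; have mg2 : measurable_fun D (fun x : meas2 R => g x ^+ 2) by exact: measurable_funX.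
have le x : D x -> g x ^+ 2 <= M ^+ 2.
  move=> /gM h; rewrite -[g x ^+ 2]real_normK ?num_real// ler_sqr ?nnegrE//.
  exact: le_trans h.
have IM : mu.-integrable D (EFin \o (fun=> M ^+ 2)).
  apply/integrableP; split; first by apply/measurable_EFinP; exact: measurable_cst.
  under eq_integral do rewrite /= ger0_norm ?sqr_ge0//.
  rewrite integral_cst//=; apply: lte_mul_pinfty => //; first by rewrite lee_fin sqr_ge0.
  exact: area_bounded.
have Ig : mu.-integrable D (EFin \o (fun x => g x ^+ 2)).
  apply: (le_integrable mD _ _ IM); first by apply/measurable_EFinP.
  by move=> x Dx /=; rewrite lee_fin !ger0_norm ?sqr_ge0// le.
split=> //; rewrite -(Rintegral_cst mu mD).
exact: (le_Rintegral mD Ig IM le).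
Qed.

Lemma young_integral (f g : R * R -> R) : sqint f -> sqint g ->
  - integ (fun x => f x * g x) <= 2^-1 * (sqn f + sqn g).
Proof.
move=> If Ig; have := @sqn_addZ _ _ _ _ _ mD _ _ 1 If Ig.
have := @sqn_ge0 _ _ _ mu D (fun x => f x + 1 * g x).
rewrite mulr1 expr1n mul1r => + e; rewrite {}e.
move: (sqn f) (sqn g) (\int[mu]_(x in D) (f x * g x)) => a b c; lra.
Qed.

(** The squared norm of the first derivative is - 1 times the integral of the
    second derivative times phi. *)
Lemma sqn_partial1_le i (phi : R * R -> R) : test_function D phi ->
  sqn ('D_(axis R i) phi) <=
    2^-1 * (sqn ('D_(axis R i) ('D_(axis R i) phi)) + sqn phi).
Proof.
move=> tphi; have t1 := test_D i tphi; have t2 := test_D i t1.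
have := young_integral (test_sqintegrable oD bD t2) (test_sqintegrable oD bD tphi).
rewrite -(integration_by_parts_test oD bD i tphi (test_smooth t1)); apply: le_trans.
rewrite le_eqVlt; apply/orP; left; apply/eqP.
by apply: eq_Rintegral => x _; rewrite expr2.
Qed.

(** The sup norm controls phi itself because D has finite area,
    [dirichlet_hess] controls the second derivatives, and [sqn_partial1_le]
    interpolates the first ones. *)
Lemma second_order_poincare : exists2 C, 0 < C & forall u s, (size s <= 2)%N ->
  sqn (partial s (tfun u)) <= C * N u ^+ 2.
Proof.
have [c c0 supN] := tsup_nrm oD bD.
pose A := c ^+ 2 * fine (mu D); have A0 : 0 <= A by rewrite mulr_ge0// ?sqr_ge0// fine_ge0.
have h0 (u : test_space D) : sqn (tfun u) <= A * N u ^+ 2.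
  have mu0 : measurable_fun D (tfun u : meas2 R -> R) by exact: test_measurable (tP u).
  have [_ /le_trans] := sqn_le_sup mu0 (fun x _ => tsup_ge u x); apply.
  rewrite /A [leRHS]mulrAC -[c ^+ 2 * N u ^+ 2]exprMn ler_wpM2r ?fine_ge0// ler_sqr ?nnegrE ?supN//.
    exact: tsup_ge0.
  by rewrite mulr_ge0 ?nrm_ge0// ltW.
have h2 (u : test_space D) i j : sqn (partial [:: i; j] (tfun u)) <= N u ^+ 2.
  have e := dirichlet_hess oD bD (tP u).
  have -> : partial [:: i; j] (tfun u) = hess i j (tfun u) by rewrite hess.unlock.
  rewrite (nrm_sqr ia) /tdirichlet e.
  have := @sqn_ge0 _ _ _ mu D (hess 0 0 (tfun u)).
  have := @sqn_ge0 _ _ _ mu D (hess 1 1 (tfun u)).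
  have := @sqn_ge0 _ _ _ mu D (hess 0 1 (tfun u)).
  have hs := hess_sym (test_smooth (tP u)).
  have [->|->] := ord2_cases i; have [->|->] := ord2_cases j; rewrite ?hs;
    move: (sqn _) (sqn _) (sqn _) => x y z; lra.
exists (1 + A); first by rewrite ltr_wpDr.
move=> u s; have Nu := sqr_ge0 (N u).
have AN : 0 <= A * N u ^+ 2 by rewrite mulr_ge0.
case: s => [_|i [_|j [_|//]]].
- by rewrite (le_trans (h0 u))// mulrDl mul1r lerDr.
- apply: le_trans (sqn_partial1_le i (tP u)) _.
  have h := lerD (h2 u i i) (h0 u).
  rewrite (@le_trans _ _ (2^-1 * (N u ^+ 2 + A * N u ^+ 2)))//.
    by rewrite ler_wpM2l.
  by rewrite mulrDl mul1r; move: (N u ^+ 2) (A * _) Nu AN => x y; lra.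
- by rewrite (le_trans (h2 u i j))// mulrDl mul1r lerDl.
Qed.

End second_order_norm.

Lemma trace_mx2 (R : nzRingType) (A : 'M[R]_2) : \tr A = A 0 0 + A 1 1.
Proof.
rewrite /mxtrace !big_ord_recl big_ord0 addr0.
by have -> : lift ord0 ord0 = 1 :> 'I_2 by exact: val_inj.
Qed.

Lemma det_mx2 (R : comNzRingType) (A : 'M[R]_2) :
  \det A = A 0 0 * A 1 1 - A 0 1 * A 1 0.
Proof.
rewrite (expand_det_row _ 0) !big_ord_recl big_ord0 addr0 /cofactor !det_mx11 !mxE /=.
have e1 : lift ord0 ord0 = 1 :> 'I_2 by exact: val_inj.
have e0 : lift (1 : 'I_2) ord0 = 0 :> 'I_2 by exact: val_inj.
by rewrite !e1 e0 /= expr0 expr1 mul1r mulN1r mulrN.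
Qed.

Section strong_limits.
Context (R : realType) (D : set (R * R)).
Hypotheses (oD : open D) (bD : bounded_set D).
Notation mu := (@area R).
Local Notation sqn f := (\int[mu]_(x in D) (f x ^+ 2)).
Local Notation sqint u := (@sqintegrable _ (meas2 R) R mu D u).
Local Notation L2cvg := (@L2cvg _ (meas2 R) R mu D).
Local Notation N := (nrm (@tdirichlet R D)).
Local Notation tsub := (sub (@tadd R D) (@tscl R D)).
Local Notation tcauchy := (cauchy_seq_for (@tadd R D) (@tscl R D) (@tdirichlet R D)).
Implicit Type phi : nat -> test_space D.

Let mD : @measurable _ (meas2 R) D := open_plane_measurable oD.
Let tP (u : test_space D) : test_function D (tfun u) := proj2_sig u.
Let ia := tdirichlet_inner oD bD.

Lemma laplacianE (u : R * R -> R) x :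
  laplacian D u x = weak_partial D [:: 0; 0] u x + weak_partial D [:: 1; 1] u x.
Proof. by rewrite /laplacian trace_mx2 !mxE. Qed.

Lemma det_hessianE (u : R * R -> R) x :
  \det (hessian D u x) =
  weak_partial D [:: 0; 0] u x * weak_partial D [:: 1; 1] u x
  - weak_partial D [:: 0; 1] u x * weak_partial D [:: 1; 0] u x.
Proof. by rewrite det_mx2 !mxE. Qed.

Lemma tsub_fun (u v : test_space D) x : tfun (tsub u v) x = tfun u x - tfun v x.
Proof. by rewrite /= mulN1r. Qed.

Lemma nrm_tsub_le (u v : test_space D) L : sqint L ->
  N (tsub u v) ^+ 2 <=
    2 * sqn (fun x => lap (tfun u) x - L x) + 2 * sqn (fun x => lap (tfun v) x - L x).
Proof.
move=> IL; have Iu := test_sqintegrable oD bD (test_lap (tP u)).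
have Iv := test_sqintegrable oD bD (test_lap (tP v)).
rewrite (nrm_sqr ia).
have -> : tdirichlet (tsub u v) (tsub u v) =
    sqn (fun x => (lap (tfun u) x - L x) + (L x - lap (tfun v) x)).
  rewrite /tdirichlet /dirichlet; apply: eq_Rintegral => x _.
  have -> : lap (tfun (tsub u v)) x = lap (tfun u) x - lap (tfun v) x.
    have su := test_smooth (tP u); have sv := test_smooth (tP v).
    apply: etrans (lapD x su (smoothZ (-1) sv)) _; congr (_ + _).
    exact: etrans (lapZ (-1) x sv) (mulN1r _).
  by rewrite subrKA expr2.
have -> : sqn (fun x => lap (tfun v) x - L x) = sqn (fun x => L x - lap (tfun v) x).
  by apply: eq_Rintegral => x _; rewrite -sqrrN opprB.
exact: (@sqnD _ (meas2 R) R mu D mD _ _ (sqintegrableB mD Iu IL) (sqintegrableB mD IL Iv)).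
Qed.

Lemma lap_cvg phi u : W22_cvg D (fun k => tfun (phi k)) u ->
  L2cvg (fun k => lap (tfun (phi k))) (laplacian D u).
Proof.
move=> [_ _ cp].
have := L2cvgD mD (cp [:: 0; 0] erefl) (cp [:: 1; 1] erefl).
rewrite (_ : laplacian D u = fun x =>
  weak_partial D [:: 0; 0] u x + weak_partial D [:: 1; 1] u x); last first.
  by apply/funext => x; exact: laplacianE.
by rewrite /lap hess.unlock.
Qed.

(** The Laplacians converge in the mean and the norm of a test function is
    that of its Laplacian. *)
Lemma W22_cvg_cauchy phi u : W22_cvg D (fun k => tfun (phi k)) u ->
  tcauchy phi /\ exists B, forall k, N (phi k) <= B.
Proof.
move=> cu; have cL := lap_cvg cu; have [_ IL c0] := cL.
have ca : tcauchy phi.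
  move=> e e0; have e4 : 0 < e ^+ 2 / 4 by rewrite divr_gt0// exprn_gt0.
  move/cvgrPdist_le : c0 => /(_ _ e4)[K _ HK]; exists K => j k Kj Kk.
  rewrite -ler_sqr ?nnegrE ?nrm_ge0 ?(ltW e0)//.
  apply: le_trans (nrm_tsub_le (phi j) (phi k) IL) _.
  have := HK j Kj; have := HK k Kk; rewrite /= !sub0r !normrN => /(le_trans (ler_norm _)) hk /(le_trans (ler_norm _)) hj.
  move: hk hj; move: (\int[mu]_(x in D) _) (\int[mu]_(x in D) _) => x y; lra.
split=> //.
have [M M0 HM] := L2cvg_bounded mD cL.
exists (Num.sqrt M) => k; rewrite -[leLHS]ger0_norm ?nrm_ge0// -sqrtr_sqr ler_wsqrtr//.
by rewrite (nrm_sqr ia); apply: le_trans (HM k); rewrite le_eqVlt; apply/orP; left; apply/eqP.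
Qed.

Definition uniform_limit phi (h : R * R -> R) :=
  exists2 e : nat -> R, e @ \oo --> 0 & forall k x, `|tfun (phi k) x - h x| <= e k.

Lemma cauchy_uniform phi : tcauchy phi -> exists h, uniform_limit phi h.
Proof.
move=> cphi; have [c c0 supN] := tsup_nrm oD bD.
have near_ e : 0 < e -> exists K, forall j k, (K <= j)%N -> (K <= k)%N ->
    forall x, `|tfun (phi j) x - tfun (phi k) x| <= e.
  move=> e0; have [|K HK] := cphi (e / c); first exact: divr_gt0.
  exists K => j k Kj Kk x; rewrite -tsub_fun (le_trans (tsup_ge _ x))//.
  by rewrite (le_trans (supN _))// mulrC -ler_pdivlMr// HK.
pose h x := limn (fun k => tfun (phi k) x).
have hc x : tfun (phi k) x @[k --> \oo] --> h x.
  apply/cauchy_cvgP/cauchy_exP => e e0.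
  have [|K HK] := near_ (e / 2); first exact: divr_gt0.
  exists (tfun (phi K) x); exists K => // k /= Kk; rewrite /ball/=.
  by rewrite (le_lt_trans (HK _ _ (leqnn K) Kk x))// ltr_pdivrMr// ltr_pMr// ltr1n.
have hu e : 0 < e -> exists K, forall k, (K <= k)%N -> forall x,
    `|tfun (phi k) x - h x| <= e.
  move=> /near_[K HK]; exists K => k Kk x.
  have hx : `|tfun (phi k) x - tfun (phi j) x| @[j --> \oo] --> `|tfun (phi k) x - h x|.
    by apply: cvg_norm; apply: cvgB; [exact: cvg_cst|exact: hc].
  apply: (ler_cvg_to hx (cvg_cst _)).
  by exists K => // j /= Kj; exact: HK.
pose S k := [set `|tfun (phi k) x - h x| | x in [set: R * R]].
have S0 k : S k !=set0 by exists (`|tfun (phi k) 0 - h 0|), 0.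
have Sb k : has_sup (S k).
  split=> //; have [K HK] := hu 1 ltr01.
  exists (tsup (phi k) + tsup (phi K) + 1) => _ [x _ <-].
  rewrite -(subrKA (tfun (phi K) x)) (le_trans (ler_normD _ _))// lerD// ?HK//.
  by rewrite (le_trans (ler_normB _ _))// lerD// tsup_ge.
exists h; exists (fun k => sup (S k)).
  apply/cvgrPdist_le => e e0; have [K HK] := hu e e0.
  exists K => // k /= Kk; rewrite sub0r normrN ger0_norm; last first.
    apply: le_trans (normr_ge0 (tfun (phi k) 0 - h 0)) _.
    by apply: sup_upper_bound => //; exists 0.
  by apply: ge_sup => // _ [x _ <-]; exact: HK.
by move=> k x; apply: sup_upper_bound => //; exists x.
Qed.

Lemma uniform_limit_measurable phi h : uniform_limit phi h ->
  measurable_fun D (h : meas2 R -> R).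
Proof.
move=> [e e0 He].
apply: (@measurable_fun_cvg _ (meas2 R) R D (fun k => tfun (phi k))).
  by move=> k; exact: test_measurable (tP _).
move=> x Dx; apply/cvgrPdist_le => d d0.
move/cvgrPdist_le : e0 => /(_ d d0); apply: filterS => k.
rewrite sub0r normrN distrC => /(le_trans (ler_norm _)); apply: le_trans.
exact: He.
Qed.

Lemma uniform_limit_L2 phi h : uniform_limit phi h -> L2cvg (fun k => tfun (phi k)) h.
Proof.
move=> /[dup] /uniform_limit_measurable mh [e e0 He].
have It k := test_sqintegrable oD bD (tP (phi k)).
have mB k : measurable_fun D (fun x : meas2 R => tfun (phi k) x - h x).
  by apply: measurable_funB => //; exact: test_measurable (tP _).
have B k := sqn_le_sup oD bD (mB k) (fun x _ => He k x).
split=> //.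
  have := sqintegrableB mD (It 0) (B 0).1.
  rewrite (_ : (fun x => _) = h)//; apply/funext => x; ring.
have e2 : (fun k => e k * e k * fine (mu D)) @ \oo --> 0.
  have e2 := @cvgMr_tmp _ _ _ _ _ _ (fine (mu D)) (cvgM e0 e0).
  rewrite mulr0 mul0r in e2; exact: e2.
apply: (@squeeze_cvgr _ _ _ _ (cst 0)) e2; last exact: cvg_cst.
by near=> k; rewrite sqn_ge0/=; have [_ /le_trans] := B k; apply; rewrite expr2.
Unshelve. all: by end_near. Qed.

Lemma W22_cvg_uniform phi u : W22_cvg D (fun k => tfun (phi k)) u ->
  exists2 h, uniform_limit phi h & ae_eq mu D u h.
Proof.
move=> /[dup] /W22_cvg_cauchy[/cauchy_uniform[h Hh] _] [_ cu _].
by exists h => //; exact: (L2cvg_unique mD cu (uniform_limit_L2 Hh)).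
Qed.

Lemma partial_tsub (u v : test_space D) s x :
  partial s (tfun (tsub u v)) x = partial s (tfun u) x - partial s (tfun v) x.
Proof.
have su := test_smooth (tP u); have sv := test_smooth (tP v).
apply: etrans (partialD s x su (smoothZ (-1) sv)) _; congr (_ + _).
exact: etrans (partialZ (-1) s x sv) (mulN1r _).
Qed.

(** Along a rapidly converging subsequence every derivative of order at most 2
    converges in the mean by [L2_rapid_cvg]; the Cauchy property extends this
    to the whole sequence. The limit function itself is the uniform one. *)
Lemma cauchy_W22_limit phi : tcauchy phi ->
  exists2 u, in_W22_0 D u & W22_cvg D (fun k => tfun (phi k)) u.
Proof.
move=> cphi; have [C C0 HC] := second_order_poincare oD bD.
have Ip s k : sqint (partial s (tfun (phi k))).
  by apply: test_sqintegrable => //; apply: test_partial; exact: tP.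
have HCB s j k : (size s <= 2)%N ->
    sqn (fun x => partial s (tfun (phi j)) x - partial s (tfun (phi k)) x) <=
    C * N (tsub (phi j) (phi k)) ^+ 2.
  move=> ss; apply: le_trans (HC _ s ss); rewrite le_eqVlt; apply/orP; left; apply/eqP.
  by apply: eq_Rintegral => x _; rewrite partial_tsub.
pose r k := Num.sqrt ((2 ^+ k * 2 ^+ k.+1)^-1 / C).
have r0 k : 0 < r k by rewrite sqrtr_gt0 divr_gt0// invr_gt0 mulr_gt0// exprn_gt0.
have /choice[K HK] : forall k, exists K, forall i j, (K <= i)%N -> (K <= j)%N ->
    N (tsub (phi i) (phi j)) <= r k by move=> k; exact: cphi.
(* a sum, so that both sigma k and sigma (k + 1) are at least K k *)
pose sigma k := (k + \sum_(j < k.+1) K j)%N.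
have Ks k : (K k <= sigma k)%N.
  by rewrite /sigma big_ord_recr /= addnA leq_addl.
have Kss k : (K k <= sigma k.+1)%N.
  by rewrite (leq_trans (Ks k))// /sigma [in leqRHS]big_ord_recr /= leq_add// leq_addr.
have sk k : (k <= sigma k)%N by rewrite leq_addr.
have [h Hh] := cauchy_uniform cphi.
have ex s : (size s <= 2)%N -> exists v, L2cvg (fun k => partial s (tfun (phi k))) v.
  move=> ss; have [||v [_ Iv cv]] := @L2_rapid_cvg _ (meas2 R) R mu D mD
      (fun k => partial s (tfun (phi (sigma k)))).
  - by move=> k; exact: Ip.
  - move=> k; apply: (le_trans (HCB s _ _ ss)); rewrite mulrC -ler_pdivlMr//.
    have rk2 : r k ^+ 2 = (2 ^+ k * 2 ^+ k.+1)^-1 / C.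
      by rewrite sqr_sqrtr// divr_ge0 ?(ltW C0)// invr_ge0 mulr_ge0// exprn_ge0.
    by rewrite -rk2 ler_sqr ?nnegrE ?nrm_ge0 ?(ltW (r0 k))// HK.
  exists v; split=> //; apply/cvgrPdist_le => e e0.
  have e1 : 0 < e / (4 * C) by rewrite divr_gt0// mulr_gt0.
  have sp : 0 < Num.sqrt (e / (4 * C)) by rewrite sqrtr_gt0.
  have [M1 HM1] := cphi _ sp.
  move/cvgrPdist_le : cv => /(_ (e / 4)) []; first by rewrite divr_gt0.
  move=> M2 _ HM2; exists (maxn M1 M2) => // k /=; rewrite geq_max => /andP[k1 k2].
  have {HM2} := HM2 k k2; rewrite !sub0r !normrN !ger0_norm ?sqn_ge0// => h2.
  have := sqnD mD (sqintegrableB mD (Ip s k) (Ip s (sigma k))) (sqintegrableB mD (Ip s (sigma k)) Iv).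
  rewrite (_ : (\int[mu]_(x in D) _ ^+ 2) =
    sqn (fun x => partial s (tfun (phi k)) x - v x)); last first.
    by apply: eq_Rintegral => x _; rewrite subrKA.
  move=> h3; apply: (le_trans h3).
  have h4 := HM1 _ _ k1 (leq_trans k1 (sk k)).
  have h5 : C * N (tsub (phi k) (phi (sigma k))) ^+ 2 <= e / 4.
    have -> : e / 4 = C * Num.sqrt (e / (4 * C)) ^+ 2.
      by rewrite sqr_sqrtr ?(ltW e1)//; field; rewrite gt_eqF.
    by rewrite ler_wpM2l ?(ltW C0)// ler_sqr ?nnegrE ?nrm_ge0 ?(ltW sp).
  have h6 := le_trans (HCB s k (sigma k) ss) h5.
  move: h2 h6; move: (\int[mu]_(x in D) _) (\int[mu]_(x in D) _) => x y; lra.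
have [Wh ch] := W22_0_limit oD bD (fun k => tP (phi k)) (uniform_limit_L2 Hh) ex.
by exists h.
Qed.

End strong_limits.

(** * Passage to the limit in the equation *)

Section existence.
Context (R : realType) (D : set (R * R)) (f : R * R -> R).
Hypotheses (oD : open D) (bD : bounded_set D).
Notation mu := (@area R).
Hypothesis intf : mu.-integrable D (EFin \o f).
Local Notation integ f := (\int[mu]_(x in D) f x).
Local Notation L2cvg := (@L2cvg _ (meas2 R) R mu D).
Local Notation N := (nrm (@tdirichlet R D)).
Implicit Type phi : nat -> test_space D.

Let mD : @measurable _ (meas2 R) D := open_plane_measurable oD.
Let tP (u : test_space D) : test_function D (tfun u) := proj2_sig u.
Let mf : measurable_fun D (f : meas2 R -> R).
Proof. by apply/measurable_EFinP; exact: measurable_int intf. Qed.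

Definition load (u : test_space D) := integ (fun x => f x * tfun u x).

Lemma integral_bounded_le (g : R * R -> R) (M : R) : measurable_fun D (g : meas2 R -> R) ->
  (forall x, D x -> `|g x| <= M) ->
  mu.-integrable D (EFin \o (fun x => f x * g x)) /\
  `|integ (fun x => f x * g x)| <= M * integ (fun x => `|f x|).
Proof.
move=> mg gM.
have If : mu.-integrable D (EFin \o (fun x => M * `|f x|)).
  have := integrableZl mD M (integrable_norm intf).
  by apply: eq_integrable => // x _ /=; rewrite EFinM.
have le x : D x -> `|f x * g x| <= M * `|f x|.
  by move=> Dx; rewrite normrM mulrC ler_wpM2r// gM.
have Ifg : mu.-integrable D (EFin \o (fun x => f x * g x)).
  apply: (le_integrable mD _ _ If).
    by apply/measurable_EFinP; exact: measurable_funM.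
  by move=> x Dx /=; rewrite lee_fin (le_trans (le x Dx))// ler_norm.
split=> //; apply: (le_trans (le_normr_Rintegral mD Ifg)).
rewrite -RintegralZl//; last exact: integrable_norm intf.
apply: le_Rintegral => //.
exact: integrable_norm Ifg.
Qed.

Lemma load_linear : linear_form (@tadd R D) (@tscl R D) load.
Proof.
have I0 (u : test_space D) : mu.-integrable D (EFin \o (fun x => f x * tfun u x)).
  have [M HM] := test_bounded (tP u).
  apply: (integral_bounded_le _ (fun x _ => HM x)).1.
  exact: test_measurable (tP u).
split=> [u v|c u].
  rewrite /load -(RintegralD mD (I0 u) (I0 v)).
  by apply: eq_Rintegral => x _; rewrite /= mulrDr.
rewrite /load -(RintegralZl c mD (I0 u)).
by apply: eq_Rintegral => x _; rewrite /= mulrCA.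
Qed.

Lemma load_le : exists2 kappa, 0 <= kappa & forall u, `|load u| <= kappa * N u.
Proof.
have [c c0 supN] := tsup_nrm oD bD.
have F0 : 0 <= integ (fun x => `|f x|) by exact: Rintegral_ge0.
exists (c * integ (fun x => `|f x|)); first by rewrite mulr_ge0// ltW.
move=> u; have mt : measurable_fun D (tfun u : meas2 R -> R) by exact: test_measurable (tP u).
apply: (le_trans (integral_bounded_le mt (fun x _ => tsup_ge u x)).2).
by rewrite mulrAC ler_wpM2r.
Qed.

Lemma load_cvg phi h : uniform_limit phi h ->
  load (phi k) @[k --> \oo] --> integ (fun x => f x * h x).
Proof.
move=> /[dup] /uniform_limit_measurable mh [e e0 He].
have mt k : measurable_fun D (tfun (phi k) : meas2 R -> R) by exact: test_measurable (tP _).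
have mB k : measurable_fun D (fun x : meas2 R => tfun (phi k) x - h x) by exact: measurable_funB.
have Ip k : mu.-integrable D (EFin \o (fun x => f x * tfun (phi k) x)).
  exact: (integral_bounded_le (mt k) (fun x _ => tsup_ge (phi k) x)).1.
have Bk k := integral_bounded_le (mB k) (fun x _ => He k x).
have Ih : mu.-integrable D (EFin \o (fun x => f x * h x)).
  have := integrableB mD (Ip 0) (Bk 0).1.
  by apply: eq_integrable => // x _ /=; congr EFin; ring.
have ec : (fun k => e k * integ (fun x => `|f x|)) @ \oo --> 0.
  have ec := @cvgMr_tmp _ _ _ _ _ _ (integ (fun x => `|f x|)) e0.
  rewrite mul0r in ec; exact: ec.
apply/cvgrPdist_le => d d0.
move/cvgrPdist_le : ec => /(_ d d0); apply: filterS => k.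
rewrite sub0r normrN => /(le_trans (ler_norm _)); apply: le_trans.
rewrite distrC -(RintegralB mD (Ip k) Ih).
apply: le_trans (Bk k).2; rewrite le_eqVlt; apply/orP; left; apply/eqP; congr (`| _ |).
by apply: eq_Rintegral => x _; rewrite mulrBr.
Qed.

Lemma trilinear_det (u phi : R * R -> R) : test_function D u -> test_function D phi ->
  trilinear D u u phi =
  integ (fun x => hess 0 0 u x * (hess 1 1 u x * phi x)) -
  integ (fun x => hess 0 1 u x * (hess 1 0 u x * phi x)).
Proof.
move=> tu tp; have th i j := test_hess i j tu.
have tM i j := test_Mr (th i j) (test_smooth tp).
have tI i j k l := test_intM oD bD (th i j) (tM k l).
rewrite /trilinear -(RintegralB mD (tI 0 0 1 1) (tI 0 1 1 0)).
rewrite -(RintegralZl _ mD (test_intM oD bD (test_bracket tu tu) tp)).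
rewrite (hess_sym (test_smooth tu)).
apply: eq_Rintegral => x _; rewrite /bracket.
by move: (hess 0 0 u x) (hess 1 1 u x) (hess 0 1 u x) (phi x) => a b c p; field.
Qed.

(** In each of the two products of the determinant, one second derivative
    converges in the mean and so does the other one multiplied by the
    uniformly convergent phi_k. *)
Lemma ttrilinear_cvg (u_ : nat -> test_space D) u phi h (B : R) :
  W22_cvg D (fun k => tfun (u_ k)) u -> uniform_limit phi h ->
  (forall k, N (phi k) <= B) ->
  ttrilinear (u_ k) (u_ k) (phi k) @[k --> \oo] -->
    integ (fun x => \det (hessian D u x) * h x).
Proof.
move=> [_ _ cu] Hh phiB; have mh := uniform_limit_measurable Hh.
have [e e0 He] := Hh; have [c c0 supN] := tsup_nrm oD bD.
have ch i j : L2cvg (fun k => hess i j (tfun (u_ k))) (weak_partial D [:: i; j] u).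
  by have := cu [:: i; j] erefl; rewrite hess.unlock.
have cM i j : L2cvg (fun k x => hess i j (tfun (u_ k)) x * tfun (phi k) x)
    (fun x => weak_partial D [:: i; j] u x * h x).
  apply: (@L2cvgM _ (meas2 R) R mu D mD _ _ _ _ (c * B) e (ch i j)) => //.
    by move=> k; exact: test_measurable (tP _).
  move=> k x _; rewrite (le_trans (tsup_ge _ _))// (le_trans (supN _))//.
  by rewrite ler_wpM2l// ltW.
have c1 := L2cvg_intM mD (ch 0 0) (cM 1 1).
have c2 := L2cvg_intM mD (ch 0 1) (cM 1 0).
have cB := cvgB c1 c2.
have [_ I0 _] := ch 0 0; have [_ I1 _] := cM 1 1.
have [_ J0 _] := ch 0 1; have [_ J1 _] := cM 1 0.
have -> : integ (fun x => \det (hessian D u x) * h x) =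
    integ (fun x => weak_partial D [:: 0; 0] u x * (weak_partial D [:: 1; 1] u x * h x)) -
    integ (fun x => weak_partial D [:: 0; 1] u x * (weak_partial D [:: 1; 0] u x * h x)).
  rewrite -(RintegralB mD (sqintegrableM mD I0 I1) (sqintegrableM mD J0 J1)).
  apply: eq_Rintegral => x _; rewrite det_hessianE.
  move: (weak_partial D [:: 0; 0] u x) (weak_partial D [:: 1; 1] u x)
    (weak_partial D [:: 0; 1] u x) (weak_partial D [:: 1; 0] u x) (h x) => a b c' d z; ring.
have e_ : (fun k => ttrilinear (u_ k) (u_ k) (phi k)) =
    (fun k => integ (fun x => hess 0 0 (tfun (u_ k)) x * (hess 1 1 (tfun (u_ k)) x * tfun (phi k) x)) -
      integ (fun x => hess 0 1 (tfun (u_ k)) x * (hess 1 0 (tfun (u_ k)) x * tfun (phi k) x))).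
  by apply/funext => k; apply: trilinear_det; exact: tP.
rewrite e_; exact: cB.
Qed.

(** The equation is tested with the approximants phi_k of psi at the same
    index k as u_k. The norms of the phi_k are bounded, so the residuals
    disappear in the limit. *)
Lemma limit_solution lambda (u_ : nat -> test_space D) u :
  in_W22_0 D u -> W22_cvg D (fun k => tfun (u_ k)) u ->
  vanishing (@tdirichlet R D) (fun k w => tdirichlet (u_ k) w -
    ttrilinear (u_ k) (u_ k) w - lambda * load w) ->
  is_solution D f lambda u.
Proof.
move=> Wu cu res; split=> // psi Wpsi.
have [p cp] := W22_0_approx oD bD Wpsi; have [tp cpsi _] := cp.
pose phi k : test_space D := exist _ (p k) (tp k).
have cphi : W22_cvg D (fun k => tfun (phi k)) psi by exact: cp.
have [_ [B HB]] := W22_cvg_cauchy oD bD cphi.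
have [h Hh psih] := W22_cvg_uniform oD bD cphi.
have mh := uniform_limit_measurable Hh.
have mpsi : measurable_fun D (psi : meas2 R -> R) by have [_ [mpsi _] _] := cpsi.
have cL := L2cvg_intM mD (lap_cvg oD cu) (lap_cvg oD cphi).
have cT := ttrilinear_cvg cu Hh HB.
have cl : (fun k => lambda * load (phi k)) @ \oo --> lambda * integ (fun x => f x * h x).
  by apply: cvgMl_tmp; exact: load_cvg.
have cR := cvgB (cvgB cL cT) cl.
have cR0 : (fun k => tdirichlet (u_ k) (phi k) - ttrilinear (u_ k) (u_ k) (phi k) -
    lambda * load (phi k)) @ \oo --> 0.
  apply/cvgrPdist_le => e e0.
  have B1 : 0 < `|B| + 1 by rewrite ltr_wpDl.
  have [|K HK] := res (e / (`|B| + 1)); first exact: divr_gt0.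
  exists K => // k /= Kk; rewrite sub0r normrN (le_trans (HK k Kk _))//.
  rewrite mulrAC ler_pdivrMr// ler_wpM2l ?(ltW e0)//.
  by rewrite (le_trans (HB k))// (le_trans (ler_norm B))// lerDl.
have E := @cvg_unique R (@norm_hausdorff _ _) _ _ _ _ (cR _ _) cR0.
have ae1 g : measurable_fun D (g : meas2 R -> R) ->
    integ (fun x => g x * psi x) = integ (fun x => g x * h x).
  move=> mg; apply: (@ae_eq_Rintegral _ (meas2 R) R mu D mD).
  - exact: measurable_funM.
  - exact: measurable_funM.
  - by apply: filterS psih => x /= ph Dx; rewrite ph.
rewrite (ae1 f mf) (ae1 (fun x => \det (hessian D u x))); last first.
  have [_ _ cs] := cu.
  have mw i j : measurable_fun D (weak_partial D [:: i; j] u : meas2 R -> R).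
    by have [_ [mw _] _] := cs [:: i; j] erefl.
  rewrite (_ : (fun x => \det (hessian D u x)) = (fun x =>
    weak_partial D [:: 0; 0] u x * weak_partial D [:: 1; 1] u x -
    weak_partial D [:: 0; 1] u x * weak_partial D [:: 1; 0] u x)); last first.
    by apply/funext => x; exact: det_hessianE.
  by apply: measurable_funB; apply: measurable_funM; exact: mw.
apply/eqP; rewrite -subr_eq0 opprD addrA; apply/eqP; exact: E.
Qed.

End existence.

(** * Two distinct solutions *)

Section distinct.
Context (R : realType) (D : set (R * R)).
Hypotheses (oD : open D) (bD : bounded_set D).
Notation mu := (@area R).
Local Notation N := (nrm (@tdirichlet R D)).
Local Notation tsub := (sub (@tadd R D) (@tscl R D)).

Let mD : @measurable _ (meas2 R) D := open_plane_measurable oD.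

(** If u and v agreed almost everywhere, the Laplacians of u_k and of v_k
    would have the same limit in the mean. *)
Lemma apart_limits (u_ v_ : nat -> test_space D) u v d :
  W22_cvg D (fun k => tfun (u_ k)) u -> W22_cvg D (fun k => tfun (v_ k)) v ->
  0 < d -> (forall k, d <= N (tsub (v_ k) (u_ k))) -> ~ ae_eq mu D u v.
Proof.
move=> cu cv d0 Hd uv; have [_ [_ [mv _] _] _] := cv.
have cuv := W22_cvg_ae oD bD cu mv uv.
have [_ IL c1] := lap_cvg oD cuv; have [_ _ c2] := lap_cvg oD cv.
have d8 : 0 < d ^+ 2 / 8 by rewrite divr_gt0// exprn_gt0.
move/cvgrPdist_le : c1 => /(_ _ d8)[K1 _ HK1].
move/cvgrPdist_le : c2 => /(_ _ d8)[K2 _ HK2].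
pose k := maxn K1 K2.
have := HK1 k (leq_maxl _ _); have := HK2 k (leq_maxr _ _).
rewrite /= !sub0r !normrN !ger0_norm ?sqn_ge0// => h1 h2.
have h3 := nrm_tsub_le oD bD (v_ k) (u_ k) IL.
have h4 : d ^+ 2 <= N (tsub (v_ k) (u_ k)) ^+ 2.
  by rewrite ler_sqr ?nnegrE ?nrm_ge0 ?(ltW d0).
have h5 := le_trans h4 h3; move: d8 h1 h2 h5.
move: (\int[mu]_(x in D) _) (\int[mu]_(x in D) _) => x y; lra.
Qed.

End distinct.

Theorem theorem3p4 (R : realType) (D : set (R * R)) (f : R * R -> R)
    (domD : is_domain D) (bndD : bounded_set D) (smoothD : smooth_boundary D)
    (intf : (@area R).-integrable D (EFin \o f)) :
  exists2 lambda0 : R, 0 < lambda0 &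
    forall lambda : R, 0 < lambda < lambda0 ->
      exists u v : R * R -> R,
        [/\ is_solution D f lambda u, is_solution D f lambda v
          & ~ ae_eq (@area R) D u v].
Proof.
have [oD D0 _] := domD.
have [c c0 supN] := tsup_nrm oD bndD.
have [kappa kappa0 loadN] := load_le oD bndD intf.
have [w tw w0] := exists_trilinear_pos oD bndD D0.
have [|lambda0 lambda0_gt0 H] := two_approximate_solutions
  (tdirichlet_inner oD bndD) (ttrilinear_sym oD bndD) (load_linear oD intf)
  c0 kappa0 (@tsup_ge0 R D) (ttrilinear_le oD bndD) supN loadN
  (tsup_compact oD bndD).
  by exists (exist _ w tw).
exists lambda0 => // lambda /H [u_ [v_ [[cu _ ru] [cv _ rv] [d d0 Hd]]]].
have [u Wu lu] := cauchy_W22_limit oD bndD cu.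
have [v Wv lv] := cauchy_W22_limit oD bndD cv.
exists u, v; split.
- exact: (@limit_solution _ _ _ oD bndD intf lambda _ _ Wu lu ru).
- exact: (@limit_solution _ _ _ oD bndD intf lambda _ _ Wv lv rv).
- exact: (@apart_limits _ _ oD bndD _ _ _ _ _ lu lv d0 Hd).
Qed.
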